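(* Let $U,V,W\subset\mathbb{C}$ be nonempty compact sets. Suppose that $(U,V,W)$ is compatible and $\kappa(U,V,W)=0$, so that every finite section method (FSM) with integer cut-offs $l_n\to-\infty$ and $r_n\to\infty$ is applicable to every $A\in\Psi E(U,V,W)$, and every FSM with $l_n=1$ and $r_n\to\infty$ is applicable to every $A_+\in\Psi E_+(U,V,W)$. Let $p,q\in[1,\infty]$ with $p^{-1}+q^{-1}=1$ and suppose also that $p$ and $q$ are both favourable for $(U,V,W)$. Let $A\in\Psi E(U,V,W)$ and $A_+\in\Psi E_+(U,V,W)$. Then, for all these finite section methods, with $(A_n)$ denoting the finite sections (of $A$, respectively of $A_+$), $$\|A_n\|_p\to\|A\|_p=\|A_+\|_p=\mathcal{M}_p,\qquad \|A_n^{-1}\|_p\to\|A^{-1}\|_p=\|A_+^{-1}\|_p=\mathcal{N}_p,$$ so that $$\operatorname{cond}_p(A_n)\to\operatorname{cond}_p(A)=\operatorname{cond}_p(A_+)$$ as $n\to\infty$. Further, $$\max_{B\in M(U,V,W)}\operatorname{cond}_p(B)=\max_{B_+\in M_+(U,V,W)}\operatorname{cond}_p(B_+)=\sup_{F\in M_{\rm fin}(U,V,W)}\operatorname{cond}_p(F)=\mathcal{M}_p\mathcal{N}_p,$$ where the two maxima are attained, respectively, by all $A\in\Psi E(U,V,W)$, and by all $A_+\in\Psi E_+(U,V,W)$.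
   Context: $\mathbb{N}=\{1,2,\dots\}$, and $\infty^{-1}:=0$. $M(U,V,W)$ is the set of bi-infinite tridiagonal matrices $A=(a_{ij})_{i,j\in\mathbb{Z}}$ with $a_{i,i-1}\in U$, $a_{i,i}\in V$, $a_{i,i+1}\in W$ for all $i$, all other entries zero. $M_+(U,V,W)$ is the set of semi-infinite tridiagonal matrices $(a_{ij})_{i,j\in\mathbb{N}}$ with subdiagonal entries in $U$, diagonal entries in $V$, superdiagonal entries in $W$, all other entries zero. $M_n(U,V,W)$ is the set of $n\times n$ matrices of the same kind, and $M_{\rm fin}(U,V,W)=\bigcup_{n\in\mathbb{N}}M_n(U,V,W)$. They act as bounded operators on $\ell^p(\mathbb{Z})$, $\ell^p(\mathbb{N})$, $\mathbb{C}^n$ with the $p$-norm; $\|\cdot\|_p$ is the induced operator norm; $\operatorname{cond}_p(B):=\|B\|_p\|B^{-1}\|_p$. Invertibility, Fredholmness and Fredholm index of the infinite ones do not depend on $p$. $A\in M(U,V,W)$ is pseudoergodic, $A\in \Psi E(U,V,W)$, if for every $n\in\mathbb N$, every $B\in M_n(U,V,W)$ and every $\varepsilon>0$ there is a submatrix $C$ of $A$ composed of rows and columns $k+1,\dots,k+n$ of $A$, for some integer $k$, with $\|B-C\|<\varepsilon$; $\Psi E_+(U,V,W)\subset M_+(U,V,W)$ is defined in the same way. $(U,V,W)$ is compatible if all operators in $M(U,V,W)$ are invertible (equivalently, all operators in $M_+(U,V,W)$ are Fredholm). If $(U,V,W)$ is compatible, all $B_+\in M_+(U,V,W)$ are Fredholm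 with one and the same index, denoted $\kappa(U,V,W)\in\{-1,0,1\}$; if this is $0$, all operators in $M_+(U,V,W)$ are invertible. $\mathcal{M}_p:=\max_{B\in M(U,V,W)}\|B\|_p$ and, for compatible $(U,V,W)$, $\mathcal{N}_p:=\max_{B\in M(U,V,W)}\|B^{-1}\|_p$ (both maxima are attained by every $B\in\Psi E(U,V,W)$). When $(U,V,W)$ is compatible with $\kappa(U,V,W)=0$, $p$ is called favourable (for $(U,V,W)$) if $\|A_+^{-1}\|_p=\max_{C_+\in M_+(U,V,W)}\|C_+^{-1}\|_p=\mathcal{N}_p$ for all $A_+\in\Psi E_+(U,V,W)$. FSM: with cut-off sequences $(l_n),(r_n)$, the finite sections of $A=(a_{ij})$ are $A_n=(a_{ij})_{i,j=l_n}^{r_n}$, and $Ax=b$ is replaced by $\sum_{l_n\le j\le r_n}a_{ij}x_n(j)=b(i)$, $l_n\le i\le r_n$. The FSM applies to $A$ if $A$ is invertible, the truncated systems are uniquely solvable for all sufficiently large $n$, and, for every $b$, $\|x_n-x\|\to0$ if $p<\infty$, while $\|x_n\|=O(1)$ and $x_n(j)\to x(j)$ for every $j$ if $p=\infty$, where $x$ solves $Ax=b$. *)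

(* Defs.v *)
From mathcomp Require Import all_boot all_order all_algebra.
From mathcomp Require Import all_classical all_reals all_analysis.
From mathcomp Require Import complex.

Set Implicit Arguments.
Unset Strict Implicit.
Unset Printing Implicit Defensive.

Import Order.TTheory GRing.Theory Num.Theory numFieldNormedType.Exports.

Local Open Scope classical_set_scope.
Local Open Scope ring_scope.

(* Matrices over an index type [I] are functions [I -> I -> R[i]]; [I] is [int]
   for bi-infinite matrices, [nat] for semi-infinite ones (so that the paper's
   index k >= 1 is k - 1 here), ['I_n] for n x n matrices, and a finite window
   of [int] or [nat] for finite sections. *)

Section LpOperators.
Variables (R : realType) (I : choiceType).
Implicit Types (p : \bar R) (x y : I -> R[i]) (a : I -> I -> R[i]).
Implicit Types (T : (I -> R[i]) -> (I -> R[i])).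

Definition lpnorm p x : \bar R :=
  match p with
  | r%:E => ((\esum_(i in [set: I]) (Normc.normc (x i) `^ r)%:E) `^ r^-1)%E
  | +oo%E => ereal_sup [set (Normc.normc (x i))%:E | i in [set: I]]
  | -oo%E => 0%E
  end.

Definition lp p : set (I -> R[i]) := [set x | (lpnorm p x < +oo)%E].

Definition opnorm p T : \bar R :=
  ereal_sup [set lpnorm p (T x) | x in [set x | (lpnorm p x <= 1)%E]].

Definition lp_bounded p T : Prop :=
  set_fun (lp p) (lp p) T /\ (opnorm p T < +oo)%E.

(* The sum has finite support when the rows of [a] do. *)
Definition matop a x : I -> R[i] := fun i => \sum_(j \in [set: I]) a i j * x j.

Definition opinv p T : (I -> R[i]) -> (I -> R[i]) :=
  'pinv_(fun=> fun=> 0) (lp p) T.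

Definition lp_invertible p T : Prop :=
  [/\ lp_bounded p T, set_bij (lp p) (lp p) T & lp_bounded p (opinv p T)].

(* [K] is a linear subspace with a basis of [d] elements. *)
Definition has_dim (K : set (I -> R[i])) (d : nat) : Prop :=
  exists e : 'I_d -> I -> R[i], forall x,
    K x <-> exists! c : {ffun 'I_d -> R[i]},
              x = (fun i => \sum_(k < d) c k * e k i).

(* The classes of [f_1, ..., f_d] form a basis of l^p / T(l^p). *)
Definition has_codim_range p T (d : nat) : Prop :=
  exists2 f : 'I_d -> I -> R[i], (forall k, lp p (f k)) &
    forall y, lp p y -> exists! c : {ffun 'I_d -> R[i]},
      exists2 x, lp p x & y = (fun i => T x i + \sum_(k < d) c k * f k i).

Definition lp_fredholm_index p T (k : int) : Prop :=
  lp_bounded p T /\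
  exists d d' : nat, [/\ has_dim [set x | lp p x /\ T x = (fun=> 0)] d,
    has_codim_range p T d' & k = d%:Z - d'%:Z].

(* For tridiagonal matrices with bounded entries these two notions do not
   depend on the exponent [s]. *)
Definition invertible a : Prop :=
  exists2 s : \bar R, (1 <= s)%E & lp_invertible s (matop a).

Definition fredholm_index a (k : int) : Prop :=
  exists2 s : \bar R, (1 <= s)%E & lp_fredholm_index s (matop a) k.

Definition mxnorm p a : \bar R := opnorm p (matop a).

Definition invnorm p a : \bar R :=
  if `[< lp_invertible p (matop a) >] then opnorm p (opinv p (matop a))
  else +oo%E.

(* The case distinction matters because [0 * +oo = 0] in [\bar R]. *)
Definition cond p a : \bar R :=
  if `[< lp_invertible p (matop a) >] then (mxnorm p a * invnorm p a)%E
  else +oo%E.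

Definition index_in (D : set I) : choiceType := set_type D.

Definition finsec a (D : set I) : index_in D -> index_in D -> R[i] :=
  fun i j => a (set_val i) (set_val j).

(* [x] solves the system truncated to [D], extended by zero outside [D]. *)
Definition truncated_solution a (D : set I) (b x : I -> R[i]) : Prop :=
  (forall i, ~ D i -> x i = 0) /\
  (forall i, D i -> \sum_(j \in D) a i j * x j = b i).

Definition fsm_applies p a (D : nat -> set I) : Prop :=
  [/\ lp_invertible p (matop a),
      \forall n \near \oo, forall b, lp p b ->
        exists! x, truncated_solution a (D n) b x
    & forall b x (xn : nat -> I -> R[i]), lp p b -> lp p x -> matop a x = b ->
        (\forall n \near \oo, truncated_solution a (D n) b (xn n)) ->
        ((p < +oo)%E ->
           lpnorm p (fun j => xn n j - x j) @[n --> \oo] --> 0%E) /\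
        (p = +oo%E ->
           (exists K : R, \forall n \near \oo, (lpnorm p (xn n) <= K%:E)%E) /\
           (forall j, (xn n j : R[i]^o) @[n --> \oo] --> (x j : R[i]^o)))].

End LpOperators.

Section Tridiagonal.
Variable R : realType.
Variables U V W : set R[i].
Implicit Types (p : \bar R).

(* [pos] gives the position of an index on the integer line. *)
Definition tridiagonal (I : Type) (pos : I -> int) : set (I -> I -> R[i]) :=
  [set a | forall i j,
     [/\ pos i = pos j + 1 -> U (a i j),
         pos i = pos j -> V (a i j),
         pos j = pos i + 1 -> W (a i j)
       & 1 < `|pos i - pos j| -> a i j = 0]].

Definition Mbi : set (int -> int -> R[i]) := tridiagonal id.

Definition Mplus : set (nat -> nat -> R[i]) := tridiagonal Posz.

Definition Mn (n : nat) : set 'M[R[i]]_n :=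
  [set B | tridiagonal (fun i : 'I_n => (i : nat)%:Z) (fun_of_matrix B)].

(* The choice of the norm on n x n matrices is immaterial here. *)
Definition PsiE : set (int -> int -> R[i]) :=
  [set A | Mbi A /\ forall (n : nat) (B : 'M[R[i]]_n) (e : R),
     (0 < n)%N -> Mn B -> 0 < e -> exists k : int,
     let C := \matrix_(i < n, j < n) A (k + 1 + i%:Z) (k + 1 + j%:Z) in
     (mxnorm 2%:E (fun_of_matrix (B - C)) < e%:E)%E].

Definition PsiEplus : set (nat -> nat -> R[i]) :=
  [set A | Mplus A /\ forall (n : nat) (B : 'M[R[i]]_n) (e : R),
     (0 < n)%N -> Mn B -> 0 < e -> exists k : nat,
     let C := \matrix_(i < n, j < n) A (k + i)%N (k + j)%N in
     (mxnorm 2%:E (fun_of_matrix (B - C)) < e%:E)%E].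

Definition compatible : Prop := forall A, Mbi A -> invertible A.

(* "kappa(U, V, W) = k" *)
Definition kappa_is (k : int) : Prop :=
  forall B, Mplus B -> fredholm_index B k.

(* The two suprema below are maxima: they are attained on [PsiE]. *)
Definition Mnorm p : \bar R := ereal_sup [set mxnorm p B | B in Mbi].

Definition Nnorm p : \bar R := ereal_sup [set invnorm p B | B in Mbi].

Definition favourable p : Prop := forall A, PsiEplus A ->
  invnorm p A = ereal_sup [set invnorm p C | C in Mplus] /\
  invnorm p A = Nnorm p.

Definition fin_conds p : set (\bar R) :=
  \bigcup_(n in [set n | (0 < n)%N])
    [set cond p (fun_of_matrix F) | F in @Mn n].

End Tridiagonal.

Definition is_max (R : realType) (S : set (\bar R)) (m : \bar R) : Prop :=
  S m /\ ubound S m.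

Definition window (l r : int) : set int := [set i | l <= i <= r].

(* The 1-based indices 1, ..., r. *)
Definition window_plus (r : nat) : set nat := [set i | (i < r)%N].

(* Main.v *)
(* Consider the compressions of the operators in M(U,V,W) to intervals of Z,
   finite or not. If all of them are injective on bounded vectors, then shifting
   almost-maximal entries to 0 and passing to an ultralimit yields a lower bound
   which is uniform over the whole class and stable under exponential weights,
   hence valid in every l^p.

   Compatibility gives injectivity on the line. A bounded kernel vector on a
   half-line and one of a transpose can be glued along a separating zero to a
   kernel vector on the line; with index 0 this gives injectivity on all
   half-lines (Coburn's lemma). A finite section is injective because copies of
   it, joined by separating rows, form a half-line operator; in the same way its
   inverse is bounded by those of half-line operators in M_+(U,V,W) or
   M_+(W,V,U). For the former the bound is N_p as p is favourable, for the latter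
   it follows by duality from q being favourable.

   Both norms are lower semicontinuous with respect to entrywise limits of
   translates, since slowly varying cut-offs almost commute with tridiagonal
   operators. This gives the values at pseudoergodic operators and the lower
   bounds for the norms of the finite sections. *)
Require Import Defs.
From mathcomp Require Import all_boot all_order all_algebra.
From mathcomp Require Import all_classical all_reals all_analysis.
From mathcomp Require Import complex.
From mathcomp Require Import ring lra zify.
Set Implicit Arguments.
Unset Strict Implicit.
Unset Printing Implicit Defensive.
Import Order.TTheory GRing.Theory Num.Theory numFieldNormedType.Exports.
Import Normc.
Local Open Scope classical_set_scope.
Local Open Scope complex_scope.
Local Open Scope ring_scope.

(** The exponents hidden in [compatible] and [kappa_is] may change from operator to operator, and
    neither hypothesis comes with a uniform estimate. Injectivity on bounded vectors removes both
    defects: it mentions no exponent, and by compactness it is automatically quantitative.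
    Surjectivity then comes for free, since finite square sections are solvable once they are
    injective, and uniform bounds let their solutions converge.

    Tridiagonality enters twice: commutators with slowly varying weights only see differences of
    neighbouring weights, and a zero entry decouples its two sides up to one scalar equation. That
    single equation is what scaling the glued pieces can solve.

    Transposition and reflection each lead from M(U,V,W) to M(W,V,U). On the line their composition
    stays in M(U,V,W), so N_p = N_q; on a half-line the reflection reverses the direction. This is
    why half-line operators of M(W,V,U), which appear when a block has to be reflected before its
    copies can be joined, require the exponent q. *)

Section Normc.
Variable R : realType.
Implicit Types x y : R[i].

Lemma normc_ge0 x : 0 <= normc x.
Proof. by case: x => a b; rewrite sqrtr_ge0. Qed.

(* [normcN] and [le_normcD] of the library are about the type [Rcomplex R]. *)
Lemma normcN x : normc (- x) = normc x. Proof. exact: normcN. Qed.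
Lemma normcD x y : normc (x + y) <= normc x + normc y.
Proof. exact: le_normcD. Qed.
Lemma normcB x y : normc (x - y) = normc (y - x).
Proof. by rewrite -normcN opprB. Qed.

Lemma absC_normc x : `|x| = (normc x)%:C. Proof. by case: x. Qed.

Lemma normc_eq0 x : (normc x == 0) = (x == 0).
Proof.
by apply/eqP/eqP => [|->]; [exact: eq0_normc|exact: normc0].
Qed.

Lemma normc_real (a : R) : normc (a%:C) = `|a|.
Proof. by rewrite /= expr0n /= addr0 sqrtr_sqr. Qed.

Lemma normcX x n : normc (x ^+ n) = normc x ^+ n.
Proof.
by elim: n => [|n IH]; rewrite ?expr0 ?normc1// !exprS normcM IH.
Qed.

Lemma normc_sum (T : Type) (s : seq T) (f : T -> R[i]) :
  normc (\sum_(i <- s) f i) <= \sum_(i <- s) normc (f i).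
Proof.
elim: s => [|a s IH]; first by rewrite !big_nil normc0.
by rewrite !big_cons (le_trans (normcD _ _))// lerD2l.
Qed.

Lemma normc_le_ReIm x : normc x <= `|complex.Re x| + `|complex.Im x|.
Proof.
case: x => a b /=; have s0 : 0 <= `|a| + `|b| by rewrite addr_ge0.
rewrite -[leRHS](ger0_norm s0) -sqrtr_sqr; apply: ler_wsqrtr.
rewrite -(real_normK (num_real a)) -(real_normK (num_real b)) sqrrD.
have : 0 <= `|a| * `|b| *+ 2 by rewrite mulrn_wge0// mulr_ge0.
lra.
Qed.

Lemma normc_small x : (forall e : R, 0 < e -> normc x < e) -> x = 0.
Proof.
move=> h; apply/eqP; rewrite -normc_eq0; apply/negPn/negP => h0.
have : 0 < normc x by rewrite lt_neqAle eq_sym h0 normc_ge0.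
by move=> /h; rewrite ltxx.
Qed.

End Normc.

#[local] Hint Extern 0 (is_true (0 <= normc _)) => exact: normc_ge0 : core.

(** * Real powers: convexity and roots *)

Section PowR.
Variable R : realType.
Implicit Types (a b m r : R).

Lemma powR_convex r (t a b : R) : 1 <= r -> 0 <= t <= 1 -> 0 <= a -> 0 <= b ->
  (t * a + (1 - t) * b) `^ r <= t * a `^ r + (1 - t) * b `^ r.
Proof.
move=> r1 /andP[t0 t1] a0 b0.
by apply: (convex_powR r1 (Itv01 t0 t1)) => //=; rewrite inE/= in_itv/= ?a0 ?b0.
Qed.

Lemma powR_le r a b : 0 < r -> 0 <= a -> 0 <= b -> (a `^ r <= b `^ r) = (a <= b).
Proof.
move=> r0 a0 b0; apply/idP/idP => h; last first.
  by apply: (ge0_ler_powR (ltW r0)) => //; rewrite nnegrE.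
rewrite leNgt; apply/negP => ba.
have : b `^ r < a `^ r by apply: (gt0_ltr_powR r0) => //; rewrite nnegrE.
by rewrite ltNge h.
Qed.

Lemma powRVK r a : 0 < r -> 0 <= a -> (a `^ r) `^ r^-1 = a.
Proof. by move=> r0 a0; rewrite -powRrM divff ?gt_eqF// powRr1. Qed.

Lemma powRKV r a : 0 < r -> 0 <= a -> (a `^ r^-1) `^ r = a.
Proof. by move=> r0 a0; rewrite -powRrM mulVf ?gt_eqF// powRr1. Qed.

Lemma powR_div r a m : 0 <= a -> 0 < m -> (a / m) `^ r = a `^ r / m `^ r.
Proof.
move=> a0 m0; have m'0 := ltW m0.
by rewrite powRM ?invr_ge0// -(powR_inv1 m'0) -powRrM mulN1r powRN.
Qed.

End PowR.

(** * Bounds on l^p norms by real numbers *)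

Section LpBound.
Variables (R : realType) (I : choiceType).
Implicit Types (p : \bar R) (x y : I -> R[i]) (m k e : R).

(** A form of [lpnorm p x <= m] in which only finite sums of reals occur. Negative [m] must be
    excluded by hand, since the real power of a negative number is a junk value. *)
Definition lpb p x m : Prop := 0 <= m /\
  match p with
  | r%:E => forall s : seq I, uniq s -> \sum_(i <- s) normc (x i) `^ r <= m `^ r
  | +oo%E => forall i, normc (x i) <= m
  | -oo%E => True
  end.

Lemma fin_exp_gt0 (r : R) : (1 <= r%:E)%E -> 0 < r.
Proof. by rewrite lee_fin; apply: lt_le_trans. Qed.

Lemma lpbP p x m : (1 <= p)%E -> 0 <= m -> (lpnorm p x <= m%:E)%E <-> lpb p x m.
Proof.
case: p => [r| |]//= r1 m0; last first.
  split=> [h|[_ h]]; last by apply: ge_ereal_sup => _ [i _ <-]; rewrite lee_fin.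
  split=> // i; rewrite -lee_fin; apply: le_trans h.
  by apply: ereal_sup_ubound; exists i.
rewrite lee_fin in r1; have r0 : 0 < r by apply: lt_le_trans r1.
set S := esum _ _.
have S0 : (0 <= S)%E by apply: esum_ge0 => i _; rewrite lee_fin powR_ge0.
have -> : ((S `^ r^-1 <= m%:E)%E = (S <= (m `^ r)%:E)%E).
  move: S0; case: S => [s| |]//=; last first.
    by move=> _; rewrite (_ : ((r^-1 == 0) = false)) ?invr_eq0 ?gt_eqF.
  rewrite !lee_fin => s0.
  by rewrite -[in RHS](powRKV r0 s0) powR_le ?powR_ge0.
split=> [h|[_ h]].
  split=> // s us; rewrite -lee_fin; apply: le_trans h.
  rewrite -sumEFin; apply: ereal_sup_ubound; exists [set` s].
    by split=> //; exact: finite_seq.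
  by rewrite (fsbig_seq _ _ us).
apply: ge_ereal_sup => _ [X [fX _] <-].
by rewrite fsbig_finite//= sumEFin lee_fin h.
Qed.

Lemma lpb_ge0 p x m : lpb p x m -> 0 <= m. Proof. by case. Qed.

Lemma lpb_rootP r x m : 1 <= r -> 0 <= m ->
  lpb r%:E x m <->
  forall s, uniq s -> (\sum_(i <- s) normc (x i) `^ r) `^ r^-1 <= m.
Proof.
move=> r1 m0; have r0 : 0 < r by apply: lt_le_trans r1.
have S0 s : 0 <= \sum_(i <- s) normc (x i) `^ r.
  by apply: sumr_ge0 => i _; exact: powR_ge0.
split=> [[_ h] s us|h]; last split=> // s us.
  by rewrite -(powRVK r0 m0) powR_le ?powR_ge0 ?invr_gt0 ?h.
by rewrite -[leLHS](powRKV r0)// powR_le ?powR_ge0 ?h.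
Qed.

Lemma lpb_pt p x m i : (1 <= p)%E -> lpb p x m -> normc (x i) <= m.
Proof.
case: p => [r| |]//=; last by move=> _ [_ /(_ i)].
rewrite lee_fin => r1 [m0 /(_ [:: i] isT)].
have r0 : 0 < r by apply: lt_le_trans r1.
by rewrite big_seq1; rewrite powR_le.
Qed.

Lemma lpb_le p x y m : (1 <= p)%E ->
  (forall i, normc (x i) <= normc (y i)) -> lpb p y m -> lpb p x m.
Proof.
case: p => [r| |]//= r1 xy [m0 h]; split=> //; last first.
  by move=> i; exact: le_trans (h i).
move=> s us; apply: le_trans (h s us); apply: ler_sum => i _.
by rewrite powR_le// (fin_exp_gt0 r1).
Qed.

Lemma lpb_mono p x m k : (1 <= p)%E -> m <= k -> lpb p x m -> lpb p x k.
Proof.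
case: p => [r| |]//= r1 mk [m0 h]; split; rewrite ?(le_trans m0)//; last first.
  by move=> i; exact: le_trans (h i) mk.
move=> s us; apply: le_trans (h s us) _.
by rewrite powR_le ?(le_trans m0)// (fin_exp_gt0 r1).
Qed.

Lemma lpb0 p x m : (1 <= p)%E -> 0 <= m -> (forall i, x i = 0) -> lpb p x m.
Proof.
case: p => [r| |]//= r1 m0 x0; split=> //; last by move=> i; rewrite x0 normc0.
move=> s us; rewrite big1 ?powR_ge0// => i _; rewrite x0 normc0 powR0//.
by rewrite gt_eqF// (fin_exp_gt0 r1).
Qed.

(** Minkowski's inequality from convexity of the r-th power: |x i| + |y i| is m + k times the convex
    combination of |x i| / m and |y i| / k with weights m / (m + k) and k / (m + k). The degenerate
    cases m = 0 and k = 0 are split off so that these quotients make sense. *)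
Lemma lpbD p x y m k : (1 <= p)%E ->
  lpb p x m -> lpb p y k -> lpb p (fun i => x i + y i) (m + k).
Proof.
move=> p1 hx hy; have [m0 k0] := (lpb_ge0 hx, lpb_ge0 hy).
have [mz|mn0] := eqVneq m 0.
  have x0 i : x i = 0.
    apply/eqP; rewrite -normc_eq0 eq_le normc_ge0 andbT -mz; exact: lpb_pt hx.
  by rewrite mz add0r; apply: lpb_le hy => // i; rewrite x0 add0r.
have [kz|kn0] := eqVneq k 0.
  have y0 i : y i = 0.
    apply/eqP; rewrite -normc_eq0 eq_le normc_ge0 andbT -kz; exact: lpb_pt hy.
  by rewrite kz addr0; apply: lpb_le hx => // i; rewrite y0 addr0.
have {mn0 m0}m0 : 0 < m by rewrite lt_neqAle eq_sym mn0.
have {kn0 k0}k0 : 0 < k by rewrite lt_neqAle eq_sym kn0.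
have mk0 : 0 < m + k by lra.
case: p p1 hx hy => [r| |]//= p1 [_ hx] [_ hy]; (split; first exact: ltW); last first.
  by move=> i; rewrite (le_trans (normcD _ _))// lerD.
move=> s us; rewrite lee_fin in p1; have r0 : 0 < r by apply: lt_le_trans p1.
pose t := m / (m + k).
have t01 : 0 <= t <= 1.
  by rewrite divr_ge0 ?(ltW m0) ?(ltW mk0)//= ler_pdivrMr// mul1r lerDl ltW.
have t1E : 1 - t = k / (m + k) by rewrite /t; field; rewrite gt_eqF.
have key i : normc (x i + y i) `^ r <=
    (m + k) `^ r * (t * (normc (x i) `^ r / m `^ r)
                    + (1 - t) * (normc (y i) `^ r / k `^ r)).
  have -> : normc (x i) `^ r / m `^ r = (normc (x i) / m) `^ r.
    by rewrite powR_div.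
  have -> : normc (y i) `^ r / k `^ r = (normc (y i) / k) `^ r.
    by rewrite powR_div.
  have nx : 0 <= normc (x i) / m by rewrite divr_ge0 ?(ltW m0).
  have ny : 0 <= normc (y i) / k by rewrite divr_ge0 ?(ltW k0).
  apply: le_trans (ler_wpM2l (powR_ge0 _ _) (powR_convex p1 t01 nx ny)).
  rewrite -powRM ?(ltW mk0)//; last first.
    by rewrite addr_ge0// mulr_ge0//; case/andP: t01 => // ? ?; rewrite subr_ge0.
  have -> : (m + k) * (t * (normc (x i) / m) + (1 - t) * (normc (y i) / k)) =
     normc (x i) + normc (y i).
    by rewrite t1E /t; field; rewrite !gt_eqF.
  by rewrite powR_le ?addr_ge0// normcD.
apply: (le_trans (ler_sum _ (fun i _ => key i))).
rewrite -mulr_sumr ler_piMr ?powR_ge0// big_split/= -!mulr_sumr -!mulr_suml.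
have {}hx : (\sum_(i <- s) normc (x i) `^ r) / m `^ r <= 1.
  by rewrite ler_pdivrMr ?powR_gt0// mul1r hx.
have {}hy : (\sum_(i <- s) normc (y i) `^ r) / k `^ r <= 1.
  by rewrite ler_pdivrMr ?powR_gt0// mul1r hy.
case/andP: t01 => t0 t1; have t1' : 0 <= 1 - t by lra.
by move: (ler_wpM2l t0 hx) (ler_wpM2l t1' hy); lra.
Qed.

Lemma lpbZ p x m (z : R[i]) : (1 <= p)%E ->
  lpb p x m -> lpb p (fun i => z * x i) (normc z * m).
Proof.
move=> p1 [m0 h]; split; first by rewrite mulr_ge0.
case: p p1 h => [r| |]//= p1 h; last by move=> i; rewrite normcM ler_wpM2l.
move=> s us; rewrite powRM//; apply: le_trans (ler_wpM2l (powR_ge0 _ _) (h s us)).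
by rewrite mulr_sumr; apply: ler_sum => i _; rewrite normcM powRM.
Qed.

Lemma lpb_leZ p x y m e : (1 <= p)%E -> 0 <= e ->
  (forall i, normc (x i) <= e * normc (y i)) -> lpb p y m -> lpb p x (e * m).
Proof.
move=> p1 e0 h hy.
have := lpbZ e%:C p1 hy; rewrite normc_real ger0_norm//.
by apply: lpb_le => // i; rewrite normcM normc_real ger0_norm.
Qed.

Lemma lpb_delta p i z : (1 <= p)%E ->
  lpb p (fun j => if j == i then z else 0) (normc z).
Proof.
case: p => [r| |]//= p1; split=> //; last by move=> j; case: eqP; rewrite ?normc0.
rewrite lee_fin in p1; have r0 : r != 0 by rewrite gt_eqF// (lt_le_trans _ p1).
move=> s us; have [si|si] := boolP (i \in s).
  rewrite (bigD1_seq i)//= eqxx big1 ?addr0// => j /negbTE ->.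
  by rewrite normc0 powR0.
rewrite big_seq big1 ?powR_ge0// => j js.
by case: eqP js si => [->->//|_ _ _]; rewrite normc0 powR0.
Qed.

Lemma lpb_indicator p j : (1 <= p)%E -> lpb p (fun i => (i == j)%:R) 1.
Proof.
move=> p1; rewrite -[X in lpb _ _ X](@normc1 R).
by apply: lpb_le (lpb_delta j 1 p1) => // i; case: eqP; rewrite ?normc0.
Qed.

Lemma lpb_finsupp p x e (s : seq I) : (1 <= p)%E -> 0 <= e ->
  (forall i, i \notin s -> x i = 0) -> (forall i, normc (x i) <= e) ->
  lpb p x (e *+ size s).
Proof.
move=> p1 e0; elim: s x => [|a s IH] x xs xe /=.
  by apply: lpb0 => // i; exact: xs.
have h1 : lpb p (fun i => if i \in s then x i else 0) (e *+ size s).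
  by apply: IH => i; [move=> /negbTE ->|case: ifP => // _; rewrite normc0].
have h2 : lpb p (fun j => if j == a then x a else 0) e.
  exact: lpb_mono (lpb_delta _ _ p1).
rewrite mulrS; apply: lpb_le (lpbD p1 h2 h1) => // i.
have [-> |ia] := eqVneq i a; last first.
  rewrite add0r; case: ifPn => // is_; rewrite xs// inE negb_or ia.
  done.
case: ifP => as_; last by rewrite addr0.
rewrite -[x a + x a]mulr2n -[_ *+ 2]mulr_natl normcM ler_peMl//.
by rewrite (_ : 2%:R = (2 : R)%:C) ?normc_real ?rmorph_nat// ger0_norm// ler1n.
Qed.

Lemma lpb_cl p x m : (1 <= p)%E -> (forall e, 0 < e -> lpb p x (m + e)) ->
  lpb p x m.
Proof.
move=> p1 h; have m0 : 0 <= m.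
  by apply/ler_addgt0Pr => e /h /lpb_ge0.
case: p p1 h => [r| |]//= p1 h; last first.
  by split=> // i; apply/ler_addgt0Pr => e /h [_].
apply/lpb_rootP => // s us; apply/ler_addgt0Pr => e e0.
by have /lpb_rootP := h e e0; apply => //; rewrite addr_ge0// ltW.
Qed.

Lemma lpb_restr p x m (s : seq I) : (1 <= p)%E ->
  lpb p x m -> lpb p (fun i => if i \in s then x i else 0) m.
Proof. by move=> p1; apply: lpb_le => // i; case: ifP => // _; rewrite normc0. Qed.

Lemma lpb_fin p x m : (1 <= p)%E -> 0 <= m ->
  (forall s : seq I, lpb p (fun i => if i \in s then x i else 0) m) -> lpb p x m.
Proof.
case: p => [r| |]//= p1 m0 h; split=> //.
  move=> s us; have [_ /(_ s us)] := h s; congr (_ <= _).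
  by apply: eq_big_seq => i ->.
by move=> i; have [_ /(_ i)] := h [:: i]; rewrite inE eqxx.
Qed.

(* Fatou's lemma *)
Lemma lpb_lim (T : Type) (F : set_system T) (FF : ProperFilter F)
    p (xn : T -> I -> R[i]) x m : (1 <= p)%E ->
  (forall i e, 0 < e -> F [set t | normc (xn t i - x i) < e]) ->
  F [set t | lpb p (xn t) m] -> lpb p x m.
Proof.
move=> p1 cv hb.
have m0 : 0 <= m by have [t] := filter_ex hb; exact: lpb_ge0.
apply: lpb_fin => // s; apply: lpb_cl => // e e0.
(* On the finite set [s] the crude estimate [lpb_finsupp] costs a factor [size s], which is harmless
   because [d] is chosen after [s]. *)
pose d := e / (size s).+1%:R.
have d0 : 0 < d by rewrite divr_gt0.
have all_s : F [set t | forall i, i \in s -> normc (xn t i - x i) < d].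
  elim: (s) => [|a u IH]; first by apply: filterS filterT.
  apply: filterS (filterI (cv a d d0) IH) => t [/= ha hu] i.
  by rewrite inE => /orP[/eqP ->|/hu].
have [t [/= tb ts]] := filter_ex (filterI hb all_s).
have h1 := lpb_restr s p1 tb.
have h2 : lpb p (fun i => if i \in s then x i - xn t i else 0) (d *+ size s).
  apply: lpb_finsupp => //; [exact: ltW|by move=> i /negbTE ->|].
  move=> i; case: ifP => [/ts|]; last by rewrite normc0 ltW.
  by rewrite normcB => /ltW.
have := lpbD p1 h1 h2.
move=> /(lpb_mono p1 _ (k := m + e)); rewrite lerD2l.
have -> : d *+ size s <= e.
  rewrite /d -mulr_natr -mulrAC ler_pdivrMr// ler_wpM2l ?(ltW e0)//.
  by rewrite ler_nat.
move=> /(_ isT); apply: lpb_le => // i.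
by case: ifP => _; rewrite ?addr0// addrC subrK.
Qed.

End LpBound.

Lemma ler_sum_supp (R : realType) (I : eqType) (s t : seq I) (f : I -> R) :
  uniq s -> (forall i, i \in s -> f i != 0 -> i \in t) -> (forall i, 0 <= f i) ->
  \sum_(i <- s) f i <= \sum_(i <- t) f i.
Proof.
move=> us st f0; elim: s t us st => [|a s IH] t /=.
  by move=> _ _; rewrite big_nil sumr_ge0.
move=> /andP[as_ us] st; rewrite big_cons; have [->|fa] := eqVneq (f a) 0.
  by rewrite add0r; apply: IH => // i is_; apply: st; rewrite inE is_ orbT.
have at_ : a \in t by apply: st => //; rewrite mem_head.
rewrite (perm_big _ (perm_to_rem at_))/= big_cons lerD2l; apply: IH => // i is_ fi.
have it : i \in t by apply: st => //; rewrite inE is_ orbT.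
have : i \in a :: rem a t by rewrite -(perm_mem (perm_to_rem at_)).
by rewrite inE => /predU1P[ia|//]; move: as_; rewrite -ia is_.
Qed.

Section LpBound2.
Variables (R : realType) (I J : choiceType).
Implicit Types (p q : \bar R) (m k e : R).

Lemma lpb_inj p (f : I -> J) (x : J -> R[i]) m : injective f ->
  lpb p x m -> lpb p (x \o f) m.
Proof.
move=> finj [m0 h]; split=> //; case: p h => [r| |]//= h s us.
by have := h (map f s); rewrite big_map (map_inj_uniq finj); apply.
Qed.

Lemma lpb_ext p (f : I -> J) (x : I -> R[i]) (X : J -> R[i]) m : (1 <= p)%E ->
  (forall i, X (f i) = x i) -> (forall j, (forall i, f i <> j) -> X j = 0) ->
  lpb p x m -> lpb p X m.
Proof.
move=> p1 Xf X0 [m0 h]; split=> //.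
have imf j : X j != 0 -> exists i, f i = j.
  move=> Xj; apply: contrapT => /forallNP nf; move/eqP: Xj; apply.
  exact: X0.
case: p p1 h => [r| |]//= r1 h; last first.
  move=> j; have [->|Xj] := eqVneq (X j) 0; first by rewrite normc0.
  by have [i <-] := imf j Xj; rewrite Xf.
have rn0 : r != 0 by rewrite gt_eqF// fin_exp_gt0.
move=> s us.
have [t tE] : exists t, map f t = [seq j <- s | X j != 0].
  elim: {us}s => [|j s [t tE]] /=; first by exists [::].
  case: ifP => [/imf[i fij]|_]; last by exists t.
  by exists (i :: t); rewrite /= fij tE.
have ut : uniq t by apply: (@map_uniq _ _ f); rewrite tE filter_uniq.
rewrite (bigID (fun j => X j != 0))/= [X in _ + X]big1 => [|j /negPn/eqP ->]; last first.
  by rewrite normc0 powR0.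
rewrite addr0 -big_filter -tE big_map; under eq_bigr do rewrite Xf.
exact: h.
Qed.

Lemma lpb_ex p (x : I -> R[i]) : (1 <= p)%E -> lp p x <-> exists m, lpb p x m.
Proof.
move=> p1; split=> [h|[m h]]; last first.
  by rewrite /lp/= (@le_lt_trans _ _ m%:E) ?ltry//; apply/lpbP => //; exact: lpb_ge0 h.
exists (Num.max 0 (fine (lpnorm p x))); apply/lpbP => //.
  by rewrite le_max lexx.
by move: h; rewrite /lp/=; case: (lpnorm p x) => [a _|//|_]; rewrite ?leNye// lee_fin le_max lexx orbT.
Qed.

End LpBound2.

(** * Hoelder's inequality and its converse *)

Section Hoelder.
Variables (R : realType) (I : choiceType).
Implicit Types (p q : \bar R) (x y : I -> R[i]) (m k e : R).

Lemma conj_cases p q : (1 <= p)%E -> (1 <= q)%E -> (p^-1 + q^-1 = 1)%E ->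
  [\/ p = 1%E /\ q = +oo%E, p = +oo%E /\ q = 1%E |
   exists r s : R, [/\ p = r%:E, q = s%:E, 1 < r, 1 < s & r^-1 + s^-1 = 1]].
Proof.
case: p => [r| |]//; case: q => [s| |]//; rewrite ?lee_fin ?invey.
- move=> r1 s1; have [r0 s0] : 0 < r /\ 0 < s by split; lra.
  rewrite !inver !gt_eqF// -EFinD => -[rs]; constructor 3; exists r, s.
  have r'0 : r^-1 > 0 by rewrite invr_gt0.
  have s'0 : s^-1 > 0 by rewrite invr_gt0.
  by split=> //; rewrite -invf_lt1//; lra.
- move=> r1 _; have r0 : 0 < r by lra.
  rewrite inver gt_eqF// adde0 => -[] rE; constructor 1; split=> //.
  by rewrite -(invrK r) rE invr1.
- move=> _ s1; have s0 : 0 < s by lra.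
  rewrite inver gt_eqF// add0e => -[] sE; constructor 2; split=> //.
  by rewrite -(invrK s) sE invr1.
- by move=> _ _ /eqP; rewrite adde0 eqe eq_sym oner_eq0.
Qed.

Lemma hoelder1 x y m k s : uniq s -> lpb 1%E x m -> lpb +oo%E y k ->
  \sum_(i <- s) normc (x i) * normc (y i) <= m * k.
Proof.
move=> us [m0 h] [k0 hk].
have := h s us; rewrite powRr1//; under eq_bigr do rewrite powRr1//.
move=> {}h; apply: le_trans (ler_wpM2r k0 h).
by rewrite mulr_suml; apply: ler_sum => i _; apply: ler_wpM2l.
Qed.

(** Young's inequality for the normalised entries |x i| / m and |y i| / k, summed over [s]. *)
Lemma hoelder_sum p q x y m k s : (1 <= p)%E -> (1 <= q)%E ->
  (p^-1 + q^-1 = 1)%E -> uniq s -> lpb p x m -> lpb q y k ->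
  \sum_(i <- s) normc (x i) * normc (y i) <= m * k.
Proof.
move=> p1 q1 pq us hx hy.
have [m0 k0] := (lpb_ge0 hx, lpb_ge0 hy).
have [pE|pE|] := conj_cases p1 q1 pq.
- by move: pE hx hy => [-> ->]; exact: hoelder1.
- move: pE hx hy => [-> ->] hx hy; rewrite mulrC; under eq_bigr do rewrite mulrC.
  exact: hoelder1.
have [mz|mn0] := eqVneq m 0.
  rewrite big1 ?mulr_ge0// => i _.
  have : normc (x i) <= 0 by rewrite -mz; exact: lpb_pt hx.
  by move=> xi; rewrite (_ : normc (x i) = 0) ?mul0r//; apply/eqP; rewrite eq_le xi normc_ge0.
have [kz|kn0] := eqVneq k 0.
  rewrite big1 ?mulr_ge0// => i _.
  have : normc (y i) <= 0 by rewrite -kz; exact: lpb_pt hy.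
  by move=> xi; rewrite (_ : normc (y i) = 0) ?mulr0//; apply/eqP; rewrite eq_le xi normc_ge0.
have {mn0 m0}m0 : 0 < m by rewrite lt_neqAle eq_sym mn0.
have {kn0 k0}k0 : 0 < k by rewrite lt_neqAle eq_sym kn0.
move=> [a [b [pE qE a1 b1 ab]]]; subst p q.
have [a0 b0] : 0 < a /\ 0 < b by split; lra.
have [_ /(_ s us) hx'] := hx; have [_ /(_ s us) hy'] := hy.
have key i : normc (x i) * normc (y i) <=
  (m * k) * ((normc (x i) `^ a / m `^ a) / a + (normc (y i) `^ b / k `^ b) / b).
  rewrite -!powR_div//.
  have nx : 0 <= normc (x i) / m by rewrite divr_ge0 ?(ltW m0).
  have ny : 0 <= normc (y i) / k by rewrite divr_ge0 ?(ltW k0).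
  have := conjugate_powR nx ny a0 b0 ab.
  move=> /(ler_wpM2l (ltW (mulr_gt0 m0 k0))); apply: le_trans.
  by rewrite le_eqVlt; apply/orP; left; apply/eqP; field; rewrite !gt_eqF.
apply: (le_trans (ler_sum _ (fun i _ => key i))).
rewrite -mulr_sumr ler_piMr ?mulr_ge0 ?(ltW m0) ?(ltW k0)// big_split/= -!mulr_suml -ab.
by apply: lerD; rewrite ler_piMl ?invr_ge0 ?(ltW a0) ?(ltW b0)// ler_pdivrMr ?powR_gt0// mul1r.
Qed.

Lemma phase (z : R[i]) : exists2 u : R[i], normc u <= 1 & z * u = (normc z)%:C.
Proof.
exists ((normc z)%:C / z).
  rewrite normcM normc_real ger0_norm// normcV.
  have [->|z0] := eqVneq z 0; first by rewrite normc0 mul0r.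
  by rewrite divff ?normc_eq0.
have [->|z0] := eqVneq z 0; first by rewrite mul0r normc0.
by rewrite mulrC mulfVK.
Qed.

(** Test with the extremal vector of Hoelder's inequality: the conjugate phases for p = 1, a unit
    mass for p = +oo, and phases times a power of |x i| in between. Staying on a finite [s] avoids
    any question of convergence. *)
Lemma hoelder_converse p q x m (s : seq I) : (1 <= p)%E -> (1 <= q)%E ->
  (p^-1 + q^-1 = 1)%E -> uniq s -> 0 <= m ->
  (forall y, (forall i, i \notin s -> y i = 0) -> lpb q y 1 ->
     normc (\sum_(i <- s) x i * y i) <= m) ->
  lpb p (fun i => if i \in s then x i else 0) m.
Proof.
move=> p1 q1 pq us m0 h.
have /choice[u hu] : forall i : I, exists u : R[i],
    normc u <= 1 /\ x i * u = (normc (x i))%:C.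
  by move=> i; have [u] := phase (x i); exists u.
have real_sum (f : I -> R) : (forall i, 0 <= f i) ->
    normc (\sum_(i <- s) (f i)%:C) = \sum_(i <- s) f i.
  move=> f0; have -> : \sum_(i <- s) (f i)%:C = (\sum_(i <- s) f i)%:C.
    by rewrite rmorph_sum.
  rewrite normc_real ger0_norm//; exact: sumr_ge0.
have [[-> qE]|[pE qE]|[a [b [pE qE a1 b1 ab]]]] := conj_cases p1 q1 pq; subst.
- pose y i := if i \in s then u i else 0.
  have := h y; rewrite (_ : \sum_(i <- s) x i * y i = \sum_(i <- s) (normc (x i))%:C);
    last by apply: eq_big_seq => i is_; rewrite /y is_ (hu i).2.
  rewrite real_sum// => hs; split=> // t ut.
  have {}hs : \sum_(i <- s) normc (x i) <= m.
    apply: hs; first by move=> i /negbTE; rewrite /y => ->.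
    by split=> // i; rewrite /y; case: ifP => _; rewrite ?normc0//; exact: (hu i).1.
  rewrite powRr1//; apply: le_trans hs.
  under eq_bigr do rewrite powRr1//.
  rewrite [leRHS](eq_big_seq (fun i => normc (if i \in s then x i else 0))) => [|i ->//].
  by apply: ler_sum_supp => // i _; case: ifP => //; rewrite normc0 eqxx.
- split=> // i; case: ifPn => is_; last by rewrite normc0.
  have := h (fun j => if j == i then 1 else 0).
  rewrite (bigD1_seq i)//= eqxx mulr1 big1 ?addr0 => [|j /negbTE ->]; last by rewrite mulr0.
  apply=> [j|]; last by rewrite -[X in lpb _ _ X]normc1; exact: lpb_delta.
  by case: eqP => // ->; rewrite is_.
have [a0 b0] : 0 < a /\ 0 < b by split; lra.
set S := \sum_(i <- s) normc (x i) `^ a.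
have S0 : 0 <= S by apply: sumr_ge0 => i _; exact: powR_ge0.
apply/lpb_rootP => [||t ut]; rewrite ?(ltW a1)//.
apply: (@le_trans _ _ (S `^ a^-1)).
  rewrite powR_le ?invr_gt0//; last by apply: sumr_ge0 => i _; exact: powR_ge0.
  rewrite [leRHS](eq_big_seq (fun i => normc (if i \in s then x i else 0) `^ a)) => [|i ->//].
  apply: ler_sum_supp => // [i _|i]; last exact: powR_ge0.
  by case: ifP => //; rewrite normc0 powR0 ?eqxx// gt_eqF.
have [->|Sn0] := eqVneq S 0; first by rewrite powR0 ?invr_eq0 ?gt_eqF.
have {Sn0}Sp : 0 < S by rewrite lt_neqAle eq_sym Sn0.
have aE : a = (a - 1) * b.
  have bE : b^-1 = 1 - a^-1 by rewrite -ab addrC addKr.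
  by apply: (mulIf (invr_neq0 (lt0r_neq0 b0))); rewrite mulfK ?gt_eqF// bE; field; rewrite gt_eqF.
(* Since (a - 1) b = a, the b-th powers of the [w i] over [s] sum to 1, while the pairing with |x i|
   gives S / S^(1/b) = S^(1/a). *)
pose w i := normc (x i) `^ (a - 1) / S `^ b^-1.
have w0 i : 0 <= w i by rewrite divr_ge0 ?powR_ge0.
pose y i := if i \in s then u i * (w i)%:C else 0.
have := h y; rewrite (_ : \sum_(i <- s) x i * y i =
    \sum_(i <- s) (normc (x i) `^ a / S `^ b^-1)%:C); last first.
  apply: eq_big_seq => i is_; rewrite /y is_ mulrA (hu i).2 -rmorphM/= /w mulrA.
  congr (_ / _)%:C; have [->|xn0] := eqVneq (normc (x i)) 0.
    by rewrite mul0r powR0 ?gt_eqF.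
  have xp : 0 < normc (x i) by rewrite lt_neqAle eq_sym xn0 normc_ge0.
  rewrite -[X in X * _]powRr1// -powRD; first by rewrite addrC subrK.
  by rewrite xn0 implybT.
rewrite real_sum => [|i]; last by rewrite divr_ge0 ?powR_ge0.
rewrite -mulr_suml -/S.
have -> : S / S `^ b^-1 = S `^ a^-1.
  rewrite -powRN -[X in X * _]powRr1// -powRD; last by rewrite (gt_eqF Sp) implybT.
  by rewrite -ab addrK.
apply=> [i /negbTE|]; first by rewrite /y => ->.
split=> // v uv; rewrite powR1.
apply: (@le_trans _ _ (\sum_(i <- s) normc (y i) `^ b)).
  apply: ler_sum_supp => // [i _|i]; last exact: powR_ge0.
  by rewrite /y; case: ifP => //; rewrite normc0 powR0 ?eqxx// gt_eqF.
apply: (@le_trans _ _ (\sum_(i <- s) normc (x i) `^ a / S)).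
  rewrite big_seq [leRHS]big_seq; apply: ler_sum => i is_.
  rewrite /y is_ normcM normc_real ger0_norm//.
  apply: (@le_trans _ _ (w i `^ b)).
    have uw : 0 <= normc (u i) * w i by rewrite mulr_ge0.
    by rewrite powR_le// ler_piMl//; exact: (hu i).1.
  by rewrite /w powR_div ?powR_ge0 ?powR_gt0// -!powRrM -aE mulVf ?gt_eqF// powRr1.
by rewrite -mulr_suml ler_pdivrMr// mul1r.
Qed.

End Hoelder.

(** * Geometric sums over the integers and almost-maximal entries *)

Section IntSums.
Variable R : realType.
Implicit Types (rho : R).

Lemma geo_sum_nat rho n : 0 <= rho < 1 ->
  \sum_(k <- iota 0 n) rho ^+ k <= (1 - rho)^-1.
Proof.
move=> /andP[r0 r1]; have r1' : 0 < 1 - rho by lra.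
rewrite -[X in _ <= X]mul1r ler_pdivlMr// mulrC.
have -> : (1 - rho) * \sum_(k <- iota 0 n) rho ^+ k = 1 - rho ^+ n.
  elim: n => [|n IH]; first by rewrite big_nil mulr0 expr0 subrr.
  by rewrite exprSr -addn1 iotaD big_cat big_seq1 mulrDr IH add0n; ring.
by rewrite lerBlDr lerDl exprn_ge0.
Qed.

Lemma geo_sum_int rho (j : int) (s : seq int) : 0 <= rho < 1 -> uniq s ->
  \sum_(i <- s) rho ^+ absz (i - j) <= 2 / (1 - rho).
Proof.
move=> r01 us; have r0 : 0 <= rho by case/andP: r01.
pose N := \max_(i <- s) absz (i - j).
pose t := [seq j + k%:Z | k <- iota 0 N.+1] ++ [seq j - k%:Z | k <- iota 0 N.+1].
apply: (@le_trans _ _ (\sum_(i <- t) rho ^+ absz (i - j))).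
  apply: ler_sum_supp => // [i is_ _|i]; last exact: exprn_ge0.
  have iN : (absz (i - j)%R <= N)%N by rewrite /N (big_rem i)//= leq_max leqnn.
  rewrite mem_cat; apply/orP; case: (lerP j i) => ij; [left|right]; apply/mapP.
    by exists (absz (i - j)); [rewrite mem_iota add0n ltnS|lia].
  by exists (absz (i - j)); [rewrite mem_iota add0n ltnS|lia].
rewrite big_cat !big_map/=.
have -> : \sum_(k <- iota 0 N.+1) rho ^+ absz (j + k%:Z - j)%R =
    \sum_(k <- iota 0 N.+1) rho ^+ k.
  by apply: eq_bigr => k _; congr (_ ^+ _); lia.
have -> : \sum_(k <- iota 0 N.+1) rho ^+ absz (j - k%:Z - j)%R =
    \sum_(k <- iota 0 N.+1) rho ^+ k.
  by apply: eq_bigr => k _; congr (_ ^+ _); lia.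
by have := geo_sum_nat N.+1 r01; lra.
Qed.

(** A supremum over an infinite set need not be attained; a point within a factor 2 of it replaces
    the maximum in all that follows. The point [t0] serves the case x = 0. *)
Lemma near_max (T : Type) (t0 : T) (x : T -> R) B : (forall i, 0 <= x i <= B) ->
  exists j, forall i, x i <= 2 * x j.
Proof.
move=> xB; have [[i xi]|/forallNP x0] := pselect (exists i, 0 < x i); last first.
  exists t0 => i; have /andP[? _] := xB t0; have /negP := x0 i; rewrite -leNgt; lra.
have hs : has_sup (range x).
  by split; [exists (x i), i|exists B => _ [k _ <-]; case/andP: (xB k)].
have sp : 0 < sup (range x).
  by apply: lt_le_trans xi _; apply: ub_le_sup; [case: hs|exists i].
have [_ [j _ <-] hj] := sup_adherent (divr_gt0 sp (ltr0Sn _ 1)) hs.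
exists j => k; have : x k <= sup (range x) by apply: ub_le_sup; [case: hs|exists k].
lra.
Qed.

(* Exponential decay of the inverse bounds it in every [l^p] at once. *)
Lemma weighted_sup_lpb p (C rho : R) : (1 <= p)%E -> 0 <= C -> 0 < rho < 1 ->
  exists2 Cp, 0 <= Cp & forall (x b : int -> R[i]) m,
    (forall i beta, (forall j, rho ^+ absz (i - j) * normc (b j) <= beta) ->
       normc (x i) <= C * beta) ->
    lpb p b m -> lpb p x (Cp * m).
Proof.
case: p => [r| |]//= r1 C0 r01; last first.
  exists C => // x b m h [m0 bm]; split; first exact: mulr_ge0.
  move=> i; apply: h => j; case/andP: r01 => rp rl.
  apply: le_trans (bm j); rewrite ler_piMl// exprn_ile1 ?ltW//.
have rp := fin_exp_gt0 r1; rewrite lee_fin in r1.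
case/andP: (r01) => rhop rhol.
pose sg := rho `^ r.
have sg01 : 0 <= sg < 1.
  have : sg < 1 `^ r by apply: (gt0_ltr_powR rp); rewrite ?nnegrE// ltW.
  by rewrite powR1 powR_ge0.
pose S := 2 / (1 - sg).
have S0 : 0 <= S by rewrite divr_ge0//; case/andP: sg01 => _ /ltW; rewrite subr_ge0.
exists (2 * C * S `^ r^-1) => [|x b m h bm].
  by rewrite mulr_ge0 ?powR_ge0// mulr_ge0.
have m0 := lpb_ge0 bm.
(* [g i] almost attains the weighted supremum that bounds [x i]. *)
have /choice[g hg] : forall i, exists j, forall k,
    rho ^+ absz (i - k) * normc (b k) <= 2 * (rho ^+ absz (i - j) * normc (b j)).
  move=> i; apply: (@near_max _ 0 _ m) => k.
  rewrite mulr_ge0 ?exprn_ge0 ?(ltW rhop)//=.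
  apply: le_trans (lpb_pt k _ bm); rewrite ?lee_fin//.
  by rewrite ler_piMl// exprn_ile1 ?ltW.
split; first by rewrite mulr_ge0// mulr_ge0 ?powR_ge0// mulr_ge0.
move=> s us; pose t := undup (map g s).
(* The single term at [g i] is dominated by the whole sum over [t]. The weighted supremum thus
   becomes a convolution with the summable kernel sg^|i - j|, and exchanging the two sums costs the
   factor [S]. *)
have key i : i \in s -> normc (x i) `^ r <=
    (2 * C) `^ r * \sum_(j <- t) sg ^+ absz (i - j) * normc (b j) `^ r.
  move=> is_; have := h i _ (hg i); rewrite mulrA [C * 2]mulrC => hx.
  have gt : g i \in t by rewrite mem_undup map_f.
  apply: (@le_trans _ _ ((2 * C * (rho ^+ absz (i - g i) * normc (b (g i)))) `^ r)).
    by rewrite powR_le// !mulr_ge0 ?exprn_ge0// ltW.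
  rewrite powRM ?mulr_ge0 ?exprn_ge0 ?(ltW rhop)// ler_wpM2l ?powR_ge0//.
  rewrite powRM ?exprn_ge0 ?(ltW rhop)//.
  rewrite -powR_mulrn ?(ltW rhop)// powRAC powR_mulrn ?powR_ge0// -/sg.
  rewrite (bigD1_seq _ gt) ?undup_uniq//= lerDl sumr_ge0// => k _.
  by rewrite mulr_ge0 ?powR_ge0 ?exprn_ge0//; case/andP: sg01.
rewrite big_seq; apply: (le_trans (ler_sum _ (fun i is_ => key i is_))).
have C2 : 0 <= 2 * C * S `^ r^-1 by rewrite mulr_ge0 ?powR_ge0// mulr_ge0.
have C1 : 0 <= 2 * C by rewrite mulr_ge0.
rewrite -big_seq -mulr_sumr exchange_big/= (powRM _ C2 m0) (powRM _ C1 (powR_ge0 _ _)).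
rewrite powRKV// -mulrA ler_wpM2l ?powR_ge0//.
apply: (@le_trans _ _ (\sum_(j <- t) S * normc (b j) `^ r)).
  apply: ler_sum => j _; rewrite -mulr_suml ler_wpM2r ?powR_ge0//.
  exact: geo_sum_int.
rewrite -mulr_sumr ler_wpM2l//; case: bm => _; apply; exact: undup_uniq.
Qed.

End IntSums.

(** * Convergence of complex numbers along a filter *)

Section Tends.
Variables (R : realType) (T : Type) (F : set_system T).
Context {FF : ProperFilter F}.
Implicit Types (z w : T -> R[i]) (u v : R[i]).

Definition tends z u := forall e : R, 0 < e -> F [set t | normc (z t - u) < e].

Lemma tends_cst u : tends (fun=> u) u.
Proof.
by move=> e e0; apply: filterS filterT => t _ /=; rewrite subrr normc0.
Qed.

Lemma tends_near_cst z u : F [set t | z t = u] -> tends z u.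
Proof. by move=> h e e0; apply: filterS h => t /= ->; rewrite subrr normc0. Qed.

Lemma tendsD z w u v : tends z u -> tends w v ->
  tends (fun t => z t + w t) (u + v).
Proof.
move=> zu wv e e0; have e2 : 0 < e / 2 by lra.
apply: filterS (filterI (zu _ e2) (wv _ e2)) => t [/= h1 h2].
have -> : z t + w t - (u + v) = (z t - u) + (w t - v) by ring.
by have := normcD (z t - u) (w t - v); lra.
Qed.

Lemma tends_bound z u : tends z u -> F [set t | normc (z t) < normc u + 1].
Proof.
move=> /(_ 1 ltr01); apply: filterS => t /= h.
have := normcD (z t - u) u; rewrite subrK; lra.
Qed.

Lemma tendsM z w u v : tends z u -> tends w v ->
  tends (fun t => z t * w t) (u * v).
Proof.
move=> zu wv e e0; pose B := normc u + normc v + 1.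
have B0 : 0 < B by rewrite /B; have := normc_ge0 u; have := normc_ge0 v; lra.
have eB : 0 < e / (2 * B) by rewrite divr_gt0// mulr_gt0.
apply: filterS (filterI (tends_bound zu) (filterI (zu _ eB) (wv _ eB))).
move=> t [/= h0 [h1 h2]].
have -> : z t * w t - u * v = z t * (w t - v) + (z t - u) * v by ring.
apply: le_lt_trans (normcD _ _) _; rewrite !normcM.
have k1 : normc (z t) * normc (w t - v) <= B * normc (w t - v).
  by rewrite ler_wpM2r// /B; have := normc_ge0 v; lra.
have k2 : normc (z t - u) * normc v <= normc (z t - u) * B.
  by rewrite ler_wpM2l// /B; have := normc_ge0 u; lra.
have k3 : B * normc (w t - v) < B * (e / (2 * B)) by rewrite ltr_pM2l.
have k4 : normc (z t - u) * B < e / (2 * B) * B by rewrite ltr_pM2r.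
have k5 : B * (e / (2 * B)) = e / 2 by field; rewrite gt_eqF.
by rewrite mulrC in k4; lra.
Qed.

Lemma tends_unique z u v : tends z u -> tends z v -> u = v.
Proof.
move=> zu zv; apply/eqP; rewrite -subr_eq0; apply/eqP/normc_small => e e0.
have e2 : 0 < e / 2 by lra.
have [t [/= h1 h2]] := filter_ex (filterI (zu _ e2) (zv _ e2)).
have -> : u - v = (z t - v) - (z t - u) by ring.
have := normcD (z t - v) (- (z t - u)); rewrite normcN; lra.
Qed.

Lemma tends_le z u (m : R) : F [set t | normc (z t) <= m] -> tends z u ->
  normc u <= m.
Proof.
move=> zm zu; apply/ler_addgt0Pr => e e0.
have [t [/= h1 h2]] := filter_ex (filterI zm (zu _ e0)).
have := normcD (z t) (u - z t); rewrite subrKC normcB in h2 *; lra.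
Qed.

End Tends.

(** * Limits along a fixed ultrafilter *)

Section Ultralimit.

Lemma nat_ultrafilter : exists G : set_system nat, UltraFilter G /\ \oo `<=` G.
Proof. exact: ultraFilterLemma. Qed.

(** One free ultrafilter, fixed once and for all: every bounded sequence converges along it, so
    infinitely many entries converge simultaneously without any diagonal extraction. *)
Definition ult : set_system nat := sval (cid nat_ultrafilter).

#[export] Instance ult_ultra : UltraFilter ult.
Proof. exact: (svalP (cid nat_ultrafilter)).1. Qed.

#[export] Instance ult_proper : ProperFilter ult.
Proof. exact: ultra_proper. Qed.

Lemma ult_near (P : set nat) : (\forall n \near \oo, P n) -> ult P.
Proof. exact: (svalP (cid nat_ultrafilter)).2. Qed.

Lemma ult_ge N : ult [set n | (N <= n)%N].
Proof. by apply: ult_near; exists N. Qed.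

Lemma ult_cluster (T : topologicalType) (K : set T) (z : nat -> T) :
  compact K -> ult [set n | K (z n)] ->
  exists2 u, K u & forall B, nbhs u B -> ult [set n | B (z n)].
Proof.
move=> cK zK; have [u [Ku cu]] := cK (z @ ult) _ zK; exists u => // B uB.
have [//|nB] := in_ultra_setVsetC [set n | B (z n)] ult_ultra.
have [y [/= ny yB]] := cu (~` B) B nB uB.
by have := ny yB.
Qed.

Lemma ult_inv_lt (R : realType) (e : R) : 0 < e -> ult [set n | n.+1%:R^-1 < e].
Proof.
move=> e0; apply: filterS (ult_ge (Num.truncn e^-1)) => n /= hn.
rewrite invf_plt ?posrE//; apply: lt_le_trans (truncnS_gt _) _.
by rewrite ler_nat ltnS.
Qed.

Variable R : realType.

Lemma ult_compact (U : set R[i]) (z : nat -> R[i]) : compact (U : set R[i]^o) ->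
  (forall n, U (z n)) -> exists2 u, U u & tends ult z u.
Proof.
move=> cU zU; have [|u Uu uz] := @ult_cluster R[i]^o U z cU.
  by apply: filterS filterT => n _; exact: zU.
exists u => // e e0.
have e0' : (0 : R[i]) < e%:C by rewrite ltcR.
have := uz _ (@nbhsx_ballx _ R[i]^o u _ e0').
apply: filterS => n; rewrite -ball_normE /= => h.
by rewrite -ltcR -absC_normc distrC.
Qed.

Lemma ult_bounded (z : nat -> R[i]) (B : R) :
  ult [set n | normc (z n) <= B] -> exists u, tends ult z u.
Proof.
move=> zB.
have reim (w : R[i]) : `|complex.Re w| <= normc w /\ `|complex.Im w| <= normc w.
  case: w => a b /=; rewrite -!sqrtr_sqr; split; apply: ler_wsqrtr.
    by rewrite lerDl sqr_ge0.
  by rewrite lerDr sqr_ge0.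
have key (f : R[i] -> R) : (forall w, `|f w| <= normc w) ->
    exists a, forall e, 0 < e -> ult [set n | `|f (z n) - a| < e].
  move=> fw; have [||a _ az] := @ult_cluster R `[- B, B]%classic (f \o z).
  - exact: segment_compact.
  - apply: filterS zB => n /= h; rewrite in_itv/= -ler_norml.
    exact: le_trans (fw _) h.
  exists a => e e0; have := az _ (nbhsx_ballx a e e0).
  by apply: filterS => n; rewrite -ball_normE /= distrC.
have [a az] := key (fun w => complex.Re w) (fun w => (reim w).1).
have [b bz] := key (fun w => complex.Im w) (fun w => (reim w).2).
exists (a +i* b) => e e0; have e2 : 0 < e / 2 by lra.
apply: filterS (filterI (az _ e2) (bz _ e2)) => n [/= h1 h2].
apply: le_lt_trans (normc_le_ReIm _) _.
have -> : complex.Re (z n - a +i* b) = complex.Re (z n) - a by case: (z n).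
have -> : complex.Im (z n - a +i* b) = complex.Im (z n) - b by case: (z n).
lra.
Qed.

Lemma compact_normc_bounded (U : set R[i]) : compact (U : set R[i]^o) ->
  exists2 K : R, 0 <= K & forall u, U u -> normc u <= K.
Proof.
move=> cU; apply: contrapT => nK.
have /choice[z hz] : forall n : nat, exists z, U z /\ n%:R < normc z.
  move=> n; apply: contrapT => /forallNP h; apply: nK; exists n%:R => // u Uu.
  by have := h u => /not_andP[//|/negP]; rewrite -leNgt.
have [u _ uz] := ult_compact cU (fun n => (hz n).1).
have [n [/= h1 h2]] := filter_ex (filterI (tends_bound uz) (ult_ge (Num.truncn (normc u + 1)).+1)).
have h3 : normc u + 1 < (Num.truncn (normc u + 1)).+1%:R := truncnS_gt _.
have := (hz n).2; have : (Num.truncn (normc u + 1)).+1%:R <= n%:R :> R by rewrite ler_nat.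
lra.
Qed.

End Ultralimit.

(** * Tridiagonal operators on the line and exponential weights *)

Section TridiagonalOperator.
Variable R : realType.
Implicit Types (A : int -> int -> R[i]) (X Y : int -> R[i]) (D : set int).

(** Reads only the three central diagonals, so that no summation over [int] is involved and
    identities reduce to [ring]; [matopE] relates it to [matop]. *)
Definition trop A X : int -> R[i] := fun i =>
  A i (i - 1) * X (i - 1) + A i i * X i + A i (i + 1) * X (i + 1).

Definition cut D X : int -> R[i] := fun i => if `[< D i >] then X i else 0.

Definition supp D X : Prop := forall i, ~ D i -> X i = 0.

Definition bounded_fun X : Prop := exists B : R, forall i, normc (X i) <= B.

Lemma cut_in D X i : D i -> cut D X i = X i.
Proof. by move=> Di; rewrite /cut asboolT. Qed.

Lemma cut_out D X i : ~ D i -> cut D X i = 0.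
Proof. by move=> Di; rewrite /cut asboolF. Qed.

Lemma supp_cut D X : supp D (cut D X).
Proof. by move=> i; exact: cut_out. Qed.

Lemma cutT X : cut setT X = X.
Proof. by apply/funext => i; rewrite cut_in. Qed.

Lemma normc_cut D X i : normc (cut D X i) <= normc (X i).
Proof. by rewrite /cut; case: asboolP => // _; rewrite normc0. Qed.

Lemma tropD A X Y i : trop A (fun k => X k + Y k) i = trop A X i + trop A Y i.
Proof. by rewrite /trop; ring. Qed.

Lemma tropB A X Y i : trop A (fun k => X k - Y k) i = trop A X i - trop A Y i.
Proof. by rewrite /trop; ring. Qed.

Lemma tropZ A (c : R[i]) X i : trop A (fun k => c * X k) i = c * trop A X i.
Proof. by rewrite /trop; ring. Qed.

Lemma trop0 A X i : (forall k, X k = 0) -> trop A X i = 0.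
Proof. by move=> X0; rewrite /trop !X0 !mulr0 !addr0. Qed.

Lemma lpb_bounded_fun p X m : (1 <= p)%E -> lpb p X m -> bounded_fun X.
Proof. by move=> p1 h; exists m => i; exact: lpb_pt h. Qed.

Lemma lpb_shift p X m (k : int) : lpb p X m -> lpb p (fun i => X (i + k)) m.
Proof. by apply: (lpb_inj (f := fun i => i + k)); exact: addIr. Qed.

Lemma lpb_normc_shift p X m (k : int) : (1 <= p)%E -> lpb p X m ->
  lpb p (fun i => (normc (X (i + k)))%:C) m.
Proof.
move=> p1 hX; apply: lpb_le (lpb_shift k hX) => // i.
by rewrite normc_real ger0_norm.
Qed.

Lemma lpb_cut p D X m : (1 <= p)%E -> lpb p X m -> lpb p (cut D X) m.
Proof. by move=> p1; apply: lpb_le => // i; exact: normc_cut. Qed.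

Lemma trop_lpb p A X K m : (1 <= p)%E -> 0 <= K ->
  (forall i j, normc (A i j) <= K) -> lpb p X m -> lpb p (trop A X) (3 * K * m).
Proof.
move=> p1 K0 AK hX.
have h j (k : int) : lpb p (fun i => A i (j i) * X (i + k)) (K * m).
  apply: lpb_leZ (lpb_shift k hX) => // i; rewrite normcM ler_wpM2r//.
have := lpbD p1 (lpbD p1 (h (fun i => i - 1) (-1)) (h (fun i => i) 0)) (h (fun i => i + 1) 1).
have -> : K * m + K * m + K * m = 3 * K * m by ring.
by apply: lpb_le => // i; rewrite addr0.
Qed.

Section Weight.
Variables (rho : R) (c : int).
Hypothesis rho01 : 0 < rho < 1.

Definition weight (j : int) : R := rho ^+ absz (j - c).

Let rho0 : 0 < rho. Proof. by case/andP: rho01. Qed.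
Let rho1 : rho <= 1. Proof. by case/andP: rho01 => _ /ltW. Qed.

Lemma weight_gt0 j : 0 < weight j.
Proof. by rewrite exprn_gt0. Qed.

Lemma weight_le1 j : weight j <= 1.
Proof. by rewrite exprn_ile1// ltW. Qed.

Lemma weight_center : weight c = 1.
Proof. by rewrite /weight subrr. Qed.

Lemma weight_step j k : absz (j - k) = 1%N ->
  `|weight k - weight j| <= (rho^-1 - 1) * weight k.
Proof.
move=> jk; have wk := weight_gt0 k.
have [E|E] : absz (j - c) = (absz (k - c)).+1 \/ (absz (j - c)).+1 = absz (k - c) by lia.
  have -> : weight j = rho * weight k by rewrite /weight E exprS.
  rewrite ger0_norm; last by rewrite subr_ge0 ler_piMl// ltW.
  have : 0 <= (rho^-1 - 1) * (1 - rho) * weight k.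
    rewrite mulr_ge0// ?(ltW wk)// mulr_ge0 ?subr_ge0//.
    by rewrite invf_ge1.
  have -> : (rho^-1 - 1) * (1 - rho) * weight k =
     (rho^-1 - 1) * weight k - (weight k - rho * weight k).
    by field; rewrite gt_eqF.
  by rewrite subr_ge0.
have -> : weight k = rho * weight j by rewrite /weight -E exprS.
have wj := weight_gt0 j.
rewrite distrC ger0_norm; last by rewrite subr_ge0 ler_piMl// ltW.
by rewrite le_eqVlt; apply/orP; left; apply/eqP; field; rewrite gt_eqF.
Qed.

(** The commutator of A with the weight: the diagonal term cancels, and the other two carry
    differences of neighbouring weights, which are small relative to the weights when rho is close
    to 1. *)
Lemma trop_weight A K X j : (forall i j, normc (A i j) <= K) ->
  normc (trop A (fun k => (weight k)%:C * X k) j - (weight j)%:C * trop A X j)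
  <= K * (rho^-1 - 1) * (normc ((weight (j - 1))%:C * X (j - 1))
                         + normc ((weight (j + 1))%:C * X (j + 1))).
Proof.
move=> AK; set w := weight.
have -> : trop A (fun k => (w k)%:C * X k) j - (w j)%:C * trop A X j =
    A j (j - 1) * ((w (j - 1) - w j)%:C * X (j - 1))
    + A j (j + 1) * ((w (j + 1) - w j)%:C * X (j + 1)).
  by rewrite /trop !rmorphB/=; ring.
have K0 : 0 <= K by apply: le_trans (AK 0 0).
have step k : absz (j - k) = 1%N -> normc (A j k * ((w k - w j)%:C * X k)) <=
    K * (rho^-1 - 1) * normc ((w k)%:C * X k).
  move=> jk; rewrite !normcM !normc_real -mulrA ler_pM ?mulr_ge0//.
  by rewrite mulrA ler_wpM2r// (ger0_norm (ltW (weight_gt0 _))) weight_step.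
apply: le_trans (normcD _ _) _; rewrite mulrDr lerD//; apply: step; lia.
Qed.

End Weight.

(** The condition of [tridiagonal] on one entry, isolated so that entries can be chosen, shifted and
    passed to the limit one at a time. *)
Definition entry (U V W : set R[i]) (i j : int) (u : R[i]) : Prop :=
  [/\ i = j + 1 -> U u, i = j -> V u, j = i + 1 -> W u & 1 < `|i - j| -> u = 0].

End TridiagonalOperator.

(** * Compactness of M(U,V,W) and uniform lower bounds *)

Section Entries.
Variables (R : realType) (U V W : set R[i]).
Hypotheses (U0 : U !=set0) (V0 : V !=set0) (W0 : W !=set0).
Hypotheses (cU : compact (U : set R[i]^o)) (cV : compact (V : set R[i]^o))
  (cW : compact (W : set R[i]^o)).
Implicit Types (A : int -> int -> R[i]) (X Y : int -> R[i]) (D : set int).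

Lemma MbiP A : Mbi U V W A <-> forall i j, entry U V W i j (A i j).
Proof. by []. Qed.

Lemma offdiag_cases (i j : int) : [\/ i = j + 1, i = j, j = i + 1 | 1 < `|i - j|].
Proof.
have [->|ij] := eqVneq i j; first by constructor 2.
have [->|ij1] := eqVneq i (j + 1); first by constructor 1.
have [->|ij2] := eqVneq j (i + 1); first by constructor 3.
by constructor 4; lia.
Qed.

Lemma entry_sub i j u : i = j + 1 -> U u -> entry U V W i j u.
Proof. by move=> -> Uu; split=> //; lia. Qed.
Lemma entry_diag i j u : i = j -> V u -> entry U V W i j u.
Proof. by move=> -> Uu; split=> //; lia. Qed.
Lemma entry_sup i j u : j = i + 1 -> W u -> entry U V W i j u.
Proof. by move=> -> Uu; split=> //; lia. Qed.
Lemma entry_far i j : 1 < `|i - j| -> entry U V W i j 0.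
Proof. by move=> h; split=> // e; exfalso; move: h; rewrite e; lia. Qed.

Lemma entry_ex i j : exists u, entry U V W i j u.
Proof.
case: U0 V0 W0 => [u Uu] [v Vv] [w Ww].
case: (offdiag_cases i j) => h.
- by exists u; exact: entry_sub.
- by exists v; exact: entry_diag.
- by exists w; exact: entry_sup.
- by exists 0; exact: entry_far.
Qed.

(** An arbitrary admissible matrix, for the positions whose values do not matter. *)
Definition fill i j : R[i] := sval (cid (entry_ex i j)).

Lemma entry_fill i j : entry U V W i j (fill i j).
Proof. exact: svalP (cid (entry_ex i j)). Qed.

Lemma entry_shift i j (k : int) u :
  entry U V W (i + k) (j + k) u <-> entry U V W i j u.
Proof.
by split=> -[h1 h2 h3 h4]; split=> h; [apply: h1|apply: h2|apply: h3|apply: h4|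
  apply: h1|apply: h2|apply: h3|apply: h4]; move: h; lia.
Qed.

Lemma Mbi_bounded : exists2 K : R, 0 <= K &
  forall A, Mbi U V W A -> forall i j, normc (A i j) <= K.
Proof.
have [a a0 ha] := compact_normc_bounded cU.
have [b b0 hb] := compact_normc_bounded cV.
have [c c0 hc] := compact_normc_bounded cW.
exists (a + b + c) => [|A AM i j]; first by rewrite !addr_ge0.
have [h1 h2 h3 h4] := AM i j.
case: (offdiag_cases i j) => h.
- by have := ha _ (h1 h); lra.
- by have := hb _ (h2 h); lra.
- by have := hc _ (h3 h); lra.
- by rewrite h4// normc0; lra.
Qed.

Lemma entry_lim i j (z : nat -> R[i]) : (forall n, entry U V W i j (z n)) ->
  exists u, entry U V W i j u /\ tends ult z u.
Proof.
move=> hz; case: (offdiag_cases i j) => h.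
- have [|u Uu zu] := @ult_compact _ U z cU; first by move=> n; case: (hz n) => /(_ h).
  by exists u; split=> //; exact: entry_sub.
- have [|u Uu zu] := @ult_compact _ V z cV; first by move=> n; case: (hz n) => _ /(_ h).
  by exists u; split=> //; exact: entry_diag.
- have [|u Uu zu] := @ult_compact _ W z cW; first by move=> n; case: (hz n) => _ _ /(_ h).
  by exists u; split=> //; exact: entry_sup.
- exists 0; split; first exact: entry_far.
  have -> : z = fun=> 0 by apply/funext => n; case: (hz n) => _ _ _ /(_ h).
  exact: tends_cst.
Qed.

Lemma Mbi_lim (An : nat -> int -> int -> R[i]) : (forall n, Mbi U V W (An n)) ->
  exists2 A, Mbi U V W A & forall i j, tends ult (fun n => An n i j) (A i j).
Proof.
move=> AM; have /choice[f hf] : forall ij : int * int, exists u,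
    entry U V W ij.1 ij.2 u /\ tends ult (fun n => An n ij.1 ij.2) u.
  by move=> [i j]; apply: entry_lim => n; exact: AM.
by exists (fun i j => f (i, j)) => i j; case: (hf (i, j)).
Qed.

Lemma tends_trop (An : nat -> int -> int -> R[i]) A Xn X i :
  (forall i j, tends ult (fun n => An n i j) (A i j)) ->
  (forall i, tends ult (fun n => Xn n i) (X i)) ->
  tends ult (fun n => trop (An n) (Xn n) i) (trop A X i).
Proof.
by move=> hA hX; rewrite /trop; apply: tendsD; [apply: tendsD|]; apply: tendsM.
Qed.

Lemma fun_lim (Xn : nat -> int -> R[i]) (B : R) :
  (forall i, ult [set n | normc (Xn n i) <= B]) ->
  exists X, forall i, tends ult (fun n => Xn n i) (X i).
Proof.
move=> h; have /choice[X hX] : forall i, exists u, tends ult (fun n => Xn n i) u.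
  by move=> i; exact: ult_bounded (h i).
by exists X.
Qed.

Section UniformBound.
(** The class of admissible index sets. It is the line alone as long as injectivity is known only
    there, and all intervals once the half-lines have been treated. *)
Variable P : set (set int).

Hypothesis P_shift : forall D (k : int), P D -> P [set i | D (i + k)].
Hypothesis P_lim : forall Dn : nat -> set int, (forall n, P (Dn n)) ->
  P [set i | ult [set n | Dn n i]].
Hypothesis P_inj : forall A D X, Mbi U V W A -> P D -> supp D X ->
  bounded_fun X -> (forall i, D i -> trop A X i = 0) -> forall i, X i = 0.

(* Otherwise, shift almost-maximal entries of almost-kernel vectors to 0 and
   pass to an ultralimit. *)
Lemma sup_lower_bound : exists2 delta : R, 0 < delta &
  forall A D X m, Mbi U V W A -> P D -> supp D X -> bounded_fun X -> 0 <= m ->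
    (forall i, D i -> normc (trop A X i) <= m) ->
    forall i, delta * normc (X i) <= m.
Proof.
apply: contrapT => nd.
(* [t] packs an operator, an index set and a vector with value 1 at 0. The factor 2 of [near_max]
   appears in both bounds, 2 for the vector and 2 / (n + 1) for its image. *)
have /choice[t ht] : forall n : nat, exists t : (int -> int -> R[i]) * set int * (int -> R[i]),
    [/\ Mbi U V W t.1.1, P t.1.2, supp t.1.2 t.2, t.2 0 = 1 &
      (forall i, normc (t.2 i) <= 2) /\
      forall i, t.1.2 i -> normc (trop t.1.1 t.2 i) <= 2 / n.+1%:R].
  move=> n; apply: contrapT => nt; apply: nd; exists n.+1%:R^-1; first by rewrite invr_gt0.
  move=> A D X m AM PD sX [B XB] m0 hm i; apply: contrapT => /negP.
  rewrite -ltNge => him; apply: nt.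
  have [j hj] : exists j, forall i, normc (X i) <= 2 * normc (X j).
    by apply: (@near_max _ _ 0 _ B) => k; rewrite normc_ge0/=.
  have n1 : 0 < n.+1%:R^-1 :> R by rewrite invr_gt0.
  have mj : m < n.+1%:R^-1 * (2 * normc (X j)).
    by apply: (lt_le_trans him); rewrite ler_wpM2l// ltW.
  have Xj : 0 < normc (X j).
    rewrite lt_neqAle normc_ge0 andbT eq_sym; apply/eqP => Xj0.
    by move: mj; rewrite Xj0 !mulr0 ltNge m0.
  pose Y k := (X j)^-1 * X (k + j).
  exists ((fun i k => A (i + j) (k + j)), [set i | D (i + j)], Y); split=> /=.
  - by apply/MbiP => a b; apply: (entry_shift a b j _).1; exact: AM.
  - exact: P_shift.
  - by move=> k Dk; rewrite /Y (sX _ Dk) mulr0.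
  - by rewrite /Y add0r mulVf// -normc_eq0 gt_eqF.
  split=> [k|k Dk].
    by rewrite /Y normcM normcV mulrC ler_pdivrMr.
  have -> : trop (fun i k => A (i + j) (k + j)) Y k = (X j)^-1 * trop A X (k + j).
    by rewrite /Y /trop !(addrAC k _ j); ring.
  rewrite normcM normcV mulrC ler_pdivrMr//.
  by apply: (le_trans (hm _ Dk)); apply/ltW; rewrite mulrAC mulrC.
have [A AM hA] := @Mbi_lim (fun n => (t n).1.1) (fun n => let: And5 h _ _ _ _ := ht n in h).
have [X hX] : exists X, forall i, tends ult (fun n => (t n).2 i) (X i).
  apply: (@fun_lim _ 2) => i; apply: filterS filterT => n _ /=.
  by case: (ht n) => _ _ _ _ [].
(* The ultrafilter decides membership of every index: off [D], almost all the index sets omit i, so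
   that the limit vector vanishes there. *)
pose D : set int := [set i | ult [set n | (t n).1.2 i]].
have X00 : X 0 = 0.
  apply: (P_inj AM (@P_lim (fun n => (t n).1.2) _)) => [n|i Di||i Di].
  - by case: (ht n).
  - have [//|h] := in_ultra_setVsetC [set n | (t n).1.2 i] ult_ultra.
    apply: tends_unique (hX i) (tends_near_cst _).
    apply: filterS h => n /= h; case: (ht n) => _ _ sX _ _.
    by rewrite (sX _ h).
  - exists 2 => i; apply: tends_le (hX i); apply: filterS filterT => n _ /=.
    by case: (ht n) => _ _ _ _ [].
  - apply/normc_small => e e0; have e4 : 0 < e / 4 by lra.
    apply: (@le_lt_trans _ _ (e / 2)); last by lra.
    have hT := @tends_trop (fun n => (t n).1.1) A (fun n => (t n).2) X i hA hX.
    apply: tends_le _ hT.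
    apply: filterS (filterI Di (ult_inv_lt e4)) => n [/= Dn ne].
    case: (ht n) => _ _ _ _ [_ /(_ i Dn)] h; apply: le_trans h _.
    by move: ne; set v := _^-1; lra.
have : X 0 = 1.
  apply: tends_unique (hX 0) (tends_near_cst _).
  by apply: filterS filterT => n _ /=; case: (ht n).
by rewrite X00 => /eqP; rewrite eq_sym oner_eq0.
Qed.

(** Apply [sup_lower_bound] to X multiplied by a weight peaked at i. The commutator error is at most
    half of the left-hand side at an almost-maximal entry and is absorbed there. The outcome says
    that the inverse is localised exponentially, uniformly over the class. *)
Lemma weighted_lower_bound : exists C rho : R, [/\ 0 <= C, 0 < rho < 1 &
  forall A D X i beta, Mbi U V W A -> P D -> supp D X -> bounded_fun X ->
    (forall j, D j -> rho ^+ absz (i - j) * normc (trop A X j) <= beta) ->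
    0 <= beta -> normc (X i) <= C * beta].
Proof.
have [delta d0 hd] := sup_lower_bound.
have [K K0 hK] := Mbi_bounded.
(* chosen so that 4 K (1/rho - 1) <= delta / 2 *)
pose rho := (1 + delta / (8 * (K + 1)))^-1.
have q0 : 0 < delta / (8 * (K + 1)) by rewrite divr_gt0// mulr_gt0//; lra.
have rho01 : 0 < rho < 1.
  by rewrite invr_gt0 invf_lt1; lra.
(* One factor 2 comes from absorbing delta / 2 into delta, the other from [near_max]. *)
exists (4 / delta), rho; split=> //; first by rewrite divr_ge0// ltW.
move=> A D X i beta AM PD sX [B XB] hbeta beta0.
pose Y k := (weight rho i k)%:C * X k.
have normY k : normc (Y k) = weight rho i k * normc (X k).
  by rewrite normcM normc_real ger0_norm// ltW// weight_gt0.
have YX k : normc (Y k) <= normc (X k).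
  by rewrite normY ler_piMl// weight_le1.
have [j hj] : exists j, forall i, normc (Y i) <= 2 * normc (Y j).
  apply: (@near_max _ _ 0 _ B) => k; rewrite normc_ge0/=.
  exact: le_trans (YX k) (XB k).
have hY : delta * normc (Y j) <= beta + delta / 2 * normc (Y j).
  apply: (hd A D Y) => //.
  - by move=> k Dk; rewrite /Y (sX _ Dk) mulr0.
  - by exists B => k; exact: le_trans (YX k) (XB k).
  - by rewrite addr_ge0// mulr_ge0//; lra.
  move=> k Dk.
  have h1 := trop_weight i rho01 X k (hK A AM).
  have h2 : normc ((weight rho i k)%:C * trop A X k) <= beta.
    rewrite normcM normc_real (ger0_norm (ltW (weight_gt0 _ rho01 _))).
    by rewrite /weight -abszN opprB hbeta.
  have h3 : K * (rho^-1 - 1) * (normc (Y (k - 1)) + normc (Y (k + 1))) <=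
     delta / 2 * normc (Y j).
    have r0 : rho^-1 - 1 = delta / (8 * (K + 1)) by rewrite invrK; ring.
    have h4 : K * (rho^-1 - 1) <= delta / 8.
      have -> : delta / 8 = (K + 1) * (rho^-1 - 1) by rewrite r0; field; lra.
      by rewrite r0 ler_wpM2r ?ltW//; lra.
    apply: le_trans (ler_wpM2r _ h4) _; first by rewrite addr_ge0.
    have := hj (k - 1); have := hj (k + 1).
    set a := normc (Y (k - 1)); set b := normc (Y (k + 1)); set c := normc (Y j).
    have -> : delta / 2 * c = delta / 8 * (4 * c) by field.
    by move=> ? ?; apply: ler_wpM2l; rewrite ?divr_ge0 ?(ltW d0)//; lra.
  have := normcD (trop A Y k - (weight rho i k)%:C * trop A X k)
    ((weight rho i k)%:C * trop A X k).
  rewrite subrK => h; apply: (le_trans h); rewrite addrC lerD//.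
  exact: le_trans h1 h3.
have Yj : normc (Y j) <= 2 / delta * beta.
  rewrite mulrAC ler_pdivlMr//; lra.
have -> : normc (X i) = normc (Y i) by rewrite normY weight_center mul1r.
have := hj i; have -> : 4 / delta * beta = 2 * (2 / delta * beta) by field; rewrite gt_eqF.
lra.
Qed.

Lemma lpb_lower_bound p : (1 <= p)%E -> exists2 Cp : R, 0 <= Cp &
  forall A D X m, Mbi U V W A -> P D -> supp D X -> bounded_fun X ->
    lpb p (cut D (trop A X)) m -> lpb p X (Cp * m).
Proof.
move=> p1; have [C [rho [C0 rho01 h]]] := weighted_lower_bound.
have [Cp Cp0 hCp] := weighted_sup_lpb p1 C0 rho01.
exists Cp => // A D X m AM PD sX bX; apply: hCp => i beta hb.
apply: h (AM) (PD) sX bX _ _ => [j Dj|].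
  by have := hb j; rewrite cut_in.
apply: le_trans (hb 0); rewrite mulr_ge0 ?exprn_ge0//.
by case/andP: rho01 => /ltW.
Qed.

Lemma trop_injective A D X Y : Mbi U V W A -> P D -> supp D X -> supp D Y ->
  bounded_fun X -> bounded_fun Y ->
  (forall i, D i -> trop A X i = trop A Y i) -> X = Y.
Proof.
move=> AM PD sX sY [B XB] [C YC] h; apply/funext => i; apply/eqP.
rewrite -subr_eq0; apply/eqP.
apply: (P_inj AM PD (X := fun k => X k - Y k)) => [k Dk||k Dk].
- by rewrite sX// sY// subr0.
- exists (B + C) => k; apply: le_trans (normcD _ _) _.
  by rewrite normcN lerD.
- by rewrite tropB h// subrr.
Qed.

End UniformBound.
End Entries.

(** * Operator norms and inverses as inequalities *)

Section OperatorNorm.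
Variables (R : realType) (I : choiceType) (p : \bar R).
Hypothesis p1 : (1 <= p)%E.
Implicit Types (T : (I -> R[i]) -> I -> R[i]) (x y : I -> R[i]).

Lemma lpb_eq x y m : x =1 y -> lpb p x m -> lpb p y m.
Proof. by move=> /funext ->. Qed.

Lemma lp_scale (z : R[i]) x : lp p x -> lp p (fun i => z * x i).
Proof. by move=> /lpb_ex[]// m h; apply/lpb_ex => //; exists (normc z * m); exact: lpbZ. Qed.

(** Homogeneity is asked only on l^p, because nothing is known about [opinv] outside it. *)
Lemma opnormP T c : (forall z x, lp p x -> T (fun i => z * x i) = (fun i => z * T x i)) ->
  0 <= c ->
  (opnorm p T <= c%:E)%E <-> (forall x m, lpb p x m -> lpb p (T x) (c * m)).
Proof.
move=> TZ c0; split=> [h x m hx|h]; last first.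
  apply: ge_ereal_sup => _ [x /= x1 <-]; apply/lpbP => //; rewrite -[c]mulr1.
  by apply: h; apply/lpbP.
have m0 := lpb_ge0 hx; apply: lpb_cl => // e e0.
(* Strictly positive even for m = 0, so that x can be divided by it, and still c d <= c m + e. *)
pose d := m + e / (c + 1).
have c1 : 0 < c + 1 by lra.
have d0 : 0 < d by rewrite /d ltr_wpDl// divr_gt0.
have lpx : lp p x by apply/lpb_ex => //; exists m.
have dn0 : d%:C != 0 :> R[i] by rewrite -normc_eq0 normc_real normr_eq0 gt_eqF.
pose y i := (d%:C)^-1 * x i.
have : (lpnorm p (T y) <= c%:E)%E.
  apply: le_trans h; apply: ereal_sup_ubound; exists y => //=.
  apply/lpbP => //; apply: lpb_mono (lpbZ _ p1 hx) => //.
  rewrite normcV normc_real ger0_norm ?(ltW d0)// mulrC ler_pdivrMr// mul1r.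
  by rewrite /d lerDl divr_ge0// ltW.
move=> /lpbP -/(_ p1 c0) /(lpbZ d%:C p1); rewrite /y TZ// normc_real ger0_norm ?(ltW d0)//.
move=> h1; apply: lpb_mono (lpb_eq _ h1) => //.
  rewrite /d mulrDl mulrC lerD2l mulrAC ler_pdivrMr// ler_wpM2l ?(ltW e0)//.
  by rewrite lerDl.
by move=> i; rewrite mulrA divff// mul1r.
Qed.

Lemma lp_bounded_of T (C : R) : 0 <= C ->
  (forall z x, lp p x -> T (fun i => z * x i) = (fun i => z * T x i)) ->
  (forall x m, lpb p x m -> lpb p (T x) (C * m)) -> lp_bounded p T.
Proof.
move=> C0 TZ h; split; last by apply: (@le_lt_trans _ _ C%:E); [apply/opnormP|exact: ltry].
by move=> x /lpb_ex[]// m hx; apply/lpb_ex => //; exists (C * m); exact: h.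
Qed.

Lemma opnorm_fin T : (opnorm p T < +oo)%E -> exists2 c : R, 0 <= c & (opnorm p T <= c%:E)%E.
Proof.
case: (opnorm p T) => [c _|//|_]; last by exists 0; rewrite ?leNye.
by exists (Num.max 0 c); [rewrite le_max lexx|rewrite lee_fin le_max lexx orbT].
Qed.

Section Inverse.
Variable T : (I -> R[i]) -> I -> R[i].
Hypothesis TZ : forall z x, T (fun i => z * x i) = (fun i => z * T x i).
Hypothesis bijT : set_bij (lp p) (lp p) T.

Lemma opinvK x : lp p x -> opinv p T (T x) = x.
Proof.
move=> xp; apply: pinvKV; last by rewrite inE.
by case: bijT => _ + _; apply.
Qed.

Lemma opinv_lp y : lp p y -> lp p (opinv p T y) /\ T (opinv p T y) = y.
Proof.
move=> yp; have [_ _ /(_ y yp) [x xp <-]] := bijT.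
by rewrite opinvK.
Qed.

Lemma opinvZ z y : lp p y -> opinv p T (fun i => z * y i) = (fun i => z * opinv p T y i).
Proof.
move=> yp; have [xp <-] := opinv_lp yp.
by rewrite -TZ !opinvK//; exact: lp_scale.
Qed.

Lemma opnorm_opinvP c : 0 <= c -> (opnorm p (opinv p T) <= c%:E)%E <->
  (forall x m, lp p x -> lpb p (T x) m -> lpb p x (c * m)).
Proof.
move=> c0; rewrite (opnormP opinvZ c0); split=> h x m.
  by move=> xp /h; rewrite opinvK.
move=> xm; have xp : lp p x by apply/lpb_ex => //; exists m.
by have [yp yE] := opinv_lp xp; apply: h => //; rewrite yE.
Qed.

End Inverse.

Lemma lp_invertible_lower_bound (T : (I -> R[i]) -> I -> R[i]) :
  (forall z x, T (fun i => z * x i) = (fun i => z * T x i)) ->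
  lp_invertible p T ->
  exists2 c : R, 0 <= c & forall x m, lp p x -> lpb p (T x) m -> lpb p x (c * m).
Proof.
move=> TZ [_ bT [_ /opnorm_fin[c c0 hc]]]; exists c => //.
by apply/(opnorm_opinvP TZ).
Qed.

End OperatorNorm.

(** * Compressions of line matrices to index sets *)

Section Represents.
Variables (R : realType) (I : choiceType) (pos : I -> int).
Implicit Types (A : int -> int -> R[i]) (X Y : int -> R[i]) (x y : I -> R[i]).

(* [a] is the compression of [A] to [D], so that matrices on the line, on the
   half-line and finite ones are all compressions of matrices on the line. *)
Definition represents (a : I -> I -> R[i]) A (D : set int) : Prop :=
  [/\ injective pos, range pos = D & forall i j, a i j = A (pos i) (pos j)].

Definition ext x : int -> R[i] := fun k =>
  if pselect (exists i, pos i = k) is left h then x (sval (cid h)) else 0.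

Hypothesis pos_inj : injective pos.

Lemma ext_pos x i : ext x (pos i) = x i.
Proof.
rewrite /ext; case: pselect => [h|[]]; last by exists i.
by congr x; apply: pos_inj; exact: svalP (cid h).
Qed.

Lemma ext_out x k : (forall i, pos i <> k) -> ext x k = 0.
Proof. by move=> h; rewrite /ext; case: pselect => // e; have [i /h] := e. Qed.

Lemma ext_restr D X : range pos = D -> supp D X -> ext (X \o pos) = X.
Proof.
move=> <- sX; apply/funext => k; have [[i <-]|/forallNP h] := pselect (exists i, pos i = k).
  by rewrite ext_pos.
by rewrite ext_out// sX// => -[i _]; exact: h.
Qed.

Lemma supp_ext D x : range pos = D -> supp D (ext x).
Proof. by move=> <- k Dk; apply: ext_out => i ik; apply: Dk; exists i. Qed.

Lemma extZ z x : ext (fun i => z * x i) = (fun k => z * ext x k).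
Proof. by apply/funext => k; rewrite /ext; case: pselect => // _; rewrite mulr0. Qed.

Lemma ext_lpb p x m : (1 <= p)%E -> lpb p (ext x) m <-> lpb p x m.
Proof.
move=> p1; split=> h.
  by have := lpb_inj pos_inj h; apply: lpb_eq => // i /=; rewrite ext_pos.
apply: (lpb_ext p1 _ _ h) => [i|j]; first exact: ext_pos.
exact: ext_out.
Qed.

Section Op.
Variables (a : I -> I -> R[i]) (A : int -> int -> R[i]) (D : set int).
Hypothesis aAD : represents a A D.
Hypothesis Atri : forall i j : int, 1 < `|i - j| -> A i j = 0.

Let rD : range pos = D. Proof. by case: aAD. Qed.

Lemma matopE x i : matop a x i = trop A (ext x) (pos i).
Proof.
have [_ _ aA] := aAD.
pose F k := A (pos i) k * ext x k.
transitivity (\sum_(k \in [set: int]) F k).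
  rewrite -(fsbig_widen (range pos))//; last first.
    by move=> k [_ /= nk]; rewrite /F ext_out ?mulr0// => j jk; apply: nk; exists j.
  rewrite fsbig_image//; last by move=> ? ? _ _; exact: pos_inj.
  by rewrite /matop; apply: eq_fsbigr => j _; rewrite /F ext_pos aA.
rewrite -(fsbig_widen [set` [:: pos i - 1; pos i; pos i + 1]])//; last first.
  move=> k [_ /=]; rewrite !inE => /negP; rewrite !negb_or => /and3P[k1 k2 k3].
  by rewrite /F Atri ?mul0r//; lia.
rewrite -fsbig_seq; last first.
  by rewrite /= !inE; apply/and3P; split=> //; apply/negP; lia.
by rewrite !big_cons big_nil /= addr0 /F /trop addrA.
Qed.

Lemma matopZ z x : matop a (fun i => z * x i) = (fun i => z * matop a x i).
Proof. by apply/funext => i; rewrite !matopE extZ tropZ. Qed.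

Lemma ext_matop x : ext (matop a x) = cut D (trop A (ext x)).
Proof.
apply/funext => k; have [[i <-]|/forallNP h] := pselect (exists i, pos i = k).
  by rewrite ext_pos cut_in ?matopE// -rD; exists i.
rewrite ext_out// cut_out// -rD => -[i _]; exact: h.
Qed.

End Op.
End Represents.

Section Bounds.
Variable R : realType.
Implicit Types (A : int -> int -> R[i]) (X Y b : int -> R[i]) (D : set int) (p : \bar R).

Definition upper_bound p A D (c : R) : Prop :=
  forall X m, supp D X -> lpb p X m -> lpb p (cut D (trop A X)) (c * m).

(** X is only assumed to be bounded. Thus a lower bound also carries a bounded solution, as provided
    by [solvable], into l^p. *)
Definition lower_bound p A D (c : R) : Prop :=
  forall X m, supp D X -> bounded_fun X ->
    lpb p (cut D (trop A X)) m -> lpb p X (c * m).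

Definition solvable p A D : Prop := forall b, supp D b -> lp p b ->
  exists X, [/\ supp D X, bounded_fun X & forall i, D i -> trop A X i = b i].

Variables (I : choiceType) (pos : I -> int).
Variables (a : I -> I -> R[i]) (A : int -> int -> R[i]) (D : set int).
Hypothesis aAD : represents pos a A D.
Hypothesis Atri : forall i j : int, 1 < `|i - j| -> A i j = 0.
Variable p : \bar R.
Hypothesis p1 : (1 <= p)%E.

Let pi : injective pos. Proof. by case: aAD. Qed.
Let rD : range pos = D. Proof. by case: aAD. Qed.

Lemma mxnormP c : 0 <= c -> (mxnorm p a <= c%:E)%E <-> upper_bound p A D c.
Proof.
move=> c0; have aZ := matopZ pi aAD Atri.
rewrite /mxnorm opnormP//; split=> h.
  move=> X m sX; rewrite -(ext_restr pi rD sX) => hX.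
  rewrite -(ext_matop pi aAD Atri); apply/(ext_lpb pi _ _ p1); apply: h.
  exact/(ext_lpb pi _ _ p1).
move=> x m hx; apply/(ext_lpb pi _ _ p1); rewrite (ext_matop pi aAD Atri); apply: h.
  exact: supp_ext.
exact/(ext_lpb pi _ _ p1).
Qed.

Lemma lp_invertibleP C K : 0 <= C -> 0 <= K -> (forall i j, normc (A i j) <= K) ->
  lower_bound p A D C -> solvable p A D -> lp_invertible p (matop a).
Proof.
move=> C0 K0 AK lbA solA; have aZ := matopZ pi aAD Atri.
have ub x m : lpb p x m -> lpb p (matop a x) (3 * K * m).
  move=> hx; apply/(ext_lpb pi _ _ p1); rewrite (ext_matop pi aAD Atri).
  by apply: lpb_cut => //; apply: trop_lpb => //; exact/(ext_lpb pi _ _ p1).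
have lb x m : lp p x -> lpb p (matop a x) m -> lpb p x (C * m).
  move=> /lpb_ex -/(_ p1)[k hk] hx; apply/(ext_lpb pi _ _ p1); apply: lbA.
  - exact: supp_ext.
  - by apply: (@lpb_bounded_fun _ p _ k) => //; exact/(ext_lpb pi _ _ p1).
  - by rewrite -(ext_matop pi aAD Atri); exact/(ext_lpb pi _ _ p1).
have bij : set_bij (lp p) (lp p) (matop a).
  split.
  - by move=> x /lpb_ex[]// m hx; apply/lpb_ex => //; exists (3 * K * m); exact: ub.
  - move=> x y; rewrite !inE => xp yp xy.
    have [k hk] := (lpb_ex x p1).1 xp; have [l hl] := (lpb_ex y p1).1 yp.
    apply/funext => i; apply/eqP; rewrite -subr_eq0 -normc_eq0 eq_le normc_ge0 andbT.
    have hxy : lpb p (fun i => x i - y i) (k + l).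
      apply: lpbD => //; rewrite (_ : (fun i => - y i) = (fun i => -1 * y i)).
        by have := lpbZ (-1) p1 hl; rewrite normcN normc1 mul1r.
      by apply/funext => j; rewrite mulN1r.
    have h0 : lpb p (fun i => x i - y i) (C * 0).
      apply: lb; first by apply/lpb_ex => //; exists (k + l).
      apply: lpb0 => // j; rewrite (matopE pi aAD Atri).
      have -> : ext pos (fun i => x i - y i) = (fun k => ext pos x k - ext pos y k).
        by apply/funext => n; rewrite /ext; case: pselect => // _; rewrite subr0.
      by rewrite tropB -!(matopE pi aAD Atri) xy subrr.
    by have := lpb_pt i p1 h0; rewrite mulr0.
  - move=> y yp; have [k hk] := (lpb_ex y p1).1 yp.
    have hy : lpb p (ext pos y) k by exact/(ext_lpb pi _ _ p1).
    have [||X [sX bX hX]] := solA (ext pos y).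
    + exact: supp_ext.
    + by apply/lpb_ex => //; exists k.
    exists (X \o pos).
      apply/lpb_ex => //; exists (C * k); apply/(ext_lpb pi _ _ p1).
      rewrite (ext_restr pi rD sX); apply: lbA => //.
      rewrite (_ : cut D _ = ext pos y)//; apply/funext => n.
      have [Dn|Dn] := pselect (D n); first by rewrite cut_in// hX.
      by rewrite cut_out// (supp_ext y rD).
    apply/funext => i; rewrite (matopE pi aAD Atri) (ext_restr pi rD sX) hX.
      by rewrite ext_pos.
    by rewrite -rD; exists i.
split=> //; first by apply: (@lp_bounded_of _ _ _ _ _ (3 * K)) => //; rewrite mulr_ge0.
split; last by apply: (@le_lt_trans _ _ C%:E); [apply/(opnorm_opinvP p1 aZ bij)|exact: ltry].
by move=> y /(opinv_lp bij)[].
Qed.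

(** [C] is an a priori constant that secures invertibility, without which [invnorm] is +oo by
    definition; [c] is the bound under test. *)
Lemma invnormP c C K : 0 <= c -> 0 <= C -> 0 <= K ->
  (forall i j, normc (A i j) <= K) ->
  lower_bound p A D C -> solvable p A D ->
  (invnorm p a <= c%:E)%E <-> lower_bound p A D c.
Proof.
move=> c0 C0 K0 AK lbA solA; have inva := lp_invertibleP C0 K0 AK lbA solA.
have aZ := matopZ pi aAD Atri; have [_ bij _] := inva.
rewrite /invnorm asboolT// (opnorm_opinvP p1 aZ bij c0); split=> h.
  move=> X m sX bX hX; have Xl := lbA X m sX bX hX.
  rewrite -(ext_restr pi rD sX); apply/(ext_lpb pi _ _ p1); apply: h.
    apply/lpb_ex => //; exists (C * m); apply/(ext_lpb pi _ _ p1).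
    by rewrite (ext_restr pi rD sX).
  by apply/(ext_lpb pi _ _ p1); rewrite (ext_matop pi aAD Atri) (ext_restr pi rD sX).
move=> x m /lpb_ex -/(_ p1)[k hk] hx; apply/(ext_lpb pi _ _ p1); apply: h.
- exact: supp_ext.
- by apply: (@lpb_bounded_fun _ p _ k) => //; exact/(ext_lpb pi _ _ p1).
- by rewrite -(ext_matop pi aAD Atri); exact/(ext_lpb pi _ _ p1).
Qed.

End Bounds.

Lemma represents_int (R : realType) (A : int -> int -> R[i]) :
  represents id A A setT.
Proof. by split=> //; exact: image_id. Qed.

Lemma ext_id (R : realType) (X : int -> R[i]) : ext id X = X.
Proof. by apply: (ext_restr (@inj_id int) (image_id setT)) => k []. Qed.

Definition halfline : set int := [set i | 0 <= i].

Lemma range_Posz : range Posz = halfline.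
Proof.
apply/seteqP; split=> [_ [n _ <-]|i /= i0]; first by rewrite /halfline.
by exists (absz i) => //; move: i0; rewrite /halfline/=; lia.
Qed.

Lemma represents_nat (R : realType) (A : int -> int -> R[i]) :
  represents Posz (fun i j : nat => A i j) A halfline.
Proof. by split=> //; [move=> ? ? []|exact: range_Posz]. Qed.

(** * The alternative for operators of index 0 *)

Section Fredholm.
Variables (R : realType) (I : choiceType) (p : \bar R).
Hypothesis p1 : (1 <= p)%E.
Variable T : (I -> R[i]) -> I -> R[i].
Hypothesis T0 : T (fun=> 0) = (fun=> 0).
Hypothesis hT : lp_fredholm_index p T 0.

Let lp0 : lp p (fun _ : I => 0 : R[i]).
Proof. by apply/lpb_ex => //; exists 0; exact: lpb0. Qed.

(** A nonzero kernel gives d > 0, hence a cokernel of the same positive dimension. Were its first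
    basis vector in the range, that vector would have two coordinate vectors. *)
Lemma index0_kernel x : lp p x -> T x = (fun=> 0) -> x <> (fun=> 0) ->
  ~ (forall y, lp p y -> exists2 z, lp p z & T z = y).
Proof.
move=> xp Tx xn0 surj; have [_ [d [d' [[e hd] [f fp hd'] dd']]]] := hT.
have {dd'}E : d' = d by move: dd'; lia.
subst d'; case: d e hd f fp hd' => [|d] e hd f fp hd'.
  have [/(_ (conj xp Tx)) [c [xE _]] _] := hd x.
  by apply: xn0; rewrite xE; apply/funext => i; rewrite big_ord0.
have [c [_ uc]] := hd' (f ord0) (fp ord0).
have c1 : c = [ffun k => (k == ord0)%:R].
  apply: uc; exists (fun=> 0) => //; apply/funext => i; rewrite T0 add0r.
  rewrite (bigD1 ord0)//= ffunE eqxx mul1r big1 ?addr0// => k /negbTE k0.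
  by rewrite ffunE k0 mul0r.
have c0 : c = [ffun=> 0].
  have [z zp Tz] := surj (f ord0) (fp ord0).
  apply: uc; exists z => //; apply/funext => i; rewrite Tz big1 ?addr0// => k _.
  by rewrite ffunE mul0r.
have := congr1 (fun g : {ffun 'I_d.+1 -> R[i]} => g ord0) (etrans (esym c1) c0).
by rewrite !ffunE eqxx => /eqP; rewrite oner_eq0.
Qed.

(** If d were positive, the first basis vector of the kernel would be 0, and 0 would have two
    coordinate vectors. So both dimensions vanish. *)
Lemma index0_injective : (forall x, lp p x -> T x = (fun=> 0) -> x = (fun=> 0)) ->
  forall y, lp p y -> exists2 z, lp p z & T z = y.
Proof.
move=> inj y yp; have [_ [d [d' [[e hd] [f fp hd'] dd']]]] := hT.
have {dd'}E : d' = d by move: dd'; lia.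
subst d'; case: d e hd f fp hd' => [|d] e hd f fp hd'; last first.
  have [/(_ (conj lp0 T0))[c0 [c0E uc0]] _] := hd (fun=> 0).
  pose c1 : {ffun 'I_d.+1 -> R[i]} := [ffun k => (k == ord0)%:R].
  have c1E : e ord0 = (fun i => \sum_(k < d.+1) c1 k * e k i).
    apply/funext => i; rewrite (bigD1 ord0)//= ffunE eqxx mul1r big1 ?addr0// => k /negbTE k0.
    by rewrite ffunE k0 mul0r.
  have ker : [set x | lp p x /\ T x = (fun=> 0)] (e ord0).
    apply/hd; exists c1; split=> // c cE.
    have : c0 = [ffun k => c0 k + (c k - c1 k)].
      apply: uc0; apply/funext => i.
      under eq_bigr do rewrite ffunE mulrDl mulrBl.
      rewrite big_split/= sumrB; move/(congr1 (fun g => g i)): c0E => /= <-.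
      move/(congr1 (fun g => g i)): cE => /= <-; move/(congr1 (fun g => g i)): c1E => /= <-.
      by rewrite subrr addr0.
    move=> /ffunP h; apply/ffunP => k; have := h k; rewrite ffunE => hk.
    by apply/eqP; rewrite eq_sym -subr_eq0 -(inj_eq (addrI (c0 k))) -hk addr0.
  case: ker => ep Te; have e0 := inj _ ep Te.
  have h0 : c0 = c1 by apply: uc0; rewrite -c1E e0.
  have h1 : c0 = [ffun=> 0].
    by apply: uc0; apply/funext => i; rewrite big1// => k _; rewrite ffunE mul0r.
  have := congr1 (fun g : {ffun 'I_d.+1 -> R[i]} => g ord0) (etrans (esym h0) h1).
  by rewrite !ffunE eqxx => /eqP; rewrite oner_eq0.
have [c [[x xp yE] _]] := hd' y yp.
by exists x => //; rewrite yE; apply/funext => i; rewrite big_ord0 addr0.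
Qed.

End Fredholm.

(** * Symmetries of the class; compatibility gives injectivity on the line *)

Section Compatible.
Variable R : realType.
Implicit Types (U V W : set R[i]) (A C : int -> int -> R[i]) (X Y : int -> R[i]).

Definition injective_Z U V W : Prop := forall A X, Mbi U V W A -> bounded_fun X ->
  (forall i, trop A X i = 0) -> forall i, X i = 0.

Definition injective_half U V W : Prop := forall A X, Mbi U V W A ->
  supp halfline X -> bounded_fun X ->
  (forall i, halfline i -> trop A X i = 0) -> forall i, X i = 0.

Lemma entry_opp U V W (i j k : int) u :
  entry U V W (k - i) (k - j) u -> entry W V U i j u.
Proof.
move=> [h1 h2 h3 h4].
by split=> h; [apply: h3|apply: h2|apply: h1|apply: h4]; move: h; lia.
Qed.

Lemma entry_tr U V W (i j : int) u : entry U V W j i u -> entry W V U i j u.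
Proof.
move=> [h1 h2 h3 h4].
by split=> h; [apply: h3|apply: h2|apply: h1|apply: h4]; move: h; lia.
Qed.

Definition tr A i j := A j i.
Definition refl (k : int) A i j := A (k - i) (k - j).

Lemma Mbi_tr U V W A : Mbi U V W A -> Mbi W V U (tr A).
Proof. by move=> AM; apply/MbiP => i j; apply: entry_tr; exact: AM. Qed.

Lemma Mbi_refl U V W A k : Mbi U V W A -> Mbi W V U (refl k A).
Proof. by move=> AM; apply/MbiP => i j; apply: (@entry_opp U V W _ _ k); exact: AM. Qed.

Lemma Mbi_shift U V W A k : Mbi U V W A -> Mbi U V W (fun i j => A (i + k) (j + k)).
Proof. by move=> AM; apply/MbiP => i j; apply/(entry_shift _ _ _ _ _ k _).1; exact: AM. Qed.

Lemma Mbi_far U V W A : Mbi U V W A -> forall i j : int, 1 < `|i - j| -> A i j = 0.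
Proof. by move=> AM i j; have [] := AM i j. Qed.

Lemma trop_refl k A X i : trop (refl k A) (fun j => X (k - j)) i = trop A X (k - i).
Proof.
rewrite /trop /refl.
have -> : k - (i - 1) = k - i + 1 by ring.
have -> : k - (i + 1) = k - i - 1 by ring.
by ring.
Qed.

Lemma trop_shift k A X i :
  trop (fun i j => A (i + k) (j + k)) (fun j => X (j + k)) i = trop A X (i + k).
Proof.
rewrite /trop.
have -> : i - 1 + k = i + k - 1 by ring.
by have -> : i + 1 + k = i + k + 1 by ring.
Qed.

Lemma bounded_refl k X : bounded_fun X -> bounded_fun (fun j => X (k - j)).
Proof. by move=> [B h]; exists B => j. Qed.

Lemma bounded_shift k X : bounded_fun X -> bounded_fun (fun j => X (j + k)).
Proof. by move=> [B h]; exists B => j. Qed.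

Lemma injective_Z_refl U V W : injective_Z U V W -> injective_Z W V U.
Proof.
move=> inj A X AM bX hX i.
have := inj _ _ (Mbi_refl 0 AM) (bounded_refl 0 bX) _ (- i).
by rewrite sub0r opprK; apply=> j; rewrite trop_refl.
Qed.

Section KernelCompatible.
Variables U V W : set R[i].
Hypotheses (cU : compact (U : set R[i]^o)) (cV : compact (V : set R[i]^o))
  (cW : compact (W : set R[i]^o)).
Hypothesis hcompat : compatible U V W.

(* Bounded kernel vectors become p-summable when multiplied by
   exponential weights. *)
Lemma compatible_injective_Z : injective_Z U V W.
Proof.
move=> A X AM [B XB] hX i0.
have [s s1 sinv] := hcompat AM.
have AZ := matopZ (@inj_id int) (represents_int A) (Mbi_far AM).
have [c c0 hc] := lp_invertible_lower_bound s1 AZ sinv.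
have [K K0 hK] := Mbi_bounded cU cV cW.
(* Makes c K (1/rho - 1) at most 1/4, so that the two neighbours in the commutator estimate together
   cost at most a factor 1/2. *)
pose rho := (1 + (4 * (c + 1) * (K + 1))^-1)^-1.
have q0 : 0 < (4 * (c + 1) * (K + 1))^-1 by rewrite invr_gt0 !mulr_gt0//; lra.
have rho01 : 0 < rho < 1.
  by rewrite invr_gt0 invf_lt1; lra.
have rE : rho^-1 - 1 = (4 * (c + 1) * (K + 1))^-1 by rewrite invrK; ring.
pose Y k := (weight rho i0 k)%:C * X k.
have B0 : 0 <= B by apply: le_trans (XB 0).
have [Cp Cp0 hCp] := weighted_sup_lpb s1 B0 rho01.
(* |Y i| is at most B rho^|i - i0|, which is B times the weighted supremum of a unit mass at i0. *)
have Ybound : exists m, lpb s Y m.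
  exists (Cp * 1); apply: (hCp _ (fun j => if j == i0 then 1 else 0)).
    move=> i beta /(_ i0); rewrite eqxx normc1 mulr1 => h.
    rewrite normcM normc_real (ger0_norm (ltW (weight_gt0 _ rho01 _))) mulrC.
    by rewrite ler_pM// ltW// weight_gt0.
  by rewrite -[X in lpb _ _ X](@normc1 R); exact: lpb_delta.
have aux (a b k : R) : 0 < a -> 0 < b -> k / 2 = a * b * ((4 * a * b)^-1 * (k + k)).
  by move=> a0 b0; field; rewrite !gt_eqF.
(* As A X = 0, the image of Y is just the commutator applied to X. Hence every l^s bound for Y can
   be halved, which forces Y = 0. *)
have half m : lpb s Y m -> lpb s Y (m / 2).
  move=> hY; have m0 := lpb_ge0 hY.
  have hT : lpb s (trop A Y) (K * (rho^-1 - 1) * (m + m)).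
    have nn k : 0 <= normc (Y (k - 1)) + normc (Y (k + 1)) by rewrite addr_ge0.
    apply: (@lpb_leZ _ _ _ _ (fun k => (normc (Y (k - 1)) + normc (Y (k + 1)))%:C)) => //.
    - by rewrite rE mulr_ge0// ltW.
    - move=> k; rewrite normc_real (ger0_norm (nn k)).
      have := trop_weight i0 rho01 X k (hK A AM).
      by rewrite hX mulr0 subr0.
    have h1 d := lpb_normc_shift d s1 hY.
    apply: lpb_le (lpbD s1 (h1 (-1)) (h1 1)) => // k.
    by rewrite rmorphD.
  have hM : lpb s (matop A Y) (K * (rho^-1 - 1) * (m + m)).
    apply: lpb_eq hT => k; rewrite (matopE (@inj_id int) (represents_int A) (Mbi_far AM)).
    by rewrite ext_id.
  apply: lpb_mono (hc _ _ _ hM) => //; last first.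
    by apply/lpb_ex => //; exists m.
  have h2 : c * K <= (c + 1) * (K + 1) by apply: ler_pM => //; lra.
  have -> : m / 2 = (c + 1) * (K + 1) * ((rho^-1 - 1) * (m + m)).
    by rewrite rE; apply: aux; lra.
  rewrite -[K * _ * _]mulrA mulrA; apply: ler_wpM2r => //.
  by rewrite rE mulr_ge0 ?addr_ge0// ltW.
have [m hm] := Ybound; have m0 := lpb_ge0 hm.
have iter n : lpb s Y (m / 2 ^+ n).
  elim: n => [|n /half]; first by rewrite expr0 divr1.
  by rewrite exprSr invfM mulrA.
have : X i0 = 0; last by [].
have -> : X i0 = Y i0 by rewrite /Y weight_center mul1r.
apply/normc_small => e e0.
pose n := Num.truncn (m / e).
have h1 := lpb_pt i0 s1 (iter n.+1).
apply: (le_lt_trans h1); rewrite ltr_pdivrMr ?exprn_gt0// mulrC -ltr_pdivrMr//.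
apply: (lt_trans (truncnS_gt _)).
by rewrite -natrX ltr_nat ltn_expl.
Qed.

End KernelCompatible.
End Compatible.

(** * Gluing and injectivity on half-lines *)

Section Coburn.
Variable R : realType.
Implicit Types (A C : int -> int -> R[i]) (X Y : int -> R[i]).

Section Glue.
Variables U V W : set R[i].
Hypotheses (U0 : U !=set0) (V0 : V !=set0) (W0 : W !=set0).

(* Join X, with a separating entry 0, to the reflection of Y; suitable
   multiples of the two parts make the separating row vanish. *)
Lemma glue_kernels A C X Y : injective_Z U V W -> Mbi U V W A -> Mbi W V U C ->
  supp halfline X -> bounded_fun X -> (forall i, halfline i -> trop A X i = 0) ->
  supp halfline Y -> bounded_fun Y -> (forall i, halfline i -> trop C Y i = 0) ->
  (exists i, X i != 0) -> forall i, Y i = 0.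
Proof.
move=> inj AM CM sX [B XB] hX sY [B' YB] hY [k Xk] i.
have k0 : 0 <= k by apply: contrapT => nk; move/eqP: Xk; apply; exact: sX.
pose F := fill U0 V0 W0.
pose u := F 0 (-1) * Y 0; pose w := F 0 1 * X 0.
(* Row 0 of the glued system reads u a + w b = 0. The pair (w, -u) solves it and is nonzero unless
   both coefficients vanish, when every pair does. *)
pose ab := if (u == 0) && (w == 0) then (1, 1) else (w, - u).
have abuw : u * ab.1 + w * ab.2 = 0.
  rewrite /ab; case: ifP => [/andP[/eqP -> /eqP ->]|_] /=; first by rewrite !mul0r addr0.
  by ring.
have abn0 : ab.1 != 0 \/ ab.2 != 0.
  rewrite /ab; case: ifPn => [_|]; first by left; rewrite oner_eq0.
  by rewrite negb_and => /orP[h|h]; [right|left] => //=; rewrite oppr_eq0.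
pose A' i j := if (1 <= i) && (1 <= j) then A (i - 1) (j - 1) else
  if (i <= -1) && (j <= -1) then C (-1 - i) (-1 - j) else F i j.
pose Z i := if 1 <= i then ab.2 * X (i - 1) else
  if i <= -1 then ab.1 * Y (-1 - i) else 0.
have A'M : Mbi U V W A'.
  apply/MbiP => a b; rewrite /A'; case: ifP => _.
    exact: ((entry_shift _ _ _ _ _ (-1) _).1 (AM (a - 1) (b - 1))).
  case: ifP => _; last exact: entry_fill.
  by apply: (@entry_opp _ W V U _ _ (-1)); exact: CM.
have Z0 : forall i, Z i = 0.
  apply: (inj A' Z A'M).
    exists (normc ab.2 * B + normc ab.1 * B') => a; rewrite /Z.
    have B0 : 0 <= B by apply: le_trans (XB 0).
    have B'0 : 0 <= B' by apply: le_trans (YB 0).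
    case: ifP => _; first by rewrite normcM ler_wpDr ?mulr_ge0// ler_wpM2l.
    case: ifP => _; first by rewrite normcM ler_wpDl ?mulr_ge0// ler_wpM2l.
    by rewrite normc0 addr_ge0// mulr_ge0.
  move=> a; have [a0|a0|a0] := ltrgtP a 0.
  - have <- : ab.1 * trop C Y (-1 - a) = 0 by rewrite hY ?mulr0// /halfline/=; lia.
    have e1 : -1 - (a - 1) = -1 - a + 1 by ring.
    have e2 : -1 - (a + 1) = -1 - a - 1 by ring.
    have a1 : a <= -1 by lia.
    have a2 : a - 1 <= -1 by lia.
    have f1 : (1 <= a) = false by lia.
    have f2 : (1 <= a - 1) = false by lia.
    have f3 : (1 <= a + 1) = false by lia.
    rewrite /trop /A' /Z f1 f2 f3 a1 a2 /= e1 e2.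
    have [a3|a3] := boolP (a + 1 <= -1); first by ring.
    have -> : Y (-1 - a - 1) = 0 by apply: sY; rewrite /halfline/=; lia.
    by ring.
  - have <- : ab.2 * trop A X (a - 1) = 0 by rewrite hX ?mulr0// /halfline/=; lia.
    have e1 : a + 1 - 1 = a - 1 + 1 by ring.
    have a1 : 1 <= a by lia.
    have a2 : 1 <= a + 1 by lia.
    have f1 : (a - 1 <= -1) = false by lia.
    rewrite /trop /A' /Z a1 a2 f1 /= e1.
    have [a3|a3] := boolP (1 <= a - 1); first by ring.
    have -> : X (a - 1 - 1) = 0 by apply: sX; rewrite /halfline/=; lia.
    by ring.
  - subst a; rewrite /trop /A' /Z /= -[RHS]abuw /u /w.
    have -> : 0 - 1 = -1 :> int by [].
    have -> : 0 + 1 = 1 :> int by [].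
    have -> : 1 - 1 = 0 :> int by [].
    by rewrite /=; ring.
(* The glued vector vanishes and X does not, so the multiple of X is 0. Then the multiple of Y is
   not, and Y must vanish. *)
have ab2 : ab.2 = 0.
  apply/eqP; have := Z0 (k + 1).
  rewrite /Z ifT; last by lia.
  by rewrite addrK => /eqP; rewrite mulf_eq0 (negbTE Xk) orbF.
have ab1 : ab.1 != 0 by case: abn0 => //; rewrite ab2 eqxx.
have [i0|i0] := boolP (0 <= i); last first.
  by apply: sY; rewrite /halfline/= (negbTE i0).
have := Z0 (-1 - i); rewrite /Z ifF; last by lia.
rewrite ifT; last by lia.
have -> : -1 - (-1 - i) = i by ring.
by move=> /eqP; rewrite mulf_eq0 (negbTE ab1)/= => /eqP.
Qed.

End Glue.

Section Half.
Variables U V W : set R[i].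
Hypotheses (U0 : U !=set0) (V0 : V !=set0) (W0 : W !=set0).
Hypotheses (cU : compact (U : set R[i]^o)) (cV : compact (V : set R[i]^o))
  (cW : compact (W : set R[i]^o)).
Hypothesis hcompat : compatible U V W.
Hypothesis hkappa : kappa_is U V W 0.

Let injZ : injective_Z U V W.
Proof. exact: compatible_injective_Z. Qed.

Let injZ' : injective_Z W V U.
Proof. exact: injective_Z_refl. Qed.

(** At this stage injectivity is known only on the whole line. *)
Let PZ : set (set int) := [set setT].

Let PZ_shift D (k : int) : PZ D -> PZ [set i | D (i + k)].
Proof. by move=> ->. Qed.

Let PZ_lim (Dn : nat -> set int) : (forall n, PZ (Dn n)) ->
  PZ [set i | ult [set n | Dn n i]].
Proof.
move=> h; apply/seteqP; split=> // i _; apply: filterS filterT => n _ /=.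
by rewrite (h n).
Qed.

Let PZ_inj A D X : Mbi U V W A -> PZ D -> supp D X ->
  bounded_fun X -> (forall i, D i -> trop A X i = 0) -> forall i, X i = 0.
Proof. by move=> AM -> _ bX hX; apply: (injZ AM bX) => i; exact: hX. Qed.

Let lpb_lb := lpb_lower_bound cU cV cW PZ_shift PZ_lim PZ_inj.

Lemma injective_Z_eq A X Y : Mbi U V W A -> bounded_fun X -> bounded_fun Y ->
  (forall i, trop A X i = trop A Y i) -> X = Y.
Proof.
move=> AM bX bY h; apply: (trop_injective PZ_inj AM (D := setT)) => //.
- by move=> i [].
- by move=> i [].
Qed.

(** The columns of the inverse matrix. Compatibility supplies them in some l^s, and the lower bound
    for exponent 1 then bounds all their entries uniformly. *)
Lemma green_ex A : Mbi U V W A -> exists g : int -> int -> R[i],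
  (exists B : R, forall i j, normc (g j i) <= B) /\
  forall i j, trop A (g j) i = (i == j)%:R.
Proof.
move=> AM; have [s s1 [_ [_ _ surj] _]] := hcompat AM.
have [C C0 hC] := lpb_lb (lexx 1%E : (1 <= 1%E :> \bar R)%E).
have /choice[g hg] : forall j, exists X, bounded_fun X /\
    forall i, trop A X i = (i == j)%:R.
  move=> j; have [] := surj (fun i : int => (i == j)%:R).
    by apply/lpb_ex => //; exists 1; exact: lpb_indicator.
  move=> X /lpb_ex -/(_ s1)[m hm] XE; exists X; split.
    exact: lpb_bounded_fun hm.
  move=> i; have := congr1 (fun f => f i) XE => /= <-.
  by rewrite (matopE (@inj_id int) (represents_int A) (Mbi_far AM)) ext_id.
exists g; split=> [|i j]; last exact: (hg j).2.
exists (C * 1) => i j.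
apply: (lpb_pt i (lexx 1%E : (1 <= 1%E :> \bar R)%E)).
apply: (hC A setT) => //; first by move=> k [].
  exact: (hg j).1.
rewrite cutT; apply: lpb_eq (lpb_indicator j (lexx 1%E)) => k.
by rewrite (hg j).2.
Qed.

(** Of the rows left of the half-line only row -1 reaches X, through one corner entry. Half-line
    problems thus become problems on the line with a right-hand side supported at -1. *)
Lemma trop_half A X k : supp halfline X -> k < 0 ->
  trop A X k = A (-1) 0 * X 0 * (k == -1)%:R.
Proof.
move=> sX k0.
have sk (j : int) : j < 0 -> X j = 0 by move=> j0; apply: sX; rewrite /halfline/=; lia.
have [->|k1] := eqVneq k (-1).
  by rewrite /trop !(sk (-1)) ?(sk (-1 - 1))// !mulr0 !add0r mulr1.
by rewrite /= mulr0 /trop !sk ?mulr0 ?addr0//; lia.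
Qed.

Section Corner.
Variable A : int -> int -> R[i].
Hypothesis AM : Mbi U V W A.
Variable g : int -> int -> R[i].
Hypothesis gB : exists B : R, forall i j, normc (g j i) <= B.
Hypothesis gE : forall i j, trop A (g j) i = (i == j)%:R.

(* [g j] is the column of the inverse matrix with index [j], so this is the row
   with index -1. *)
Definition green_row (j : int) : R[i] := g j (-1).

Lemma green_row_bounded : bounded_fun green_row.
Proof. by case: gB => B h; exists B => i; exact: h. Qed.

(** The right inverse is also a left inverse: A maps column k of the product g A to its own column
    k, which is also the image of the unit vector at k, and A is injective on bounded vectors. *)
Lemma green_rowE k : trop (tr A) green_row k = (k == -1)%:R.
Proof.
pose G i := A (k - 1) k * g (k - 1) i + A k k * g k i + A (k + 1) k * g (k + 1) i.
have GE : G = fun i => (i == k)%:R.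
  apply: (injective_Z_eq AM).
  - have [B h] := gB; exists (normc (A (k - 1) k) * B + normc (A k k) * B +
        normc (A (k + 1) k) * B) => i.
    rewrite /G; apply: le_trans (normcD _ _) _; apply: lerD; last first.
      by rewrite normcM ler_wpM2l.
    by apply: le_trans (normcD _ _) _; rewrite !normcM lerD// ler_wpM2l.
  - by exists 1 => i; case: eqP; rewrite ?normc0 ?normc1.
  move=> i; rewrite /G !tropD !tropZ !gE /trop.
  have -> : A (k - 1) k * (i == k - 1)%:R = A i (i + 1) * (i + 1 == k)%:R.
    by rewrite -(can2_eq (addrK 1) (subrK 1)); case: eqP => [<-|]; rewrite ?addrK ?mulr0.
  have -> : A (k + 1) k * (i == k + 1)%:R = A i (i - 1) * (i - 1 == k)%:R.
    by rewrite -(can2_eq (subrK 1) (addrK 1)); case: eqP => [<-|]; rewrite ?subrK ?mulr0.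
  have -> : A k k * (i == k)%:R = A i i * (i == k)%:R by case: eqP => [<-//|]; rewrite !mulr0.
  by ring.
have := congr1 (fun f => f (-1)) GE => /=; rewrite /G /trop /tr /green_row => ->.
by rewrite eq_sym.
Qed.

Definition half_surjective (s : \bar R) : Prop :=
  forall b, supp halfline b -> lp s b ->
    exists X, [/\ supp halfline X, lp s X & forall i, halfline i -> trop A X i = b i].

(** Index 0 as an alternative on zero-extended vectors. The exponent is whichever one the hypothesis
    provides for this particular operator. *)
Lemma half_fredholm : exists2 s : \bar R, (1 <= s)%E &
  ((exists X, [/\ supp halfline X, lp s X, (exists i, X i != 0) &
      forall i, halfline i -> trop A X i = 0]) -> ~ half_surjective s) /\
  ((forall X, supp halfline X -> lp s X ->
      (forall i, halfline i -> trop A X i = 0) -> forall i, X i = 0) ->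
   half_surjective s).
Proof.
pose a i j := A (Posz i) (Posz j).
have aM : Mplus U V W a by move=> i j; exact: AM.
have [s s1 hs] := hkappa aM; exists s => //.
have pinj : injective Posz by move=> ? ? [].
have rA := represents_nat A; have far := Mbi_far AM.
have T0 : matop a (fun=> 0) = (fun=> 0).
  by apply/funext => i; rewrite /matop fsbig1// => j _; rewrite mulr0.
have posH (i : nat) : halfline i by [].
have surjP : half_surjective s <->
    (forall y, lp s y -> exists2 z, lp s z & matop a z = y).
  split=> h y.
    move=> /lpb_ex -/(_ s1)[m hm].
    have [||X [sX /lpb_ex -/(_ s1)[k hk] hX]] := h (ext Posz y).
    - exact: supp_ext range_Posz.
    - by apply/lpb_ex => //; exists m; exact/(ext_lpb pinj).
    exists (X \o Posz); first by apply/lpb_ex => //; exists k; exact: lpb_inj.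
    apply/funext => i; rewrite (matopE pinj rA far) (ext_restr pinj range_Posz sX) hX//.
    by rewrite ext_pos.
  move=> sy /lpb_ex -/(_ s1)[m hm].
  have [|z /lpb_ex -/(_ s1)[k hk] zE] := h (y \o Posz).
    by apply/lpb_ex => //; exists m; exact: lpb_inj.
  exists (ext Posz z); split.
  - exact: supp_ext range_Posz.
  - by apply/lpb_ex => //; exists k; exact/(ext_lpb pinj).
  move=> i; rewrite -range_Posz => -[n _ <-].
  by rewrite -(matopE pinj rA far) zE.
split.
  move=> [X [sX /lpb_ex -/(_ s1)[k hk] [i Xi] hX]] /surjP.
  apply: (index0_kernel s1 T0 hs (x := X \o Posz)).
  - by apply/lpb_ex => //; exists k; exact: lpb_inj.
  - by apply/funext => j; rewrite (matopE pinj rA far) (ext_restr pinj range_Posz sX) hX.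
  - move=> X0; move/eqP: Xi; apply; have [|] := pselect (halfline i); last exact: sX.
    by rewrite -range_Posz => -[n _ <-]; exact: (congr1 (fun f => f n) X0).
move=> h; apply/surjP; apply: (index0_injective s1 T0 hs) => x /lpb_ex -/(_ s1)[k hk] x0.
apply/funext => i; rewrite -(ext_pos pinj x i); apply: h.
- exact: supp_ext range_Posz.
- by apply/lpb_ex => //; exists k; exact/(ext_lpb pinj).
- move=> j; rewrite -range_Posz => -[n _ <-].
  by rewrite -(matopE pinj rA far) x0.
Qed.

Lemma trop_half_kernel X k : supp halfline X ->
  (forall i, halfline i -> trop A X i = 0) ->
  trop A X k = A (-1) 0 * X 0 * (k == -1)%:R.
Proof.
move=> sX hX; have [k0|k0] := boolP (0 <= k).
  rewrite hX// (_ : (k == -1) = false) ?mulr0//; lia.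
by apply: trop_half => //; lia.
Qed.

(** Extended by zero, X solves A X = c delta_(-1) on the line, so it is c times column -1 of the
    inverse. *)
Lemma half_kernel X : supp halfline X -> bounded_fun X ->
  (forall i, halfline i -> trop A X i = 0) ->
  X = fun i => A (-1) 0 * X 0 * g (-1) i.
Proof.
move=> sX bX hX; apply: (injective_Z_eq AM) => //.
  have [B h] := gB; exists (normc (A (-1) 0 * X 0) * B) => i.
  by rewrite normcM ler_wpM2l.
by move=> i; rewrite (trop_half_kernel _ sX hX) tropZ gE.
Qed.

(** If row -1 of the inverse vanishes on the half-line, the solution on the line for a right-hand
    side supported there vanishes at -1. Cutting it at 0 then leaves the rows i >= 0 unchanged. *)
Lemma half_surjective_of_row s : (1 <= s)%E ->
  (forall j, halfline j -> green_row j = 0) -> half_surjective s.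
Proof.
move=> s1 row0 b sb /lpb_ex -/(_ s1)[m hm].
have [C C0 hC] := lpb_lb s1.
(* [g] is only known to be bounded, so the full series for the solution might diverge. Its partial
   sums solve for truncated right-hand sides and obey one l^s bound, hence have an ultralimit. *)
pose bn (n : nat) (i : int) : R[i] := if i < n%:Z then b i else 0.
pose Zn n (i : int) := \sum_(0 <= j < n) b (Posz j) * g (Posz j) i.
have tropZn n i : trop A (Zn n) i = \sum_(0 <= j < n) b (Posz j) * (i == Posz j)%:R.
  elim: n => [|n IH].
    by rewrite big_geq// trop0// => k; rewrite /Zn big_geq.
  rewrite big_nat_recr//= -IH -gE -tropZ -tropD; congr (trop _ _ _).
  by apply/funext => k; rewrite /Zn big_nat_recr.
have tropE n i : trop A (Zn n) i = bn n i.
  rewrite tropZn /bn; have [i0|i0] := boolP (0 <= i); last first.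
    rewrite sb ?if_same; last by rewrite /halfline/=; lia.
    by rewrite big1// => j _; rewrite (_ : (i == _) = false) ?mulr0//; lia.
  case: i i0 => // i _; rewrite ltz_nat; case: ifPn => iN.
    rewrite (bigD1_seq i) ?mem_index_iota ?iota_uniq//= eqxx mulr1 big1 ?addr0// => j ji.
    by rewrite (_ : (_ == _) = false) ?mulr0//; apply/negbTE; rewrite eqz_nat eq_sym.
  rewrite big_nat big1// => j /andP[_ jn].
  by rewrite (_ : (_ == _) = false) ?mulr0//; apply/negbTE; rewrite eqz_nat; lia.
have Znb n : lpb s (Zn n) (C * m).
  apply: (hC A setT) => //; first by move=> i [].
    have [B h] := gB; exists (\sum_(0 <= j < n) normc (b (Posz j)) * B) => i.
    apply: le_trans (normc_sum _ _) _; apply: ler_sum => j _.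
    by rewrite normcM ler_wpM2l.
  rewrite cutT; apply: lpb_le hm => // i; rewrite tropE /bn.
  by case: ifP => //; rewrite normc0.
have [Z hZ] : exists Z, forall i, tends ult (fun n => Zn n i) (Z i).
  apply: (@fun_lim _ _ (C * m)) => i; apply: filterS filterT => n _ /=.
  exact: lpb_pt (Znb n).
have Zb : lpb s Z (C * m).
  apply: (@lpb_lim _ _ _ ult _ _ Zn) => //.
  by apply: filterS filterT => n _ /=; exact: Znb.
have Zm1 : Z (-1) = 0.
  apply: tends_unique (hZ (-1)) (tends_near_cst _).
  apply: filterS filterT => n _ /=; rewrite /Zn big1// => j _.
  by rewrite -/(green_row j) row0 ?mulr0.
have ZE i : trop A Z i = b i.
  apply: tends_unique (@tends_trop _ (fun=> A) A Zn Z i _ hZ) _.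
    by move=> *; exact: tends_cst.
  apply: tends_near_cst.
  apply: filterS (ult_ge (absz i).+1) => n /= hn.
  by rewrite tropE /bn ifT//; lia.
exists (cut halfline Z); split; first exact: supp_cut.
  by apply/lpb_ex => //; exists (C * m); exact: lpb_cut.
move=> i i0; have ip : halfline (i + 1) by move: i0; rewrite /halfline/=; lia.
rewrite -ZE /trop (cut_in _ i0) (cut_in _ ip).
have [i1|i1] := boolP (0 <= i - 1); first by rewrite cut_in.
rewrite cut_out//; last by rewrite /halfline/= (negbTE i1).
have -> : i - 1 = -1 by move: i0 i1; rewrite /halfline/=; lia.
by rewrite Zm1.
Qed.

(** A nonzero kernel vector is a multiple of column -1, so the inverse has entry 0 at (-1, -1).
    Therefore row -1, cut at 0, is a kernel vector of the transpose. Gluing it to X shows that it is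
    0, which makes A surjective on the half-line, against index 0. *)
Lemma half_injective_aux X : supp halfline X -> bounded_fun X ->
  (forall i, halfline i -> trop A X i = 0) -> forall i, X i = 0.
Proof.
move=> sX bX hX; apply: contrapT => /existsNP[i0 /eqP Xi0].
have XE := half_kernel sX bX hX; set c := A (-1) 0 * X 0 in XE.
have cn0 : c != 0 by apply: contra Xi0 => /eqP c0; rewrite XE c0 mul0r.
have rowm1 : green_row (-1) = 0.
  have : X (-1) = 0 by apply: sX; rewrite /halfline.
  by rewrite XE => /eqP; rewrite mulf_eq0 (negbTE cn0)/= => /eqP.
have [s s1 [notsurj _]] := half_fredholm.
apply: notsurj (half_surjective_of_row s1 _).
  exists X; split=> //; last by exists i0.
  have [C C0 hC] := lpb_lb s1.
  apply/lpb_ex => //; exists (C * (normc c * 1)); apply: (hC A setT) => //.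
    by move=> i [].
  rewrite cutT; apply: lpb_eq (lpbZ c s1 (lpb_indicator (-1) s1)) => i.
  by rewrite (trop_half_kernel _ sX hX).
pose Y := cut halfline green_row.
have Y0 : forall i, Y i = 0.
  apply: (glue_kernels U0 V0 W0 injZ AM (Mbi_tr AM) sX bX hX).
  - exact: supp_cut.
  - have [B h] := green_row_bounded; exists B => i.
    exact: le_trans (normc_cut _ _ _) (h i).
  - move=> i i0'; have := green_rowE i.
    rewrite (_ : (i == -1) = false); last by move: i0'; rewrite /halfline/=; lia.
    have ip : halfline (i + 1) by move: i0'; rewrite /halfline/=; lia.
    move=> hr; transitivity (trop (tr A) green_row i); last exact: hr.
    rewrite /trop /Y (cut_in _ i0') (cut_in _ ip).
    have [i1|i1] := boolP (0 <= i - 1); first by rewrite cut_in.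
    rewrite cut_out; last by rewrite /halfline/= (negbTE i1).
    have -> : i - 1 = -1 by move: i0' i1; rewrite /halfline/=; lia.
    by rewrite rowm1.
  - by exists i0.
by move=> j j0; rewrite -(Y0 j) /Y cut_in.
Qed.

(** Injectivity and index 0 make A surjective on the half-line. A kernel vector of the transpose is
    a multiple of row -1 of the inverse, and surjectivity shows that this row vanishes on the
    half-line unless the multiple is 0. *)
Lemma half_tr_injective_aux Y :
  (forall X, supp halfline X -> bounded_fun X ->
    (forall i, halfline i -> trop A X i = 0) -> forall i, X i = 0) ->
  supp halfline Y -> bounded_fun Y ->
  (forall i, halfline i -> trop (tr A) Y i = 0) -> forall i, Y i = 0.
Proof.
move=> inj sY bY hY.
have [s s1 [_ surj]] := half_fredholm.
have {}surj : half_surjective s.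
  apply: surj => X sX /lpb_ex -/(_ s1)[m hm]; apply: inj => //.
  exact: lpb_bounded_fun hm.
have sk (j : int) : j < 0 -> Y j = 0 by move=> j0; apply: sY; rewrite /halfline/=; lia.
set c := A 0 (-1) * Y 0.
have YE : Y = fun i => c * green_row i.
  apply/funext => i; apply/eqP; rewrite -subr_eq0; apply/eqP.
  apply: (injZ' (Mbi_tr AM) (X := fun i => Y i - c * green_row i)) => [|k].
    have [B h] := bY; have [B' h'] := green_row_bounded.
    exists (B + normc c * B') => j; apply: le_trans (normcD _ _) _.
    by rewrite normcN normcM lerD// ler_wpM2l.
  rewrite tropB tropZ green_rowE; have [k0|k0] := boolP (0 <= k).
    rewrite hY// (_ : (k == -1) = false) ?mulr0 ?subr0//; lia.
  by rewrite (trop_half _ sY) ?subrr//; lia.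
have [c0|cn0] := eqVneq c 0; first by move=> i; rewrite YE c0 mul0r.
have rowm1 : green_row (-1) = 0.
  by apply/eqP; have := sk (-1) isT; rewrite YE => /eqP; rewrite mulf_eq0 (negbTE cn0).
move=> i; have [i0|i0] := boolP (0 <= i); last by apply: sk; lia.
rewrite YE; suff -> : green_row i = 0 by rewrite mulr0.
(* H, extended by zero, differs from column i of the inverse by a multiple of column -1. Both H and
   column -1 vanish at -1, hence so does column i, which is the claim. *)
have [||H [sH /lpb_ex -/(_ s1)[m hm] HE]] := surj (fun k => (k == i)%:R).
- by move=> k /negP k0; rewrite (_ : (k == i) = false)//; apply/eqP => E; move: k0; rewrite E i0.
- by apply/lpb_ex => //; exists 1; exact: lpb_indicator.
pose d := A (-1) 0 * H 0.
have HG : H = fun k => g i k + d * g (-1) k.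
  apply: (injective_Z_eq AM); first exact: lpb_bounded_fun hm.
    have [B h] := gB; exists (B + normc d * B) => k.
    by apply: le_trans (normcD _ _) _; rewrite normcM lerD// ler_wpM2l.
  move=> k; rewrite tropD tropZ !gE; have [k0|k0] := boolP (0 <= k).
    rewrite HE// (_ : (k == -1) = false) ?mulr0 ?addr0//; lia.
  have -> : (k == i) = false by lia.
  by rewrite (trop_half _ sH) ?add0r//; lia.
have : H (-1) = 0 by exact: sH.
rewrite HG -/(green_row i) -/(green_row (-1)) rowm1 mulr0 addr0.
by [].
Qed.

End Corner.

Lemma injective_half_UVW : injective_half U V W.
Proof.
move=> A X AM; have [g [gB gE]] := green_ex AM.
exact: (half_injective_aux AM gB gE).
Qed.

Lemma injective_half_WVU : injective_half W V U.
Proof.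
move=> C Y CM; have AM := Mbi_tr CM; have [g [gB gE]] := green_ex AM.
apply: (half_tr_injective_aux AM gB gE) => X sX bX hX.
exact: injective_half_UVW hX.
Qed.

End Half.
End Coburn.

Definition block (n : nat) : set int := [set i | 0 <= i < n%:Z].

(** * Chains of copies of a finite block *)

Section Concatenation.
Variable R : realType.
Implicit Types (A : int -> int -> R[i]) (X : int -> R[i]).
Variables (U V W : set R[i]) (u v w : R[i]) (n : nat).
Hypotheses (Uu : U u) (Vv : V v) (Ww : W w).
Hypothesis n0 : (0 < n)%N.

Local Notation N := (n.+1%:Z).

(* Infinitely many copies of the n x n block of [A], with one separating row
   and column between consecutive copies. *)
Definition concat_mx A i j : R[i] :=
  if 1 < `|i - j| then 0 else
  if [&& (i %/ N)%Z == (j %/ N)%Z, (i %% N)%Z < n%:Z & (j %% N)%Z < n%:Z]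
  then A (i %% N)%Z (j %% N)%Z
  else if i == j + 1 then u else if i == j then v else w.

(** Position q (n + 1) + a carries entry a of copy q, scaled by [al q]. The separator is a = n,
    where a vector supported in the block is 0. *)
Definition concat_vec (al : nat -> R[i]) X i : R[i] :=
  if 0 <= i then al (absz (i %/ N)%Z) * X (i %% N)%Z else 0.

Lemma concat_Mbi A : Mbi U V W A -> Mbi U V W (concat_mx A).
Proof.
move=> AM; apply/MbiP => i j; rewrite /concat_mx.
case: ifPn => far; first exact: entry_far.
case: ifPn => [/and3P[/eqP q _ _]|_]; last first.
  case: (offdiag_cases i j) => h; last by rewrite h in far.
  - by rewrite h eqxx; exact: entry_sub.
  - rewrite (_ : (i == j + 1) = false); last by lia.
    by rewrite h eqxx; exact: entry_diag.
  - rewrite (_ : (i == j + 1) = false); last by lia.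
    by rewrite (_ : (i == j) = false); [exact: entry_sup|lia].
have iE := divz_eq i N; have jE := divz_eq j N.
rewrite [in entry _ _ _ i]iE [in entry _ _ _ _ j]jE -q.
rewrite -![(_ * N + _)%R]addrC.
by apply/(entry_shift _ _ _ _ _ ((i %/ N)%Z * N) _).2; exact: AM.
Qed.

Lemma block_divz (q a : int) : 0 <= a <= n%:Z -> ((q * N + a) %/ N)%Z = q.
Proof.
by move=> a0; rewrite divzMDl// divz_small ?addr0//; lia.
Qed.

Lemma block_modz (q a : int) : 0 <= a <= n%:Z -> ((q * N + a) %% N)%Z = a.
Proof. by move=> a0; rewrite modzMDl modz_small//; lia. Qed.

Lemma concat_vecE al X (q : nat) (a : int) : 0 <= a <= n%:Z ->
  concat_vec al X (q%:Z * N + a) = al q * X a.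
Proof.
move=> a0; rewrite /concat_vec block_divz// block_modz// ifT//.
by case/andP: a0 => ? _; rewrite addr_ge0// mulr_ge0.
Qed.

Lemma concat_vec_neg al X i : ~ halfline i -> concat_vec al X i = 0.
Proof. by move=> /negP i0; rewrite /concat_vec (negbTE i0). Qed.

Lemma concat_vec_sep al X (q : nat) : X n%:Z = 0 ->
  concat_vec al X (q%:Z * N - 1) = 0.
Proof.
move=> Xn; case: q => [|q]; first by rewrite mul0r concat_vec_neg.
have -> : q.+1%:Z * N - 1 = q%:Z * N + n%:Z by rewrite -addn1 PoszD; lia.
by rewrite concat_vecE ?Xn ?mulr0//; lia.
Qed.

Lemma halfline_block i : halfline i ->
  exists q a : nat, [/\ i = q%:Z * N + a%:Z, (a <= n)%N & (q <= absz i)%N].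
Proof.
rewrite /halfline/= => i0; exists (absz i %/ n.+1)%N, (absz i %% n.+1)%N.
split; last exact: leq_div.
  by rewrite -PoszM -PoszD -divn_eq; lia.
by rewrite -ltnS ltn_mod.
Qed.

Section Vec.
Variables (A : int -> int -> R[i]) (X : int -> R[i]) (al : nat -> R[i]).
Hypothesis sX : supp (block n) X.

Let Xneg : X (-1) = 0. Proof. by apply: sX. Qed.
Let Xn : X n%:Z = 0. Proof. by apply: sX; rewrite /block/=; lia. Qed.

Lemma trop_concat_in (q a : nat) : (a < n)%N ->
  trop (concat_mx A) (concat_vec al X) (q%:Z * N + a%:Z) = al q * trop A X a%:Z.
Proof.
move=> an; set i := q%:Z * N + a%:Z.
have Zi : concat_vec al X i = al q * X a%:Z by rewrite concat_vecE//; lia.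
have im : (i %% N)%Z = a%:Z by rewrite block_modz//; lia.
have id_ : (i %/ N)%Z = q%:Z by rewrite block_divz//; lia.
have Ain (b : int) : 0 <= b -> b < n%:Z -> absz (a%:Z - b) = 1%N \/ b = a%:Z ->
    concat_mx A i (q%:Z * N + b) = A a%:Z b.
  move=> b0 bn ab; rewrite /concat_mx ifF; last by rewrite /i; lia.
  by rewrite id_ im block_divz ?block_modz ?eqxx ?bn; [rewrite ltz_nat an|lia|lia].
have E1 : concat_mx A i (i - 1) * concat_vec al X (i - 1) =
    al q * (A a%:Z (a%:Z - 1) * X (a%:Z - 1)).
  have [a0|a0] := posnP a.
    by rewrite /i a0 addr0 concat_vec_sep// sub0r Xneg !mulr0.
  have -> : i - 1 = q%:Z * N + (a%:Z - 1) by rewrite /i; ring.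
  by rewrite Ain ?concat_vecE; [ring|lia|lia|lia|lia].
have E2 : concat_mx A i (i + 1) * concat_vec al X (i + 1) =
    al q * (A a%:Z (a%:Z + 1) * X (a%:Z + 1)).
  have -> : i + 1 = q%:Z * N + (a%:Z + 1) by rewrite /i; ring.
  rewrite concat_vecE; last by lia.
  have [an1|an1] := boolP (a.+1 == n).
    have -> : a%:Z + 1 = n%:Z by move/eqP: an1 => <-; lia.
    by rewrite Xn !mulr0.
  by rewrite Ain; [ring|lia|lia|lia].
have E3 : concat_mx A i i = A a%:Z a%:Z by apply: Ain; lia.
rewrite /trop E1 E2 E3 Zi; ring.
Qed.

Lemma trop_concat_sep (q : nat) :
  trop (concat_mx A) (concat_vec al X) (q%:Z * N + n%:Z) =
  u * (al q * X (n%:Z - 1)) + w * (al q.+1 * X 0).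
Proof.
set i := q%:Z * N + n%:Z.
have im : (i %% N)%Z = n%:Z by rewrite block_modz//; lia.
have Zi : concat_vec al X i = 0 by rewrite concat_vecE ?Xn ?mulr0//; lia.
have out j : absz (i - j) = 1%N -> concat_mx A i j = if i == j + 1 then u else w.
  move=> ij; rewrite /concat_mx ifF; last by lia.
  rewrite im ltxx/= andbF.
  by case: eqP => // _; case: eqP => // E; move: ij; rewrite E subrr.
rewrite /trop Zi mulr0 addr0 !out; [|lia|lia].
have -> : i - 1 = q%:Z * N + (n%:Z - 1) by rewrite /i; ring.
have E2 : i + 1 = q.+1%:Z * N + 0 by rewrite /i -[q.+1]addn1 PoszD; lia.
rewrite E2 !concat_vecE; [|lia|lia].
rewrite ifT; last by rewrite /i; lia.
by rewrite ifF// -E2; lia.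
Qed.

End Vec.

Lemma concat_vec_bounded al X : supp (block n) X ->
  (forall q, normc (al q) <= 1) -> bounded_fun (concat_vec al X).
Proof.
move=> sX al1; exists (\sum_(0 <= k < n) normc (X k%:Z)) => i.
have S0 : 0 <= \sum_(0 <= k < n) normc (X k%:Z) by apply: sumr_ge0.
have [i0|i0] := pselect (halfline i); last by rewrite concat_vec_neg// normc0.
have [q [a [-> an _]]] := halfline_block i0.
rewrite concat_vecE; last by lia.
rewrite normcM; apply: (@le_trans _ _ (1 * normc (X a%:Z))); first by rewrite ler_wpM2r.
rewrite mul1r; move: an; rewrite leq_eqVlt => /predU1P[->|an].
  by rewrite sX ?normc0// /block/=; lia.
by rewrite (bigD1_seq a) ?mem_index_iota ?iota_uniq//= lerDl sumr_ge0.
Qed.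

(** The separating row between consecutive copies vanishes for scalings r^q with r = - u x / (w y).
    The hypothesis gives |r| <= 1, so the chain stays bounded; the opposite inequality is handled by
    reflecting the block. *)
Lemma concat_ratio (x y : R[i]) : normc (u * x) <= normc (w * y) ->
  exists2 r : R[i], normc r <= 1 &
    forall q, u * (r ^+ q * x) + w * (r ^+ q.+1 * y) = 0.
Proof.
move=> xy; have [y0|y0] := eqVneq (w * y) 0.
  have x0 : u * x = 0.
    apply/eqP; rewrite -normc_eq0 eq_le normc_ge0 andbT.
    by rewrite (le_trans xy)// y0 normc0.
  by exists 0 => [|q]; rewrite ?normc0// mulrCA x0 mulrCA y0 !mulr0 addr0.
exists (- (u * x / (w * y))) => [|q].
  by rewrite normcN normcM normcV ler_pdivrMr ?mul1r// lt_neqAle eq_sym normc_eq0 y0 normc_ge0.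
set r := - _; have hr : r * (w * y) = - (u * x) by rewrite /r mulNr divfK.
transitivity (r ^+ q * (u * x + r * (w * y))); first by rewrite exprSr; ring.
by rewrite hr subrr mulr0.
Qed.

Lemma block_injective_aux A X : injective_half U V W -> Mbi U V W A ->
  supp (block n) X -> normc (u * X (n%:Z - 1)) <= normc (w * X 0) ->
  (forall i, block n i -> trop A X i = 0) -> forall i, X i = 0.
Proof.
move=> inj AM sX uw hX.
have [r r1 hr] := concat_ratio uw.
have Z0 : forall i, concat_vec (fun q => r ^+ q) X i = 0.
  apply: (inj _ _ (concat_Mbi AM)).
  - by move=> i; exact: concat_vec_neg.
  - by apply: concat_vec_bounded => // q; rewrite normcX exprn_ile1.
  - move=> i i0; have [q [a [-> an _]]] := halfline_block i0.
    move: an; rewrite leq_eqVlt => /predU1P[->|an].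
      by rewrite trop_concat_sep// hr.
    by rewrite trop_concat_in// hX ?mulr0//.
move=> i; have [|i0] := pselect (block n i); last exact: sX.
move=> /andP[i0 in_]; have := Z0 (0%:Z * N + i).
by rewrite concat_vecE ?expr0 ?mul1r//; lia.
Qed.

(* In the case [p < +oo], a chain of [K] copies only violates the equation in
   its last separating row, with relative weight at most [1 / K]. *)
Lemma block_lower_bound_aux p A X c m : (1 <= p)%E -> 0 <= c ->
  (forall A', Mbi U V W A' -> lower_bound p A' halfline c) -> Mbi U V W A ->
  supp (block n) X -> normc (u * X (n%:Z - 1)) <= normc (w * X 0) ->
  lpb p (cut (block n) (trop A X)) m -> lpb p X (c * m).
Proof.
move=> p1 c0 lb AM sX uw hb; have m0 := lpb_ge0 hb.
have [r r1 hr] := concat_ratio uw.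
have bin (a : nat) : (a < n)%N -> block n a%:Z by [].
pose al K q : R[i] := if (q < K)%N then r ^+ q else 0.
have al1 K q : normc (al K q) <= 1.
  by rewrite /al; case: ifP => _; rewrite ?normc0// normcX exprn_ile1.
have sZ al' : supp halfline (concat_vec al' X) by move=> i; exact: concat_vec_neg.
case: p p1 lb hb => [s| |]//= p1 lb hb; last first.
  (* For p = +oo the infinite chain can be used: it is bounded, and all its separating rows vanish
     exactly. For p < +oo its residual need not be summable when |r| = 1. *)
  have := lb _ (concat_Mbi AM) (concat_vec (fun q => r ^+ q) X) m (sZ _).
  case; last 1 first.
  - move=> _ h; split; first by rewrite mulr_ge0.
    move=> i; have [|i0] := pselect (block n i); last by rewrite sX// normc0 mulr_ge0.
    move=> /andP[i0 in_]; have := h (0%:Z * N + i).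
    by rewrite concat_vecE ?expr0 ?mul1r//; lia.
  - by apply: concat_vec_bounded => // q; rewrite normcX exprn_ile1.
  split=> // i; have [i0|i0] := pselect (halfline i); last by rewrite cut_out// normc0.
  rewrite cut_in//; have [q [a [-> an _]]] := halfline_block i0.
  move: an; rewrite leq_eqVlt => /predU1P[->|an].
    by rewrite trop_concat_sep// hr normc0.
  rewrite trop_concat_in// normcM normcX.
  apply: (@le_trans _ _ (1 * m)); last by rewrite mul1r.
  apply: ler_pM => //; rewrite ?exprn_ge0 ?exprn_ile1//.
  by have := lpb_pt a%:Z (leey _) hb; rewrite cut_in.
have s0 := fin_exp_gt0 p1.
pose SX := \sum_(0 <= a < n) normc (X a%:Z) `^ s.
pose ka := normc (u * X (n%:Z - 1)).
(* With [S] the sum of the |al q|^s, the chain has at least S SX on the left, and on the right at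
   most S m^s plus its last separating row. The moduli of the scalings do not increase, so the last
   |al q|^s is at most the average S / K; dividing by [S] gives the claim. *)
have key K : (0 < K)%N -> SX <= c `^ s * (m `^ s + ka `^ s / K%:R).
  move=> K0; pose Z := concat_vec (al K) X.
  pose S := \sum_(0 <= q < K) normc (al K q) `^ s.
  pose t := [seq q%:Z * N + a%:Z | q <- iota 0 K, a <- iota 0 n.+1].
  have sum_t (F : int -> R) : \sum_(i <- t) F i =
      \sum_(0 <= q < K) \sum_(0 <= a < n.+1) F (q%:Z * N + a%:Z).
    by rewrite /t big_allpairs_dep /index_iota !subn0.
  have ut : uniq t.
    apply: allpairs_uniq; rewrite ?iota_uniq// => -[q a] [q' a'].
    move=> /allpairsP[[x y] [_ yn [-> ->]]] /allpairsP[[x' y'] [_ y'n [-> ->]]].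
    move: yn y'n; rewrite !mem_iota /= => yn y'n E.
    have := congr1 (fun i => (i %/ N)%Z) E; have := congr1 (fun i => (i %% N)%Z) E.
    by rewrite /= !block_divz ?block_modz; [move=> [->] [->]|lia..].
  have normcMs (x y : R[i]) : normc (x * y) `^ s = normc x `^ s * normc y `^ s.
    by rewrite normcM powRM.
  have zs : normc (0 : R[i]) `^ s = 0 by rewrite normc0 powR0 ?gt_eqF.
  pose rest := normc (al K K.-1) `^ s * ka `^ s.
  have S0 : 0 <= S by apply: sumr_ge0 => q _; exact: powR_ge0.
  have M0 : 0 <= S * m `^ s + rest by rewrite addr_ge0// mulr_ge0 ?powR_ge0.
  pose M := (S * m `^ s + rest) `^ s^-1.
  have Ms : M `^ s = S * m `^ s + rest by rewrite powRKV.
  have bsum : \sum_(0 <= a < n) normc (trop A X a%:Z) `^ s <= m `^ s.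
    have [_ hb'] := hb; have := hb' [seq a%:Z | a <- iota 0 n].
    rewrite map_inj_uniq ?iota_uniq; last by move=> ? ? [].
    move=> /(_ isT); rewrite big_map /index_iota subn0; congr (_ <= _).
    by apply: eq_big_seq => a; rewrite mem_iota => /andP[_ an]; rewrite cut_in// bin.
  pose G i := normc (cut halfline (trop (concat_mx A) Z) i) `^ s.
  have G0 i : 0 <= G i by exact: powR_ge0.
  have posH (q a : nat) : halfline (q%:Z * N + a%:Z).
    by rewrite /halfline/= addr_ge0// mulr_ge0.
  have Gin (q a : nat) : (a < n)%N ->
      G (q%:Z * N + a%:Z) = normc (al K q) `^ s * normc (trop A X a%:Z) `^ s.
    by move=> an; rewrite /G cut_in// trop_concat_in// normcMs.
  have Gsep (q : nat) : G (q%:Z * N + n%:Z) = if q == K.-1 then rest else 0.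
    rewrite /G cut_in// trop_concat_sep//; have [->|qK] := eqVneq q K.-1.
      by rewrite {2}/al prednK// ltnn mul0r mulr0 addr0 mulrCA normcMs.
    rewrite /al; have [qK1|qK1] := ltnP q K; last first.
      by rewrite ifF ?mul0r ?mulr0 ?addr0 ?zs//; apply/negbTE; rewrite -leqNgt leqW.
    rewrite ifT; last by rewrite -[X in (_ < X)%N](prednK K0) ltnS ltn_neqAle qK -ltnS prednK.
    by rewrite hr zs.
  have Gt i : G i != 0 -> i \in t.
    apply: contraR => it; apply/eqP.
    have [i0|i0] := pselect (halfline i); last by rewrite /G cut_out// zs.
    have [q [a [iE an _]]] := halfline_block i0.
    have qK : (K <= q)%N.
      rewrite leqNgt; apply: contra it => qK; rewrite iE.
      by apply: allpairs_f; rewrite mem_iota /= ?add0n.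
    move: an; rewrite iE leq_eqVlt => /predU1P[->|an].
      by rewrite Gsep gtn_eqF// prednK.
    by rewrite Gin// /al ltnNge qK /= zs mul0r.
  have hM : lpb s%:E (cut halfline (trop (concat_mx A) Z)) M.
    split; first exact: powR_ge0.
    move=> s' us'; rewrite -/(\sum_(i <- s') G i).
    apply: (@le_trans _ _ (\sum_(i <- t) G i)).
      by apply: ler_sum_supp => // i _ /Gt.
    rewrite sum_t Ms.
    under eq_bigr do rewrite big_nat_recr//=.
    rewrite big_split/= lerD//.
      rewrite mulr_suml; apply: ler_sum => q _.
      apply: (@le_trans _ _ (\sum_(0 <= a < n) normc (al K q) `^ s * normc (trop A X a%:Z) `^ s)).
        by rewrite big_nat [leRHS]big_nat; apply: ler_sum => a /andP[_ an]; rewrite Gin.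
      by rewrite -mulr_sumr ler_wpM2l ?powR_ge0.
    under eq_bigr do rewrite Gsep.
    rewrite (bigD1_seq K.-1) ?iota_uniq//=; last by rewrite mem_index_iota ltn_predL.
    by rewrite eqxx big1 ?addr0// => q /negbTE ->.
  have [_ hZ] := lb _ (concat_Mbi AM) Z M (sZ _) (concat_vec_bounded sX (al1 K)) hM.
  have {hZ} := hZ t ut; rewrite powRM ?powR_ge0// Ms sum_t => hZ.
  have ZE : S * SX <= c `^ s * (S * m `^ s + rest).
    apply: le_trans hZ; rewrite mulr_suml; apply: ler_sum => q _.
    rewrite mulr_sumr big_nat_recr//= -[leLHS]addr0 lerD ?powR_ge0//.
    rewrite big_nat [leRHS]big_nat; apply: ler_sum => a /andP[_ an].
    by rewrite /Z concat_vecE ?normcMs//= lez_nat ltnW.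
  have KS : K%:R * normc (al K K.-1) `^ s <= S.
    rewrite /S mulr_natl.
    have -> : normc (al K K.-1) `^ s *+ K = \sum_(0 <= q < K) normc (al K K.-1) `^ s.
      by rewrite big_const_nat subn0 iter_addr_0.
    rewrite big_nat [leRHS]big_nat; apply: ler_sum => q /andP[_ qK].
    rewrite powR_le// /al qK ifT; last by rewrite prednK.
    by rewrite !normcX ler_wiXn2l// -ltnS prednK.
  have Sp : 0 < S.
    rewrite /S big_ltn//; apply: (@lt_le_trans _ _ 1).
      exact: ltr01.
    by rewrite {1}/al K0 expr0 normc1 powR1 lerDl sumr_ge0// => q _; exact: powR_ge0.
  have Kp : 0 < K%:R :> R by rewrite ltr0n.
  rewrite -(ler_pM2l Sp); apply: (le_trans ZE).
  rewrite mulrCA ler_wpM2l ?powR_ge0// mulrDr lerD2l /rest.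
  rewrite mulrA ler_pdivlMr// mulrAC; apply: ler_wpM2r; first exact: powR_ge0.
  by rewrite mulrC.
have SXle : SX <= (c * m) `^ s.
  rewrite powRM//; apply/ler_addgt0Pr => e e0.
  pose T := c `^ s * ka `^ s.
  have T0 : 0 <= T by rewrite mulr_ge0 ?powR_ge0.
  pose K := (Num.truncn (T / e)).+1.
  apply: (le_trans (key K isT)); rewrite mulrDr lerD2l mulrA -/T.
  rewrite ler_pdivrMr ?ltr0n// mulrC -ler_pdivrMr//.
  exact: ltW (truncnS_gt _).
split; first by rewrite mulr_ge0.
move=> s' us'; apply: le_trans SXle.
have sz (i : int) : ~ block n i -> normc (X i) `^ s = 0.
  by move=> bi; rewrite sX// normc0 powR0 ?gt_eqF.
apply: (@le_trans _ _ (\sum_(i <- [seq a%:Z | a <- iota 0 n]) normc (X i) `^ s)).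
  apply: ler_sum_supp => // [i _ Xi|i]; last exact: powR_ge0.
  apply/mapP; exists (absz i).
    rewrite mem_iota; have [|/sz Xi0] := pselect (block n i); last by rewrite Xi0 eqxx in Xi.
    by rewrite /block/=; lia.
  have [|/sz Xi0] := pselect (block n i); last by rewrite Xi0 eqxx in Xi.
  by rewrite /block/=; lia.
by rewrite big_map /SX /index_iota subn0.
Qed.

End Concatenation.

(** * Reflections, shifts and intervals *)

Section Symmetries.
Variable R : realType.
Implicit Types (A : int -> int -> R[i]) (X : int -> R[i]) (D : set int).

Lemma lpb_refl p X m (k : int) : lpb p X m -> lpb p (fun i => X (k - i)) m.
Proof. by apply: (lpb_inj (f := fun i => k - i)) => i j /addrI /oppr_inj. Qed.

Lemma supp_refl k D X : supp D X -> supp [set i | D (k - i)] (fun i => X (k - i)).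
Proof. by move=> sX i Di; exact: sX. Qed.

Lemma supp_shift k D X : supp D X -> supp [set i | D (i + k)] (fun i => X (i + k)).
Proof. by move=> sX i Di; exact: sX. Qed.

Lemma lower_bound_refl p A D c k :
  lower_bound p (refl k A) [set i | D (k - i)] c -> lower_bound p A D c.
Proof.
move=> h X m sX bX hX.
have := h _ m (supp_refl (k := k) sX) (bounded_refl k bX).
have -> : cut [set i | D (k - i)] (trop (refl k A) (fun j => X (k - j))) =
    fun i => cut D (trop A X) (k - i).
  by apply/funext => i; rewrite /cut trop_refl.
move=> /(_ (lpb_refl k hX)) /(lpb_refl k); apply: lpb_eq => i.
by congr X; ring.
Qed.

Lemma lower_bound_shift p A D c k :
  lower_bound p (fun i j => A (i + k) (j + k)) [set i | D (i + k)] c ->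
  lower_bound p A D c.
Proof.
move=> h X m sX bX hX.
have := h _ m (supp_shift (k := k) sX) (bounded_shift k bX).
have -> : cut [set i | D (i + k)]
     (trop (fun i j => A (i + k) (j + k)) (fun j => X (j + k))) =
    fun i => cut D (trop A X) (i + k).
  by apply/funext => i; rewrite /cut trop_shift.
move=> /(_ (lpb_shift k hX)) /(lpb_shift (- k)); apply: lpb_eq => i.
by congr X; ring.
Qed.

End Symmetries.

Section ConvexSets.

(** Covers bounded and unbounded intervals and the empty set at once. In this form closure under
    shifts, intersections and ultralimits is immediate; the shapes are recovered by
    [convex_cases]. *)
Definition convex_set (D : set int) : Prop :=
  forall i j k : int, D i -> D j -> i <= k <= j -> D k.

Lemma int_min (D : set int) d N : D d -> (forall i, D i -> N <= i) ->
  exists2 l, D l & forall i, D i -> l <= i.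
Proof.
move=> Dd DN; pose P n := `[< D (N + n%:Z) >].
have exP : exists n, P n.
  by exists (absz (d - N)); apply/asboolP; rewrite (_ : _ + _ = d)//; have := DN _ Dd; lia.
have [l /asboolP Dl lmin] := ex_minnP exP; exists (N + l%:Z) => // i Di.
have iN := DN _ Di.
have : (l <= absz (i - N))%N.
  by apply: lmin; apply/asboolP; rewrite (_ : _ + _ = i)//; lia.
lia.
Qed.

Lemma int_max (D : set int) d N : D d -> (forall i, D i -> i <= N) ->
  exists2 r, D r & forall i, D i -> i <= r.
Proof.
move=> Dd DN; have [|i Di|l Dl hl] := @int_min [set i | D (- i)] (- d) (- N).
- by rewrite /= opprK.
- by have := DN _ Di; lia.
exists (- l) => // i Di; have := hl (- i); rewrite /= opprK => /(_ Di); lia.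
Qed.

Lemma convex_cases D d : convex_set D -> D d ->
  [\/ D = setT, exists l, D = [set i | l <= i], exists r, D = [set i | i <= r] |
      exists l r, l <= r /\ D = window l r].
Proof.
move=> cD Dd.
have [[N hN]|nb] := pselect (exists N, forall i, D i -> N <= i);
  have [[M hM]|nt] := pselect (exists N, forall i, D i -> i <= N).
- have [l Dl hl] := int_min Dd hN; have [r Dr hr] := int_max Dd hM.
  constructor 4; exists l, r; split; first exact: hl.
  apply/seteqP; split=> i; first by move=> Di; rewrite /window/= hl ?hr.
  exact: cD.
- have [l Dl hl] := int_min Dd hN; constructor 2; exists l.
  apply/seteqP; split=> i /=; first exact: hl.
  move=> li; move/forallNP: nt => /(_ i) /existsNP[j /not_implyP[Dj /negP ji]].
  by apply: (cD l j); rewrite ?li//; lia.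
- have [r Dr hr] := int_max Dd hM; constructor 3; exists r.
  apply/seteqP; split=> i /=; first exact: hr.
  move=> ir; move/forallNP: nb => /(_ i) /existsNP[j /not_implyP[Dj /negP ji]].
  by apply: (cD j r); rewrite ?ir ?andbT//; lia.
- constructor 1; apply/seteqP; split=> // i _.
  move/forallNP: nb => /(_ i) /existsNP[j /not_implyP[Dj /negP ji]].
  move/forallNP: nt => /(_ i) /existsNP[k /not_implyP[Dk /negP ki]].
  by apply: (cD j k) => //; lia.
Qed.

Lemma convex_setT : convex_set setT. Proof. by []. Qed.

Lemma convex_halfline : convex_set halfline.
Proof. by move=> i j k; rewrite /halfline/=; lia. Qed.

Lemma convex_window l r : convex_set (window l r).
Proof. by move=> i j k; rewrite /window/=; lia. Qed.

Lemma convex_block n : convex_set (block n).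
Proof. by move=> i j k; rewrite /block/=; lia. Qed.

Lemma convexI D E : convex_set D -> convex_set E -> convex_set (D `&` E).
Proof.
by move=> cD cE i j k [Di Ei] [Dj Ej] h; split; [apply: (cD i j)|apply: (cE i j)].
Qed.

Lemma convex_shift D (k : int) : convex_set D -> convex_set [set i | D (i + k)].
Proof. by move=> cD i j l /= Di Dj h; apply: (cD _ _ _ Di Dj); lia. Qed.

Lemma convex_lim (Dn : nat -> set int) : (forall n, convex_set (Dn n)) ->
  convex_set [set i | ult [set n | Dn n i]].
Proof.
move=> cD i j k Di Dj h; apply: filterS (filterI Di Dj) => n /= [hi hj].
exact: (cD n i j).
Qed.

Lemma shift_window l r : l <= r ->
  [set i | window l r (i + l)] = block (absz (r - l)).+1.
Proof.
by move=> lr; apply/seteqP; split=> i; rewrite /window /block /=; lia.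
Qed.

End ConvexSets.

(** * Injectivity and bounds on finite intervals *)

Section BlockBounds.
Variables (R : realType) (U V W : set R[i]).
Hypotheses (U0 : U !=set0) (V0 : V !=set0) (W0 : W !=set0).
Implicit Types (A : int -> int -> R[i]) (X : int -> R[i]) (D : set int).

Lemma refl_block n : [set i | block n.+1 (n%:Z - i)] = block n.+1.
Proof. by apply/seteqP; split=> i; rewrite /block/=; lia. Qed.

(** Compare u times the last entry with w times the first one. Either the copies can be joined with
    a ratio at most 1, or this becomes possible after reflection, where the chain belongs to
    M(W,V,U). *)
Lemma block_injective A n X : injective_half U V W -> injective_half W V U ->
  Mbi U V W A -> supp (block n) X ->
  (forall i, block n i -> trop A X i = 0) -> forall i, X i = 0.
Proof.
case: U0 V0 W0 => [u Uu] [v Vv] [w Ww] inj inj' AM sX hX.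
case: n sX hX => [|n] sX hX i; first by apply: sX; rewrite /block/=; lia.
have [h|h] := lerP (normc (u * X (n.+1%:Z - 1))) (normc (w * X 0)).
  by apply: (block_injective_aux Uu Vv Ww _ inj AM sX h hX).
have := @block_injective_aux R W V U w v u n.+1 Ww Vv Uu isT (refl n%:Z A)
  (fun i => X (n%:Z - i)) inj' (Mbi_refl _ AM).
have -> : (i : int) = n%:Z - (n%:Z - i) by ring.
apply.
- by rewrite -refl_block; exact: supp_refl.
- have -> : n%:Z - (n.+1%:Z - 1) = 0 by lia.
  have -> : n%:Z - 0 = n.+1%:Z - 1 by lia.
  exact: ltW.
- by move=> j; rewrite -refl_block trop_refl => /hX.
Qed.

Lemma block_lower_bound p A n c : (1 <= p)%E -> 0 <= c ->
  (forall A', Mbi U V W A' -> lower_bound p A' halfline c) ->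
  (forall A', Mbi W V U A' -> lower_bound p A' halfline c) ->
  Mbi U V W A -> lower_bound p A (block n) c.
Proof.
case: U0 V0 W0 => [u Uu] [v Vv] [w Ww] p1 c0 lb lb' AM X m sX bX hX.
case: n sX hX => [|n] sX hX.
  apply: lpb0 => //; first by rewrite mulr_ge0// (lpb_ge0 hX).
  by move=> i; apply: sX; rewrite /block/=; lia.
have [h|h] := lerP (normc (u * X (n.+1%:Z - 1))) (normc (w * X 0)).
  by apply: (block_lower_bound_aux Uu Vv Ww _ p1 c0 lb AM sX h hX).
have := @block_lower_bound_aux R W V U w v u n.+1 Ww Vv Uu isT p (refl n%:Z A)
  (fun i => X (n%:Z - i)) c m p1 c0 lb' (Mbi_refl _ AM).
have H1 : supp (block n.+1) (fun i => X (n%:Z - i)).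
  by rewrite -refl_block; exact: supp_refl.
move=> /(_ H1).
have -> : n%:Z - (n.+1%:Z - 1) = 0 by lia.
have -> : n%:Z - 0 = n.+1%:Z - 1 by lia.
have E : cut (block n.+1) (trop (refl n%:Z A) (fun i => X (n%:Z - i))) =
    fun i => cut (block n.+1) (trop A X) (n%:Z - i).
  by apply/funext => i; rewrite -{1}refl_block /cut trop_refl.
move=> /(_ (ltW h)); rewrite E => /(_ (lpb_refl _ hX)) /(lpb_refl n%:Z).
by apply: lpb_eq => i; congr X; ring.
Qed.

Lemma window_lower_bound p A l r c : (1 <= p)%E -> 0 <= c ->
  (forall A', Mbi U V W A' -> lower_bound p A' halfline c) ->
  (forall A', Mbi W V U A' -> lower_bound p A' halfline c) ->
  Mbi U V W A -> l <= r -> lower_bound p A (window l r) c.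
Proof.
move=> p1 c0 lb lb' AM lr; apply: (@lower_bound_shift _ _ _ _ _ l).
rewrite shift_window//; apply: block_lower_bound => //; exact: Mbi_shift.
Qed.

Lemma convex_injective A D X : injective_Z U V W ->
  injective_half U V W -> injective_half W V U ->
  Mbi U V W A -> convex_set D -> supp D X -> bounded_fun X ->
  (forall i, D i -> trop A X i = 0) -> forall i, X i = 0.
Proof.
move=> injZ inj inj' AM cD sX bX hX i.
have [Di|] := pselect (D i); last exact: sX.
have [E|[l E]|[r E]|[l [r [lr E]]]] := convex_cases cD Di; subst D.
- by apply: (injZ A) => // j; exact: hX.
- have := inj _ _ (Mbi_shift l AM) _ (bounded_shift l bX) _ (i - l).
  rewrite subrK; apply.
    by move=> j /= jh; apply: sX => /=; move: jh; rewrite /halfline/=; lia.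
  by move=> j jh; rewrite trop_shift; apply: hX; move: jh; rewrite /halfline/=; lia.
- have := inj' _ _ (Mbi_refl r AM) _ (bounded_refl r bX) _ (r - i).
  have -> : r - (r - i) = i by ring.
  apply.
    by move=> j /= jh; apply: sX => /=; move: jh; rewrite /halfline/=; lia.
  by move=> j jh; rewrite trop_refl; apply: hX; move: jh; rewrite /halfline/=; lia.
- have := @block_injective _ (absz (r - l)).+1 (fun j => X (j + l)) inj inj'
    (Mbi_shift l AM).
  rewrite -(shift_window lr) => /(_ (supp_shift sX)) h.
  rewrite -(subrK l i); apply: h => j jw.
  by rewrite trop_shift; exact: hX.
Qed.

End BlockBounds.

Lemma solve_finite (R : realType) (n : nat) (pos : 'I_n -> int)
    (A : int -> int -> R[i]) D (b : int -> R[i]) :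
  injective pos -> range pos = D ->
  (forall i j : int, 1 < `|i - j| -> A i j = 0) ->
  (forall X, supp D X -> bounded_fun X ->
     (forall i, D i -> trop A X i = 0) -> forall i, X i = 0) ->
  exists X, [/\ supp D X, bounded_fun X & forall i, D i -> trop A X i = b i].
Proof.
move=> pinj rD far inj; pose a i j := A (pos i) (pos j).
have rA : represents pos a A D by [].
have mE (x : 'I_n -> R[i]) i : trop A (ext pos x) (pos i) = \sum_j a i j * x j.
  rewrite -(matopE pinj rA far) /matop.
  have -> : [set: 'I_n] = [set` enum 'I_n].
    by apply/seteqP; split=> // j _ /=; rewrite mem_enum.
  by rewrite -fsbig_seq ?enum_uniq// big_enum.
have bext (x : 'I_n -> R[i]) : bounded_fun (ext pos x).
  exists (\sum_j normc (x j)) => k; have [[i <-]|/forallNP h] := pselect (exists i, pos i = k).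
    by rewrite ext_pos// (bigD1 i)//= lerDl sumr_ge0.
  by rewrite ext_out// normc0 sumr_ge0.
(* The transpose of the compression, because [kermx] and [invmx] are used here with row vectors. *)
pose N : 'M[R[i]]_n := \matrix_(j, i) a i j.
have mulE (x : 'rV[R[i]]_n) i : (x *m N) 0 i = trop A (ext pos (x 0)) (pos i).
  by rewrite mE mxE; apply: eq_bigr => j _; rewrite mxE mulrC.
have uN : N \in unitmx.
  rewrite -row_free_unit -kermx_eq0; apply/eqP/row_matrixP => k; rewrite row0.
  have : row k (kermx N) *m N = 0 by rewrite -row_mul mulmx_ker row0.
  move=> /rowP hk; apply/rowP => i; rewrite [RHS]mxE.
  rewrite -(ext_pos pinj (row k (kermx N) 0) i).
  apply: inj => [||j]; [exact: supp_ext|exact: bext|].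
  by rewrite -rD => -[l _ <-]; rewrite -mulE hk mxE.
pose x := (\row_i b (pos i)) *m invmx N.
exists (ext pos (x 0)); split; [exact: supp_ext|exact: bext|].
by move=> j; rewrite -rD => -[l _ <-]; rewrite -mulE mulmxKV// mxE.
Qed.

(** * Uniform invertibility on all intervals *)

Section WellPosed.
Variables (R : realType) (U V W : set R[i]).
Hypotheses (U0 : U !=set0) (V0 : V !=set0) (W0 : W !=set0).
Hypotheses (cU : compact (U : set R[i]^o)) (cV : compact (V : set R[i]^o))
  (cW : compact (W : set R[i]^o)).
Hypotheses (injZ : injective_Z U V W) (inj : injective_half U V W)
  (inj' : injective_half W V U).
Implicit Types (A : int -> int -> R[i]) (X : int -> R[i]) (D : set int).

Lemma convex_inj A D X : Mbi U V W A -> convex_set D -> supp D X ->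
  bounded_fun X -> (forall i, D i -> trop A X i = 0) -> forall i, X i = 0.
Proof. exact: convex_injective. Qed.

Lemma uniform_lower_bound p : (1 <= p)%E -> exists2 C : R, 0 <= C &
  forall A D, Mbi U V W A -> convex_set D -> lower_bound p A D C.
Proof.
move=> p1; have [C C0 hC] := lpb_lower_bound cU cV cW convex_shift convex_lim convex_inj p1.
by exists C => // A D AM cD X m sX bX; exact: hC.
Qed.

Lemma uniform_decay : exists C rho : R, [/\ 0 <= C, 0 < rho < 1 &
  forall A D X i beta, Mbi U V W A -> convex_set D -> supp D X -> bounded_fun X ->
    (forall j, D j -> rho ^+ absz (i - j) * normc (trop A X j) <= beta) ->
    0 <= beta -> normc (X i) <= C * beta].
Proof. exact: (weighted_lower_bound cU cV cW convex_shift convex_lim convex_inj). Qed.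

Lemma window_solvable A l r b : Mbi U V W A -> exists X,
  [/\ supp (window l r) X, bounded_fun X &
      forall i, window l r i -> trop A X i = b i].
Proof.
move=> AM; have [lr|lr] := leP l r; last first.
  exists (fun=> 0); split=> //; first by exists 0 => i; rewrite normc0.
  by move=> i; rewrite /window/=; lia.
apply: (@solve_finite _ (absz (r - l)).+1 (fun k => l + (k : nat)%:Z)).
- by move=> i j /addrI [] /val_inj.
- apply/seteqP; split=> [_ [k _ <-]|i].
    by have := ltn_ord k; rewrite /window/=; lia.
  rewrite /window/= => h; have hk : (absz (i - l) < (absz (r - l)).+1)%N by lia.
  by exists (Ordinal hk) => //=; lia.
- exact: Mbi_far AM.
- by move=> X; apply: convex_inj AM (@convex_window l r).
Qed.

(** Solve the finite systems on the intersections of D with [-n, n]. The uniform lower bound keeps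
    the solutions bounded, and their ultralimit is a solution on D because each row involves only
    three entries. *)
Lemma convex_solvable p A D : (1 <= p)%E -> Mbi U V W A -> convex_set D ->
  solvable p A D.
Proof.
move=> p1 AM cD b sb /lpb_ex -/(_ p1)[m hm].
have [C C0 lb] := uniform_lower_bound p1.
pose Dn (n : nat) := D `&` window (- n%:Z) n%:Z.
have cDn n : convex_set (Dn n) by apply: convexI => //; exact: convex_window.
have /choice[Xn hXn] : forall n, exists X, [/\ supp (Dn n) X, bounded_fun X &
    forall i, Dn n i -> trop A X i = b i].
  move=> n; have [[d Dd]|/forallNP nd] := pselect (exists d, Dn n d); last first.
    exists (fun=> 0); split=> //; first by exists 0 => i; rewrite normc0.
    by move=> i /nd.
  have [l [r ->]] : exists l r, Dn n = window l r.
    have [E|[l E]|[r E]|[l [r [lr E]]]] := convex_cases (cDn n) Dd; last by exists l, r.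
    - have : Dn n (n.+1%:Z) by rewrite E.
      by move=> [_]; rewrite /window/=; lia.
    - have : Dn n (Num.max l n.+1%:Z) by rewrite E /= le_max lexx.
      by move=> [_]; rewrite /window/=; lia.
    - have : Dn n (Num.min r (- n.+1%:Z)) by rewrite E /= ge_min lexx.
      by move=> [_]; rewrite /window/=; lia.
  exact: window_solvable.
have hb n : lpb p (Xn n) (C * m).
  have [sX bX hX] := hXn n; apply: (lb A (Dn n)) => //.
  apply: lpb_le hm => // i; have [Di|Di] := pselect (Dn n i).
    by rewrite cut_in// hX.
  by rewrite cut_out// normc0.
have [X hX] : exists X, forall i, tends ult (fun n => Xn n i) (X i).
  apply: (@fun_lim _ _ (C * m)) => i; apply: filterS filterT => n _ /=.
  exact: lpb_pt (hb n).
exists X; split.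
- move=> i Di; apply: tends_unique (hX i) (tends_near_cst _).
  apply: filterS filterT => n _ /=; case: (hXn n) => sX _ _.
  by rewrite sX// => -[].
- exists (C * m) => i; apply: tends_le _ (hX i); apply: filterS filterT => n _ /=.
  exact: lpb_pt (hb n).
move=> i Di; apply: tends_unique (@tends_trop _ (fun=> A) A Xn X i _ hX) _.
  by move=> *; exact: tends_cst.
apply: tends_near_cst.
apply: filterS (ult_ge (absz i)) => n /= hn; case: (hXn n) => _ _ h.
by rewrite h//; split=> //; rewrite /window/=; lia.
Qed.

End WellPosed.

Lemma geo_small (R : realType) (rho c e : R) : 0 < rho < 1 -> 0 < e ->
  exists n, forall k, (n <= k)%N -> c * rho ^+ k <= e.
Proof.
move=> /andP[r0 r1] e0.
have : `|rho| < 1 by rewrite ger0_norm// ltW.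
move=> /(cvg_geometric c)/cvgrPdist_le/(_ e e0)[n _ hn]; exists n => k nk.
have := hn k nk; rewrite /geometric/= sub0r normrN; apply: le_trans.
exact: ler_norm.
Qed.

Lemma mem_sym_range (n : nat) (i : int) : (absz i <= n)%N ->
  i \in [seq j%:Z - n%:Z | j <- iota 0 (n + n).+1].
Proof.
by move=> h; apply/mapP; exists (absz (i + n%:Z)%R); [rewrite mem_iota; lia|lia].
Qed.

(** * Cut-offs and semicontinuity under limit operators *)

Section Truncation.
Variable R : realType.
Implicit Types (A B : int -> int -> R[i]) (X : int -> R[i]) (D E : set int).

Definition finsupp (N : nat) X : Prop := forall i, (N < absz i)%N -> X i = 0.

Lemma finsupp_bounded N X : finsupp N X -> bounded_fun X.
Proof.
move=> fX; exists (\sum_(i <- [seq k%:Z - N%:Z | k <- iota 0 (N + N).+1]) normc (X i)) => i.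
have [iN|iN] := leqP (absz i) N; last by rewrite fX// normc0 sumr_ge0.
by rewrite (big_rem _ (mem_sym_range iN))/= lerDl sumr_ge0.
Qed.

(** A tent of slope 1 / (N + 1), so that commutators with tridiagonal operators are of order 1 /
    N. *)
Definition taper (N : nat) (i : int) : R := Num.max 0 (1 - (absz i)%:R / N.+1%:R).

Lemma taper_ge0 N i : 0 <= taper N i.
Proof. by rewrite le_max lexx. Qed.

Lemma taper_le1 N i : taper N i <= 1.
Proof. by rewrite ge_max ler01 /= lerBlDr lerDl divr_ge0. Qed.

Lemma taper_out N i : (N < absz i)%N -> taper N i = 0.
Proof.
move=> h; apply/max_idPl; rewrite subr_le0 ler_pdivlMr ?ltr0n// mul1r ler_nat.
exact: h.
Qed.

Lemma taper_near1 N i : `|taper N i - 1| <= (absz i)%:R / N.+1%:R.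
Proof.
rewrite distrC ger0_norm ?subr_ge0 ?taper_le1//.
have : 1 - (absz i)%:R / N.+1%:R <= taper N i by rewrite le_max lexx orbT.
by set q := _ / _; lra.
Qed.

Lemma taper_step N i j : absz (i - j) = 1%N -> `|taper N j - taper N i| <= N.+1%:R^-1.
Proof.
move=> ij; have q0 : 0 < N.+1%:R^-1 :> R by rewrite invr_gt0.
have h : (absz i)%:R <= (absz j)%:R + 1 :> R by rewrite natr1 ler_nat; lia.
have h' : (absz j)%:R <= (absz i)%:R + 1 :> R by rewrite natr1 ler_nat; lia.
have {}h : (absz i)%:R / N.+1%:R <= (absz j)%:R / N.+1%:R + N.+1%:R^-1 :> R.
  by rewrite -[X in _ + X]mul1r -mulrDl ler_pM2r.
have {}h' : (absz j)%:R / N.+1%:R <= (absz i)%:R / N.+1%:R + N.+1%:R^-1 :> R.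
  by rewrite -[X in _ + X]mul1r -mulrDl ler_pM2r.
move: h h'; rewrite /taper; set a := _ / _; set b := _ / _ => h h'.
set q := _^-1 in q0 h h' *.
rewrite ler_norml; case: (leP 0 (1 - a)) => ?; case: (leP 0 (1 - b)) => ?; lra.
Qed.

(** Tapering X costs a commutator of size K / (N + 1) times the norm of X. The a priori constant [C]
    makes that norm finite, the error disappears as N grows, and Fatou's lemma transfers the bound
    to X. *)
Lemma lower_bound_finsupp p A D c C K : (1 <= p)%E -> 0 <= c -> 0 <= K ->
  (forall i j, normc (A i j) <= K) -> lower_bound p A D C ->
  (forall X m N, supp D X -> finsupp N X -> lpb p (cut D (trop A X)) m ->
     lpb p X (c * m)) ->
  lower_bound p A D c.
Proof.
move=> p1 c0 K0 AK lbC h X m sX bX hX; have X0 := lbC X m sX bX hX.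
have m0 := lpb_ge0 X0; set k := C * m in X0 m0.
pose Y N i := (taper N i)%:C * X i.
have normY N i : normc (Y N i) <= normc (X i).
  by rewrite normcM normc_real ger0_norm ?taper_ge0// ler_piMl// taper_le1.
have hY N : lpb p (Y N) (c * (m + K / N.+1%:R * (k + k))).
  apply: (h _ _ N).
  - by move=> i Di; rewrite /Y sX ?mulr0.
  - by move=> i Ni; rewrite /Y taper_out// mul0r.
  pose err j : R[i] := (normc (X (j - 1)) + normc (X (j + 1)))%:C.
  have errE j : normc (err j) = normc (X (j - 1)) + normc (X (j + 1)).
    by rewrite normc_real ger0_norm// addr_ge0.
  have herr : lpb p err (k + k).
    have h1 d := lpb_normc_shift d p1 X0.
    by apply: lpb_le (lpbD p1 (h1 (-1)) (h1 1)) => // j; rewrite /err rmorphD.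
  have KN : 0 <= K / N.+1%:R by rewrite divr_ge0.
  have hd : lpb p (fun j => cut D (trop A (Y N)) j - (taper N j)%:C * cut D (trop A X) j)
      (K / N.+1%:R * (k + k)).
    apply: (lpb_leZ p1 KN _ herr) => j; rewrite errE.
    have [Dj|Dj] := pselect (D j); last first.
      by rewrite !cut_out// mulr0 subr0 normc0 mulr_ge0// addr_ge0.
    rewrite !cut_in//.
    have -> : trop A (Y N) j - (taper N j)%:C * trop A X j =
        A j (j - 1) * ((taper N (j - 1) - taper N j)%:C * X (j - 1))
        + A j (j + 1) * ((taper N (j + 1) - taper N j)%:C * X (j + 1)).
      by rewrite /trop /Y !rmorphB/=; ring.
    have step i : absz (j - i) = 1%N ->
        normc (A j i * ((taper N i - taper N j)%:C * X i)) <= K / N.+1%:R * normc (X i).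
      move=> ji; rewrite !normcM normc_real -mulrA ler_pM ?mulr_ge0//.
      by rewrite ler_wpM2r// taper_step.
    by apply: le_trans (normcD _ _) _; rewrite mulrDr lerD//; apply: step; lia.
  have hc : lpb p (fun j => (taper N j)%:C * cut D (trop A X) j) m.
    apply: lpb_le hX => // j.
    by rewrite normcM normc_real ger0_norm ?taper_ge0// ler_piMl// taper_le1.
  by apply: lpb_eq (lpbD p1 hc hd) => j; rewrite addrC subrK.
apply: lpb_cl => // e e0.
pose T := c * (K * (k + k)).
have T0 : 0 <= T by rewrite !mulr_ge0 ?addr_ge0.
apply: (@lpb_lim _ _ _ ult _ p Y) => //.
  move=> i d d0; apply: filterS (ult_ge (Num.truncn ((absz i)%:R * normc (X i) / d))) => N /= hN.
  have -> : Y N i - X i = (taper N i - 1)%:C * X i by rewrite /Y rmorphB /= mulrBl mul1r.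
  rewrite normcM normc_real; apply: le_lt_trans (ler_wpM2r _ (taper_near1 N i)) _ => //.
  rewrite mulrAC ltr_pdivrMr ?ltr0n// [d * _]mulrC -ltr_pdivrMr//.
  by apply: lt_le_trans (truncnS_gt _) _; rewrite ler_nat ltnS.
apply: filterS (ult_ge (Num.truncn (T / e))) => N /= hN.
apply: lpb_mono (hY N) => //; rewrite mulrDr lerD2l.
have -> : c * (K / N.+1%:R * (k + k)) = T / N.+1%:R by rewrite /T; ring.
rewrite ler_pdivrMr ?ltr0n// [e * _]mulrC -ler_pdivrMr//.
by apply/ltW/(lt_le_trans (truncnS_gt _)); rewrite ler_nat ltnS.
Qed.

Section Approximation.
Variables (S : Type) (At : S -> int -> int -> R[i]) (Dt : S -> set int).

(* [B] on [E] is a limit operator of the family of the [At s] on [Dt s]. *)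
Definition loc_approx B E : Prop := forall (N : nat) (e : R), 0 < e ->
  exists s (t : int), forall i, (absz i <= N)%N -> (E i <-> Dt s (i + t)) /\
    forall j, (absz j <= N)%N -> normc (At s (i + t) (j + t) - B i j) < e.

Variables (B : int -> int -> R[i]) (E : set int) (p : \bar R).
Hypothesis p1 : (1 <= p)%E.
Hypothesis approx : loc_approx B E.

Lemma approx_vector X N e m : 0 < e -> finsupp N X -> supp E X -> lpb p X m ->
  exists s (t : int),
  supp (Dt s) (fun i => X (i - t)) /\
  lpb p (fun i => cut (Dt s) (trop (At s) (fun i => X (i - t))) (i + t)
                  - cut E (trop B X) i) (e * (m + m + m)).
Proof.
(* The image of X reaches one step beyond the support of X, hence the window N + 1. *)
move=> e0 fX sX hX; have [s [t hst]] := approx N.+1 e0; exists s, t.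
split=> [i Di|].
  have [iN|iN] := leqP (absz (i - t)) N.+1; last by apply: fX; exact: ltnW.
  apply: sX => Ei; apply: Di; have [/iffLR h _] := hst _ iN.
  by have := h Ei; rewrite subrK.
pose err j : R[i] := (normc (X (j - 1)) + normc (X j) + normc (X (j + 1)))%:C.
have errE j : normc (err j) = normc (X (j - 1)) + normc (X j) + normc (X (j + 1)).
  by rewrite normc_real ger0_norm// !addr_ge0.
have herr : lpb p err (m + m + m).
  have h1 d := lpb_normc_shift d p1 hX.
  apply: lpb_le (lpbD p1 (lpbD p1 (h1 (-1)) (h1 0)) (h1 1)) => // j.
  by rewrite /err addr0 !rmorphD.
apply: (lpb_leZ p1 (ltW e0) _ herr) => i; rewrite errE.
have shiftE : trop (At s) (fun i => X (i - t)) (i + t) =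
    trop (fun i j => At s (i + t) (j + t)) X i.
  rewrite -trop_shift; congr (trop _ _ _); apply/funext => j.
  by rewrite addrK.
have nn : 0 <= normc (X (i - 1)) + normc (X i) + normc (X (i + 1)) by rewrite !addr_ge0.
have [iN|iN] := leqP (absz i) N.+1; last first.
  have E0 A : trop A X i = 0 by rewrite /trop !fX ?mulr0 ?addr0//; lia.
  have -> : cut (Dt s) (trop (At s) (fun i => X (i - t))) (i + t) = 0.
    by rewrite /cut shiftE E0 if_same.
  have -> : cut E (trop B X) i = 0 by rewrite /cut E0 if_same.
  by rewrite subr0 normc0 mulr_ge0// ltW.
have [Ei hA] := hst i iN.
have [Ei'|Ei'] := pselect (E i); last first.
  rewrite !cut_out ?subr0 ?normc0 ?mulr_ge0 ?(ltW e0)//.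
  by move=> /Ei.
rewrite !cut_in//; last exact/Ei.
rewrite shiftE.
have dE : trop (fun i j => At s (i + t) (j + t)) X i - trop B X i =
    (At s (i + t) (i - 1 + t) - B i (i - 1)) * X (i - 1) +
    (At s (i + t) (i + t) - B i i) * X i +
    (At s (i + t) (i + 1 + t) - B i (i + 1)) * X (i + 1).
  by rewrite /trop; ring.
rewrite dE {dE}.
have term j : (absz j <= N.+2)%N -> normc ((At s (i + t) (j + t) - B i j) * X j) <= e * normc (X j).
  move=> _; have [jN|jN] := leqP (absz j) N.+1.
    by rewrite normcM ler_wpM2r// ltW// hA.
  by rewrite fX ?mulr0 ?normc0 ?mulr0//; exact: ltnW.
rewrite !mulrDr; apply: le_trans (normcD _ _) _; apply: lerD; last by apply: term; lia.
by apply: le_trans (normcD _ _) _; apply: lerD; apply: term; lia.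
Qed.

Lemma lower_bound_approx c C K : 0 <= c -> 0 <= K ->
  (forall i j, normc (B i j) <= K) -> lower_bound p B E C ->
  (forall s, lower_bound p (At s) (Dt s) c) -> lower_bound p B E c.
Proof.
move=> c0 K0 BK lbC lb; apply: (lower_bound_finsupp p1 c0 K0 BK lbC).
move=> X m N sX fX hX.
have bX := finsupp_bounded fX.
have hX0 := lbC X m sX bX hX; set k := C * m in hX0.
have k0 := lpb_ge0 hX0.
apply: lpb_cl => // e e0.
(* The transplanted vector has residual at most m + 3 d k; this choice makes c times the excess at
   most e. *)
pose d := e / (c * (k + k + k) + 1).
have T0 : 0 <= c * (k + k + k) by rewrite mulr_ge0// !addr_ge0.
have d0 : 0 < d by rewrite divr_gt0//; lra.
have [s [t [sX' hd]]] := approx_vector d0 fX sX hX0.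
have hX' := lpbD p1 hX hd.
have bX' : bounded_fun (fun i => X (i - t)) by exact: bounded_shift.
have : lpb p (cut (Dt s) (trop (At s) (fun i => X (i - t)))) (m + d * (k + k + k)).
  apply: lpb_eq (lpb_shift (- t) hX') => i /=.
  by rewrite addrC subrK subrK.
move=> /(lb s _ _ sX' bX') /(lpb_shift t).
move=> h; apply: lpb_mono (lpb_eq _ h) => //; last by move=> i; rewrite addrK.
rewrite mulrDr lerD2l /d mulrCA mulrAC ler_pdivrMr; last by lra.
by rewrite ler_wpM2l ?(ltW e0)//; lra.
Qed.

(** For p = +oo the truncations of X need not converge to X in norm. However, in each fixed row
    their images eventually equal that of X, and this is enough for Fatou's lemma. *)
Lemma upper_bound_approx c : 0 <= c ->
  (forall s, upper_bound p (At s) (Dt s) c) -> upper_bound p B E c.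
Proof.
move=> c0 ub X m sX hX; have m0 := lpb_ge0 hX.
pose XN (N : nat) i := if (absz i <= N)%N then X i else 0.
have hXN N : lpb p (XN N) m.
  by apply: lpb_le hX => // i; rewrite /XN; case: ifP => // _; rewrite normc0.
have key N : lpb p (cut E (trop B (XN N))) (c * m).
  have fX : finsupp N (XN N) by move=> i iN; rewrite /XN leqNgt iN.
  have sXN : supp E (XN N) by move=> i Ei; rewrite /XN sX// if_same.
  apply: lpb_cl => // e e0; pose d := e / (m + m + m + 1).
  have d0 : 0 < d by rewrite divr_gt0//; lra.
  have [s [t [sX' hd]]] := approx_vector d0 fX sXN (hXN N).
  have h1 := lpb_shift t (ub s _ _ sX' (lpb_shift (- t) (hXN N))).
  have := lpbD p1 h1 (lpbZ (-1) p1 hd).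
  rewrite normcN normc1 mul1r => h2; apply: lpb_mono (lpb_eq _ h2) => //.
    rewrite lerD2l /d mulrAC ler_pdivrMr; last by lra.
    by rewrite ler_wpM2l ?(ltW e0)//; lra.
  by move=> i; ring.
apply: (@lpb_lim _ _ _ ult _ p (fun N => cut E (trop B (XN N)))) => //.
  move=> i e e0; apply: filterS (ult_ge (absz i).+1) => N /= hN.
  rewrite (_ : cut E (trop B (XN N)) i = cut E (trop B X) i) ?subrr ?normc0//.
  rewrite /cut (_ : trop B (XN N) i = trop B X i)//.
  by rewrite /trop /XN !ifT//; lia.
by apply: filterS filterT => N _ /=; exact: key.
Qed.

End Approximation.
End Truncation.

(** * Duality between conjugate exponents *)

Section Duality.
Variables (R : realType) (U V W : set R[i]).
Hypotheses (U0 : U !=set0) (V0 : V !=set0) (W0 : W !=set0).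
Hypotheses (cU : compact (U : set R[i]^o)) (cV : compact (V : set R[i]^o))
  (cW : compact (W : set R[i]^o)).
Hypotheses (injZ : injective_Z U V W) (inj : injective_half U V W)
  (inj' : injective_half W V U).
Implicit Types (A : int -> int -> R[i]) (X Y : int -> R[i]) (D : set int).

Let injZ' : injective_Z W V U. Proof. exact: injective_Z_refl. Qed.

(* Pair a finitely supported X with a solution of the transposed equation. *)
Lemma dual_lower_bound p q A D c : (1 <= p)%E -> (1 <= q)%E ->
  (p^-1 + q^-1 = 1)%E -> 0 <= c -> Mbi U V W A -> convex_set D ->
  lower_bound q (tr A) D c -> lower_bound p A D c.
Proof.
move=> p1 q1 pq c0 AM cD lb; have [K K0 hK] := Mbi_bounded cU cV cW.
have [C C0 lbC] := uniform_lower_bound U0 V0 W0 cU cV cW injZ inj inj' p1.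
apply: (lower_bound_finsupp p1 c0 K0 (hK A AM) (lbC A D AM cD)) => X m N sX fX hX.
have m0 := lpb_ge0 hX.
have cm0 : 0 <= c * m by rewrite mulr_ge0.
apply: lpb_fin => // s.
have -> : (fun i => if i \in s then X i else 0) =
    (fun i => if i \in undup s then X i else 0).
  by apply/funext => i; rewrite mem_undup.
apply: (hoelder_converse p1 q1 pq (undup_uniq s) cm0) => y ys hy.
have AM' := Mbi_tr AM.
(* The test vector, cut to D, is the right-hand side of the transposed equation; the bound assumed
   for q then controls Y by c. *)
have [||Y [sY bY hY]] := convex_solvable W0 V0 U0 cW cV cU injZ' inj' inj q1 AM' cD (b := cut D y).
- exact: supp_cut.
- by apply/lpb_ex => //; exists 1; exact: lpb_cut.
have hY1 : lpb q Y (c * 1).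
  apply: lb => //; apply: lpb_le (lpb_cut D q1 hy) => // i.
  have [Di|Di] := pselect (D i); last by rewrite !cut_out.
  by rewrite cut_in// hY.
rewrite mulr1 in hY1.
have [n0 n0P] : exists n0, forall i, i \in undup s -> (absz i <= n0)%N.
  exists (\max_(i <- undup s) absz i)%N => i is_.
  by rewrite (big_rem i)//= leq_max leqnn.
(* The boundary term (Casoratian) of the discrete Green formula. Summation telescopes, and both ends
   vanish because X is finitely supported, whatever Y does there. *)
pose J i := X i * (A (i + 1) i * Y (i + 1)) - Y i * (A i (i + 1) * X (i + 1)).
have JE i : X i * trop (tr A) Y i - Y i * trop A X i = J i - J (i - 1).
  by rewrite /J /trop /tr subrK; ring.
have [n nE] : exists n, n = (n0 + N.+1)%N by exists (n0 + N.+1)%N.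
have J0 i : (N < absz i)%N -> (N < absz (i + 1)%R)%N -> J i = 0.
  by move=> h1 h2; rewrite /J !fX// !(mulr0, mul0r) subrr.
pose t := [seq j%:Z - n%:Z | j <- iota 0 (n + n).+1].
have ut : uniq t by rewrite map_inj_uniq ?iota_uniq// => i j /addIr [].
have st : {subset undup s <= t}.
  by move=> i /n0P hi; apply: mem_sym_range; rewrite nE (leq_trans hi)// leq_addr.
have tel : \sum_(i <- t) (X i * trop (tr A) Y i - Y i * trop A X i) = 0.
  rewrite big_map; under eq_bigr do rewrite JE.
  pose f (j : nat) := J (j%:Z - n%:Z - 1).
  transitivity (\sum_(0 <= j < (n + n).+1) (f j.+1 - f j)).
    rewrite /index_iota subn0; apply: eq_bigr => j _; rewrite /f.
    by congr (J _ - _); clear; lia.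
  by rewrite telescope_sumr// /f !J0 ?subrr//; move: nE; clear; lia.
have sumE : \sum_(i <- undup s) X i * y i =
    \sum_(i <- t) Y i * cut D (trop A X) i.
  rewrite -[RHS]addr0 -[X in _ + X]tel -big_split/=.
  transitivity (\sum_(i <- t) X i * trop (tr A) Y i).
    have -> : \sum_(i <- t) X i * trop (tr A) Y i = \sum_(i <- t) X i * y i.
      apply: eq_bigr => i _; have [Di|Di] := pselect (D i); last by rewrite sX// !mul0r.
      by rewrite hY// cut_in.
    rewrite [RHS](bigID (fun i => i \in undup s))/= [X in _ + X]big1 => [|i is_]; last first.
      by rewrite ys ?mulr0.
    have pe : perm_eq (undup s) [seq i <- t | i \in undup s].
      apply: uniq_perm; [exact: undup_uniq|exact: filter_uniq|].
      by move=> i; rewrite mem_filter; apply/idP/andP => [h|[]//]; split=> //; exact: st.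
    by rewrite addr0 -[RHS]big_filter (perm_big _ pe).
  apply: eq_bigr => i _; have [Di|Di] := pselect (D i).
    by rewrite cut_in// addrC subrK.
  by rewrite sX// sY// !mul0r subr0 addr0.
rewrite sumE; apply: le_trans (normc_sum _ _) _; under eq_bigr do rewrite normcM mulrC.
by rewrite mulrC; exact: (hoelder_sum p1 q1 pq ut hX hY1).
Qed.

End Duality.

(** * Convergence criteria and tails of summable vectors *)

Lemma cvge_dist (R : realType) (f : nat -> \bar R) (v : R) :
  (forall e, 0 < e -> \forall n \near \oo, ((v - e)%:E <= f n <= (v + e)%:E)%E) ->
  f n @[n --> \oo] --> v%:E.
Proof.
move=> h; apply/fine_cvgP; split.
  have [N _ hN] := h 1 ltr01; exists N => // n /hN /andP[h1 h2].
  by rewrite fin_numElt (lt_le_trans (ltNyr _) h1) (le_lt_trans h2 (ltry _)).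
apply/cvgrPdist_le => e /h [N _ hN]; exists N => // n /hN /=.
by case: (f n) => [a| |]; rewrite /= ?leeNy_eq ?leye_eq ?andbF// !lee_fin ler_norml; lra.
Qed.

Lemma cvg_normc (R : realType) (z : nat -> R[i]) (u : R[i]) :
  (forall e : R, 0 < e -> \forall n \near \oo, normc (z n - u) <= e) ->
  (z n : R[i]^o) @[n --> \oo] --> (u : R[i]^o).
Proof.
move=> h; apply/cvgrPdist_le => e e0.
have [a ea] : exists a : R, e = a%:C.
  by apply/complex_realP; rewrite realE ltW.
have a0 : 0 < a by move: e0; rewrite ea ltcR.
have [N _ hN] := h a a0; exists N => // n /hN hn.
by rewrite distrC absC_normc ea lecR.
Qed.

(** Take [s] whose partial sum is within e^r of the supremum of all partial sums; any finite set
    disjoint from [s] can then add at most e^r. *)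
Lemma lpb_tail (R : realType) (I : choiceType) (r m e : R) (X : I -> R[i]) : 1 <= r ->
  lpb r%:E X m -> 0 < e -> exists s : seq I, forall Y : I -> R[i],
    (forall i, normc (Y i) <= normc (X i)) -> (forall i, i \in s -> Y i = 0) ->
    lpb r%:E Y e.
Proof.
move=> r1 [m0 hX] e0; have r0 : 0 < r by lra.
pose S := [set \sum_(i <- s) normc (X i) `^ r | s in [set s : seq I | uniq s]].
have hS : has_sup S.
  split; first by exists 0; exists [::] => //; rewrite big_nil.
  by exists (m `^ r) => _ [s us <-]; exact: hX.
have [_ [s us <-] hs] := sup_adherent (powR_gt0 r e0) hS.
exists s => Y YX Y0; split=> [|t ut]; first exact: ltW.
rewrite (bigID (fun i => i \in s))/= big1 => [|i /Y0 ->]; last first.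
  by rewrite normc0 powR0// gt_eqF.
rewrite add0r -big_filter; pose t' := [seq i <- t | i \notin s]; rewrite -/t'.
have : \sum_(i <- s ++ t') normc (X i) `^ r <= sup S.
  apply: ub_le_sup; [by case: hS|exists (s ++ t') => //=].
  rewrite cat_uniq us filter_uniq//= andbT; apply/hasPn => i.
  by rewrite mem_filter => /andP[].
rewrite big_cat/= => h; apply: (@le_trans _ _ (\sum_(i <- t') normc (X i) `^ r)).
  by apply: ler_sum => i _; rewrite powR_le.
by move: hs h; lra.
Qed.

(** * Universal words and dense sequences *)

Section UniversalSequence.

Lemma injective_unbounded (f : nat -> nat) N : injective f -> exists j, (N <= f j)%N.
Proof.
move=> finj; apply: contrapT => /forallNP h.
have : (size (map f (iota 0 N.+1)) <= size (iota 0 N))%N.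
  apply: uniq_leq_size; first by rewrite map_inj_uniq// iota_uniq.
  by move=> _ /mapP[j _ ->]; have /negP := h j; rewrite mem_iota -ltnNge.
by rewrite size_map !size_iota ltnn.
Qed.

(* The word with code [c] is written in the positions [2^c, ..., 2^(c+1) - 1]. *)
Lemma universal_sequence (T : countType) (x0 : T) : exists s : nat -> T,
  forall t : seq T, exists k, forall i, (i < size t)%N -> s (k + i)%N = nth x0 t i.
Proof.
pose dec c : seq T := if (unpickle c : option (seq T * nat)) is Some w then w.1 else [::].
exists (fun m => nth x0 (dec (trunc_log 2 m)) (m - 2 ^ trunc_log 2 m)) => t.
(* The second component gives each word infinitely many codes, so some code is large enough for the
   word to fit into its 2^c positions. *)
have [|j hj] := @injective_unbounded (fun j => pickle (t, j)) (size t).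
  by move=> i j /(pcan_inj pickleK)[].
set c := pickle (t, j) in hj; exists (2 ^ c)%N => i it.
have ic : (i < 2 ^ c)%N.
  by apply: (leq_trans it); apply: (leq_trans hj); apply: ltnW; exact: ltn_expl.
have -> : trunc_log 2 (2 ^ c + i) = c.
  by apply: trunc_log_eq; rewrite // leq_addr /= expnS mul2n -addnn ltn_add2l.
by rewrite addKn /dec /c pickleK.
Qed.

Variable R : realType.

(** Rational points need not lie in U. So for every rational point and every precision, a nearby
    point of U is chosen whenever there is one. *)
Lemma dense_sequence (U : set R[i]) : U !=set0 -> exists u : nat -> R[i],
  (forall n, U (u n)) /\
  forall z (e : R), U z -> 0 < e -> exists n, normc (u n - z) < e.
Proof.
move=> [u0 Uu0].
pose q (c : rat * rat * nat) : R[i] := ratr c.1.1 +i* ratr c.1.2.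
have /choice[f hf] : forall c : rat * rat * nat, exists z, U z /\
    ((exists2 z', U z' & normc (z' - q c) < 2 / c.2.+1%:R) ->
     normc (z - q c) < 2 / c.2.+1%:R).
  move=> c; have [[z Uz hz]|h] := pselect (exists2 z', U z' & normc (z' - q c) < 2 / c.2.+1%:R).
    by exists z.
  by exists u0.
exists (fun n => if unpickle n is Some c then f c else u0); split.
  by move=> n; case: unpickle => // c; exact: (hf c).1.
move=> z e Uz e0; pose N := Num.truncn (4 / e).
have N0 : 0 < N.+1%:R :> R by rewrite ltr0n.
have N1 : 0 < N.+1%:R^-1 :> R by rewrite invr_gt0.
have fl (x : R) : exists a : rat, `|x - ratr a| < N.+1%:R^-1.
  have [|a] := @rat_in_itvoo R (x - N.+1%:R^-1) (x + N.+1%:R^-1); first by rewrite ltrBlDr -addrA ltrDl addr_gt0.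
  by rewrite in_itv/= => h; exists a; rewrite ltr_distlC.
have [[a ha] [b hb]] := (fl (complex.Re z), fl (complex.Im z)).
pose c := (a, b, N).
have zc : normc (z - q c) < 2 / c.2.+1%:R.
  apply: le_lt_trans (normc_le_ReIm _) _.
  have -> : complex.Re (z - q c) = complex.Re z - ratr a by case: (z).
  have -> : complex.Im (z - q c) = complex.Im z - ratr b by case: (z).
  by rewrite mulr_natl mulr2n ltrD.
have hc := (hf c).2 (ex_intro2 _ _ z Uz zc).
exists (pickle c); rewrite pickleK.
have -> : f c - z = (f c - q c) - (z - q c) by ring.
apply: le_lt_trans (normcD _ _) _; rewrite normcN.
have : 4 / N.+1%:R < e.
  by rewrite ltr_pdivrMr// mulrC -ltr_pdivrMr//; exact: truncnS_gt.
move: hc zc; rewrite /=; set v := _^-1; lra.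
Qed.

End UniversalSequence.

(** * Existence of pseudoergodic operators; their limit operators *)

Section Pseudoergodic.
Variables (R : realType) (U V W : set R[i]).
Hypotheses (U0 : U !=set0) (V0 : V !=set0) (W0 : W !=set0).
Implicit Types (A B : int -> int -> R[i]).

(** Positions outside the range of [pos] receive arbitrary admissible values. In this way half-line
    and finite matrices become compressions of members of [Mbi]. *)
Lemma extension_ex (I : choiceType) (pos : I -> int) (a : I -> I -> R[i]) :
  injective pos -> tridiagonal U V W pos a ->
  exists2 A, Mbi U V W A & represents pos a A (range pos).
Proof.
move=> pinj ta.
have /choice[A hA] : forall kl : int * int, exists z, entry U V W kl.1 kl.2 z /\
    forall i j, pos i = kl.1 -> pos j = kl.2 -> a i j = z.
  move=> [k l]; have [[[i j] [/= ik jl]]|/forallNP h] :=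
    pselect (exists ij, pos ij.1 = k /\ pos ij.2 = l).
    exists (a i j); split; first by rewrite /= -ik -jl; exact: ta.
    by move=> i' j' /= h1 h2; congr a; apply: pinj; [rewrite h1 ik|rewrite h2 jl].
  exists (fill U0 V0 W0 k l); split; first exact: entry_fill.
  by move=> i j /= h1 h2; case: (h (i, j)).
exists (fun k l => A (k, l)); first by move=> k l; exact: (hA (k, l)).1.
by split=> // i j; apply: (hA (pos i, pos j)).2.
Qed.

Lemma mxnorm2_entry (n : nat) (F : 'M[R[i]]_n) (e : R) i j :
  (mxnorm 2%:E (fun_of_matrix F) < e%:E)%E -> normc (F i j) < e.
Proof.
have two1 : (1 <= 2%:E :> \bar R)%E by rewrite lee_fin ler1n.
move=> h; have [c c0 [hc ce]] : exists2 c : R, 0 <= c &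
    (mxnorm 2%:E (fun_of_matrix F) <= c%:E)%E /\ c < e.
  have e0 : 0 < e.
    rewrite -lte_fin; apply: le_lt_trans h; apply: ereal_sup_ubound.
    exists (fun=> 0); first by apply/lpbP => //; exact: lpb0.
    have -> : matop (fun_of_matrix F) (fun=> 0) = fun=> 0.
      by apply/funext => k; rewrite /matop fsbig1// => l _; rewrite mulr0.
    apply/eqP; rewrite eq_le; apply/andP; split; last exact: poweR_ge0.
    by apply/lpbP => //; exact: lpb0.
  move: h; case: (mxnorm _ _) => [c|//|_]; last by exists 0; rewrite ?leNye.
  rewrite lte_fin => ce; exists (Num.max 0 c); first by rewrite le_max lexx.
  by rewrite lee_fin le_max lexx orbT gt_max e0.
apply: le_lt_trans ce; pose d (k : 'I_n) : R[i] := if k == j then 1 else 0.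
have -> : F i j = matop (fun_of_matrix F) d i.
  rewrite /matop (_ : [set: 'I_n] = [set` enum 'I_n]); last first.
    by apply/seteqP; split=> // k _ /=; rewrite mem_enum.
  rewrite -fsbig_seq ?enum_uniq// big_enum /= (bigD1 j)//= /d eqxx mulr1.
  by rewrite big1 ?addr0// => k /negbTE ->; rewrite mulr0.
apply: (lpb_pt (p := 2%:E)) => //; apply/lpbP => //; apply: le_trans hc.
apply: ereal_sup_ubound; exists d => //; apply/lpbP => //.
by rewrite -[X in lpb _ _ X](@normc1 R); exact: lpb_delta.
Qed.

Lemma represents_block n (A : int -> int -> R[i]) :
  represents (fun i : 'I_n => (i : nat)%:Z) (fun i j : 'I_n => A (i : nat)%:Z (j : nat)%:Z)
    A (block n).
Proof.
split=> //; first by move=> i j [] /val_inj.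
apply/seteqP; split=> [_ [i _ <-]|k]; first by rewrite /block/=; have := ltn_ord i; lia.
rewrite /block/= => /andP[k0 kn].
have hk : (absz k < n)%N by lia.
by exists (Ordinal hk) => //=; lia.
Qed.

Lemma small_entries_mxnorm2 (n : nat) (A : int -> int -> R[i]) (e : R) : 0 < e ->
  (forall i j : int, 1 < `|i - j| -> A i j = 0) ->
  (forall i j : 'I_n, normc (A (i : nat)%:Z (j : nat)%:Z) <= e / 4) ->
  (mxnorm 2%:E (fun_of_matrix
     (\matrix_(i < n, j < n) A (i : nat)%:Z (j : nat)%:Z)%R) < e%:E)%E.
Proof.
move=> e0 far small; have two1 : (1 <= 2%:E :> \bar R)%E by rewrite lee_fin ler1n.
have inI k : block n k -> exists i : 'I_n, (i : nat)%:Z = k.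
  by have [_ <- _] := represents_block n A; move=> [i _ <-]; exists i.
pose A' (k l : int) := if (0 <= k < n%:Z) && (0 <= l < n%:Z) then A k l else 0.
have rA : represents (fun i : 'I_n => (i : nat)%:Z)
    (fun_of_matrix (\matrix_(i < n, j < n) A (i : nat)%:Z (j : nat)%:Z)) A' (block n).
  have [h1 h2 _] := represents_block n A'; split; [exact: h1|exact: h2|] => i j.
  by rewrite mxE /A' !ltz_nat !ltn_ord.
have A'far (k l : int) : 1 < `|k - l| -> A' k l = 0 by rewrite /A' => /far ->; rewrite if_same.
have e4 : 0 <= e / 4 by lra.
have A'small k l : normc (A' k l) <= e / 4.
  rewrite /A'; case: ifP => [/andP[/inI[i <-] /inI[j <-]]|_]; first exact: small.
  by rewrite normc0.
(* Three diagonals, each with entries of modulus at most e / 4. *)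
apply: (@le_lt_trans _ _ (3 * (e / 4))%:E); last by rewrite lte_fin; lra.
apply/(mxnormP rA A'far two1); first by lra.
by move=> X m _ hX; apply: lpb_cut => //; apply: trop_lpb.
Qed.

Definition tri (x y z : int -> R[i]) (i j : int) : R[i] :=
  if i == j + 1 then x i else if i == j then y i else if j == i + 1 then z i else 0.

Lemma Mbi_tri (x y z : int -> R[i]) :
  (forall i, U (x i)) -> (forall i, V (y i)) -> (forall i, W (z i)) ->
  Mbi U V W (tri x y z).
Proof.
move=> Ux Vy Wz; apply/MbiP => i j; rewrite /tri; case: eqP => [h|h1]; first exact: entry_sub.
case: eqP => [h|h2]; first exact: entry_diag.
case: eqP => [h|h3]; first exact: entry_sup.
by apply: entry_far; case: (offdiag_cases i j).
Qed.

Lemma Mbi_triE B : Mbi U V W B ->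
  B = tri (fun i => B i (i - 1)) (fun i => B i i) (fun i => B i (i + 1)).
Proof.
move=> BM; apply/funext => i; apply/funext => j; rewrite /tri; case: eqP => [->|h1].
  by rewrite addrK.
case: eqP => [->//|h2]; case: eqP => [->//|h3].
by apply: (Mbi_far BM); case: (offdiag_cases i j).
Qed.

Lemma tri_shift x y z (i j k : int) : tri x y z (k + i) (k + j) =
  tri (fun i => x (k + i)) (fun i => y (k + i)) (fun i => z (k + i)) i j.
Proof. by rewrite /tri -!addrA !(inj_eq (addrI k)). Qed.

Lemma tri_dist x y z x' y' z' (e : R) i j : 0 <= e -> normc (x i - x' i) <= e ->
  normc (y i - y' i) <= e -> normc (z i - z' i) <= e ->
  normc (tri x y z i j - tri x' y' z' i j) <= e.
Proof.
by move=> e0 hx hy hz; rewrite /tri; do 3!case: ifP => // _; rewrite subrr normc0.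
Qed.

(** A universal word in codes of dense sequences, read along the three diagonals. All patterns
    already occur at nonnegative positions, so a single matrix serves the line and the half-line. *)
Lemma pseudoergodic_ex : exists2 A, Mbi U V W A & PsiE U V W A /\
  PsiEplus U V W (fun i j : nat => A i j).
Proof.
have [u [uU ud]] := dense_sequence U0.
have [v [vV vd]] := dense_sequence V0.
have [w [wW wd]] := dense_sequence W0.
have [s hs] := universal_sequence (0, 0, 0)%N.
pose A := tri (fun i => u (s (absz i)).1.1) (fun i => v (s (absz i)).1.2) (fun i => w (s (absz i)).2).
have AM : Mbi U V W A by apply: Mbi_tri.
have key (n : nat) (B : 'M[R[i]]_n) (e : R) : Mn U V W B -> 0 < e ->
    exists k : nat, (mxnorm 2%:E (fun_of_matrix
      (B - \matrix_(i < n, j < n) A (k + i)%N%:Z (k + j)%N%:Z)) < e%:E)%E.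
  move=> BM e0; have e4 : 0 < e / 4 by lra.
  have [|B' B'M [_ _ BB']] := @extension_ex _ (fun i : 'I_n => (i : nat)%:Z) _ _ BM.
    by move=> i j [] /val_inj.
  have /choice[c hc] : forall i : nat, exists c : nat * nat * nat,
      [/\ normc (u c.1.1 - B' i (i%:Z - 1)) < e / 4, normc (v c.1.2 - B' i i) < e / 4 &
          normc (w c.2 - B' i (i%:Z + 1)) < e / 4].
    move=> i; have [hU _ _ _] := B'M i%:Z (i%:Z - 1).
    have [_ hV _ _] := B'M i%:Z i%:Z; have [_ _ hW _] := B'M i%:Z (i%:Z + 1).
    have [|a ha] := ud _ _ (hU _) e4; first by rewrite subrK.
    have [b hb] := vd _ _ (hV erefl) e4; have [d hd] := wd _ _ (hW erefl) e4.
    by exists (a, b, d).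
  have [k hk] := hs [seq c i | i <- iota 0 n]; exists k.
  have sk (i : 'I_n) : s (k + i)%N = c i.
    by rewrite hk ?size_map ?size_iota// (nth_map 0%N) ?size_iota// nth_iota.
  have -> : B - \matrix_(i < n, j < n) A (k + i)%N%:Z (k + j)%N%:Z =
      \matrix_(i, j) (B' (i : nat)%:Z (j : nat)%:Z
                      - A (k%:Z + (i : nat)%:Z) (k%:Z + (j : nat)%:Z)).
    by apply/matrixP => i j; rewrite !mxE BB' !PoszD.
  apply: (@small_entries_mxnorm2 _ (fun i j => B' i j - A (k%:Z + i) (k%:Z + j))) => // i j.
    move=> far; rewrite (Mbi_far B'M far) (Mbi_far AM) ?subrr//.
    by rewrite opprD addrACA subrr add0r.
  rewrite normcB (Mbi_triE B'M) /A tri_shift; have [h1 h2 h3] := hc i.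
  by apply: tri_dist; rewrite -?PoszD ?absz_nat ?sk; exact: ltW.
exists A => //; split; split=> //.
(* In [PsiE] the submatrix starts at k + 1, in [PsiEplus] at k. *)
- move=> n B e n0 BM e0; have [k hk] := key n B e BM e0; exists (k%:Z - 1) => /=.
  have -> : \matrix_(i < n, j < n) A (k%:Z - 1 + 1 + (i : nat)%:Z) (k%:Z - 1 + 1 + (j : nat)%:Z) =
      \matrix_(i < n, j < n) A (k + i)%N%:Z (k + j)%N%:Z.
    by apply/matrixP => i j; rewrite !mxE subrK !PoszD.
  exact: hk.
- by move=> n B e n0 BM e0; have [k hk] := key n B e BM e0; exists k.
Qed.

Lemma window_approx A B N (k : int) (e : R) :
  (mxnorm 2%:E (fun_of_matrix
     (\matrix_(i < (N + N).+1, j < (N + N).+1) B ((i : nat)%:Z - N%:Z) ((j : nat)%:Z - N%:Z)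
      - \matrix_(i, j) A (k + (i : nat)%:Z) (k + (j : nat)%:Z))%R) < e%:E)%E ->
  forall i j, (absz i <= N)%N -> (absz j <= N)%N ->
    normc (A (i + (k + N%:Z)) (j + (k + N%:Z)) - B i j) < e.
Proof.
move=> hk i j iN jN.
have hi : (absz (i + N%:Z)%R < (N + N).+1)%N by lia.
have hj : (absz (j + N%:Z)%R < (N + N).+1)%N by lia.
have := mxnorm2_entry (Ordinal hi) (Ordinal hj) hk; rewrite !mxE /= normcB.
have -> : (absz (i + N%:Z)%R)%:Z = i + N%:Z by lia.
have -> : (absz (j + N%:Z)%R)%:Z = j + N%:Z by lia.
by rewrite !addrK ![k + (_ + _)]addrCA.
Qed.

Lemma Mn_window B n (k : int) : Mbi U V W B ->
  Mn U V W (\matrix_(i < n, j < n) B ((i : nat)%:Z + k) ((j : nat)%:Z + k)).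
Proof.
by move=> BM i j; rewrite !mxE; exact: ((entry_shift _ _ _ _ _ k _).1 (BM _ _)).
Qed.

Lemma PsiE_loc_approx A B : PsiE U V W A -> Mbi U V W B ->
  loc_approx (fun _ : unit => A) (fun=> setT) B setT.
Proof.
move=> [AM hA] BM N e e0.
have [k hk] := hA (N + N).+1 _ e isT (@Mn_window B _ (- N%:Z) BM) e0.
by exists tt, (k + 1 + N%:Z) => i iN; split=> // j; exact: window_approx hk i j iN.
Qed.

(** Windows centred at 0 are found around k + N with k >= 0, that is, entirely inside the half-line.
    So the approximated index set is the whole line. *)
Lemma PsiEplus_loc_approx (a : nat -> nat -> R[i]) A B : PsiEplus U V W a ->
  represents Posz a A halfline -> Mbi U V W B ->
  loc_approx (fun _ : unit => A) (fun=> halfline) B setT.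
Proof.
move=> [_ ha] [_ _ aA] BM N e e0.
have [k hk] := ha (N + N).+1 _ e isT (@Mn_window B _ (- N%:Z) BM) e0.
exists tt, (k%:Z + N%:Z) => i iN; split=> [|j].
  by split=> // _; rewrite /halfline/=; lia.
apply: (@window_approx A B N k%:Z e _ i j iN); move: hk => /=.
rewrite (_ : \matrix_(i', j') a _ _ =
  \matrix_(i', j') A (k%:Z + (i' : nat)%:Z) (k%:Z + (j' : nat)%:Z))//.
by apply/matrixP => i' j'; rewrite !mxE aA !PoszD.
Qed.

End Pseudoergodic.

(** * Nonnegativity and convergence of norms *)

Section NonnegativeNorms.
Variables (R : realType) (I : choiceType) (p : \bar R).
Hypothesis p1 : (1 <= p)%E.

(** On an empty index type the norm for p = +oo is a supremum over the empty set, that is -oo; hence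
    the inhabitation conditions here and later. *)
Lemma lpnorm_ge0 (x : I -> R[i]) : inhabited I -> (0 <= lpnorm p x)%E.
Proof.
case=> i; move: p1; case: (p) => [r| |]//= _; first exact: poweR_ge0.
apply: (@le_trans _ _ (normc (x i))%:E); first by rewrite lee_fin.
by apply: ereal_sup_ubound; exists i.
Qed.

Lemma opnorm_ge0 (T : (I -> R[i]) -> I -> R[i]) : inhabited I -> (0 <= opnorm p T)%E.
Proof.
move=> hI; apply: (@le_trans _ _ (lpnorm p (T (fun=> 0)))); first exact: lpnorm_ge0.
apply: ereal_sup_ubound; exists (fun=> 0) => //=.
by apply/lpbP => //; exact: lpb0.
Qed.

Lemma mxnorm_ge0 (a : I -> I -> R[i]) : inhabited I -> (0 <= mxnorm p a)%E.
Proof. exact: opnorm_ge0. Qed.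

Lemma invnorm_ge0 (a : I -> I -> R[i]) : inhabited I -> (0 <= invnorm p a)%E.
Proof. by move=> hI; rewrite /invnorm; case: ifP => // _; exact: opnorm_ge0. Qed.

End NonnegativeNorms.

Lemma ereal_fin_between (R : realType) (x : \bar R) (C : R) :
  (0 <= x)%E -> (x <= C%:E)%E -> exists2 c : R, 0 <= c & x = c%:E.
Proof. by case: x => [c| |]// c0 _; exists c. Qed.

(** Convergence from below, phrased for lower semicontinuity: if it failed, infinitely many values
    would stay below some c < v, and the last hypothesis applies to exactly that subfamily. *)
Lemma cvge_of_frequently (R : realType) (f : nat -> \bar R) (v : R) : 0 <= v ->
  (forall n, (f n <= v%:E)%E) -> (\forall n \near \oo, (0 <= f n)%E) ->
  (forall c, 0 <= c -> (forall N, exists n, (N <= n)%N /\ (f n <= c%:E)%E) -> v <= c) ->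
  f n @[n --> \oo] --> v%:E.
Proof.
move=> v0 fv f0 hf; apply: cvge_dist => e e0.
have ub n : (f n <= (v + e)%:E)%E.
  by apply: le_trans (fv n) _; rewrite lee_fin; lra.
have [c0|c0] := leP 0 (v - e); last first.
  by move: f0 => [N _ hN]; exists N => // n /hN /= h; rewrite ub andbT (le_trans _ h)// lee_fin ltW.
have [N hN] : exists N, forall n, (N <= n)%N -> ((v - e)%:E <= f n)%E.
  apply: contrapT => /forallNP h.
  suff : v <= v - e by lra.
  apply: hf => // N; have /existsNP[n /not_implyP[Nn /negP]] := h N.
  by rewrite -ltNge => /ltW fn; exists n.
by exists N => // n /hN h; rewrite h ub.
Qed.

Section FiniteSections.
Variable R : realType.

Lemma represents_finsec_int (A : int -> int -> R[i]) (D : set int) :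
  represents (@set_val _ D : index_in D -> int) (finsec A (D := D)) A D.
Proof.
split=> //.
apply/seteqP; split=> [_ [x _ <-]|i Di]; first by rewrite set_valE; exact: set_valP.
by exists (SigSub (mem_set Di)).
Qed.

Lemma window_plus_image r : Posz @` window_plus r = block r.
Proof.
apply/seteqP; split=> [_ [k /= kr <-]|i]; first by rewrite /block/=.
rewrite /block/= => /andP[i0 ir]; exists (absz i); last by lia.
by rewrite /window_plus/=; lia.
Qed.

Lemma represents_finsec_nat (a : nat -> nat -> R[i]) (A : int -> int -> R[i]) r :
  represents Posz a A halfline ->
  represents (fun i : index_in (window_plus r) => Posz (set_val i))
    (finsec a (D := window_plus r)) A (block r).
Proof.
move=> [_ _ aA]; split.
- by move=> i j [] ; rewrite set_valE => /val_inj.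
- rewrite -window_plus_image; apply/seteqP; split=> [_ [x _ <-]|_ [k kr <-]].
    by exists (set_val x) => //; rewrite set_valE; exact: set_valP.
  by exists (SigSub (mem_set kr)).
- by move=> i j; rewrite /finsec aA.
Qed.

End FiniteSections.

(** * Finite section methods, norms and condition numbers *)

Section Main.
Variables (R : realType) (U V W : set R[i]).
Hypotheses (U0 : U !=set0) (V0 : V !=set0) (W0 : W !=set0).
Hypotheses (cU : compact (U : set R[i]^o)) (cV : compact (V : set R[i]^o))
  (cW : compact (W : set R[i]^o)).
Hypotheses (injZ : injective_Z U V W) (inj : injective_half U V W)
  (inj' : injective_half W V U).
Implicit Types (p q : \bar R) (A B : int -> int -> R[i]) (D E : set int).

Lemma represents_invertible (I : choiceType) (pos : I -> int) a A E p :
  (1 <= p)%E -> represents pos a A E -> Mbi U V W A -> convex_set E ->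
  lp_invertible p (matop a).
Proof.
move=> p1 rA AM cE; have [C C0 lb] := uniform_lower_bound U0 V0 W0 cU cV cW injZ inj inj' p1.
have [K K0 hK] := Mbi_bounded cU cV cW.
apply: (lp_invertibleP rA (Mbi_far AM) p1 C0 K0 (hK A AM)).
  exact: lb.
exact: (convex_solvable U0 V0 W0 cU cV cW injZ inj inj').
Qed.

Section FiniteSectionMethod.
Variables (I : choiceType) (pos : I -> int) (a : I -> I -> R[i]).
Variables (A : int -> int -> R[i]) (E : set int).
Hypotheses (rA : represents pos a A E) (AM : Mbi U V W A) (cE : convex_set E).
Variable D : nat -> set I.
Hypothesis cD : forall n, convex_set (pos @` D n).
Hypothesis fD : forall n, exists N, forall i, D n i -> (absz (pos i) <= N)%N.
Hypothesis exD : forall i, \forall n \near \oo, D n i.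

Let pi : injective pos. Proof. by case: rA. Qed.
Let rE : range pos = E. Proof. by case: rA. Qed.
Let far := Mbi_far AM.

Lemma truncated_solutionP n b x : truncated_solution a (D n) b x <->
  supp (pos @` D n) (ext pos x) /\
  forall k, (pos @` D n) k -> trop A (ext pos x) k = ext pos b k.
Proof.
have key y : (forall i, ~ D n i -> y i = 0) -> forall i,
    \sum_(j \in D n) a i j * y j = trop A (ext pos y) (pos i).
  move=> y0 i; rewrite -(matopE pi rA far) /matop; apply: fsbig_widen => // j [_ /= Dj].
  by rewrite y0// mulr0.
split=> -[x0 hx].
  split=> [k Dk|_ [i Di <-]]; last by rewrite -key// hx// ext_pos.
  have [[i ik]|/forallNP h] := pselect (exists i, pos i = k); last exact: ext_out.
  by rewrite -ik ext_pos//; apply: x0 => Di; apply: Dk; exists i.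
have x0' i : ~ D n i -> x i = 0.
  move=> Di; rewrite -(ext_pos pi x i); apply: x0 => -[j Dj /pi ji].
  by apply: Di; rewrite -ji.
by split=> // i Di; rewrite key// hx ?ext_pos//; exists i.
Qed.

Let D_bounded n (X : int -> R[i]) : supp (pos @` D n) X -> bounded_fun X.
Proof.
move=> sX; have [N hN] := fD n; apply: (@finsupp_bounded _ N X) => k kN.
by apply: sX => -[i /hN iN ik]; move: kN; rewrite -ik ltnNge iN.
Qed.

Lemma eventually_covers (s : seq int) :
  \forall n \near \oo, forall k, k \in s -> E k -> (pos @` D n) k.
Proof.
elim: s => [|k0 s IH]; first by exists 0%N.
have h0 : \forall n \near \oo, E k0 -> (pos @` D n) k0.
  have [|nE] := pselect (E k0); last by exists 0%N.
  rewrite -rE => -[i _ <-]; have [N _ hN] := exD i; exists N => // n /hN Di _.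
  by exists i.
near=> n => k; rewrite inE => /predU1P[->|ks]; first by near: n.
by move: k ks; near: n.
Unshelve. all: by end_near.
Qed.

(** [Q n] is the part of the solution outside the section and [Z n] the error inside; the section
    maps [Z n] to the restriction of A ([Q n]). For p < +oo, [Q n] is a small tail. For p = +oo it
    is merely bounded, but far away from any given index, and [uniform_decay] gives entrywise
    convergence. *)
Lemma fsm_applies_represents p : (1 <= p)%E -> fsm_applies p a D.
Proof.
move=> p1; split; first exact: (represents_invertible p1 rA).
  exists 0%N => // n _ b bp.
  have [m hm] := (lpb_ex b p1).1 bp.
  have [||X [sX bX hX]] := convex_solvable U0 V0 W0 cU cV cW injZ inj inj' p1 AM (@cD n)
      (b := cut (pos @` D n) (ext pos b)).
  - exact: supp_cut.
  - by apply/lpb_ex => //; exists m; apply: lpb_cut => //; exact/(ext_lpb pi _ _ p1).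
  have XE : ext pos (X \o pos) = X.
    by apply: (ext_restr pi rE) => k Ek; apply: sX => -[i _ ik]; apply: Ek; rewrite -rE; exists i.
  exists (X \o pos); split.
    by apply/truncated_solutionP; rewrite XE; split=> // k Dk; rewrite hX// cut_in.
  move=> y /truncated_solutionP[sy hy]; apply/funext => i; rewrite /= -(ext_pos pi y i).
  suff -> : X = ext pos y by [].
  apply: (trop_injective (convex_inj U0 V0 W0 injZ inj inj') AM (@cD n)) => //.
    exact: D_bounded sy.
  by move=> k Dk; rewrite hy// hX// cut_in.
move=> b x xn bp xp axb hxn.
have [C C0 lb] := uniform_lower_bound U0 V0 W0 cU cV cW injZ inj inj' p1.
have [K K0 hK] := Mbi_bounded cU cV cW; have AK := hK A AM.
have [m hm] := (lpb_ex x p1).1 xp; have [mb hb] := (lpb_ex b p1).1 bp.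
have hX : lpb p (ext pos x) m by exact/(ext_lpb pi _ _ p1).
pose X := ext pos x; pose Xn n := ext pos (xn n).
pose Q n k := X k - cut (pos @` D n) X k.
pose Z n k := Xn n k - cut (pos @` D n) X k.
have QX n k : normc (Q n k) <= normc (X k).
  by rewrite /Q /cut; case: asboolP => _; rewrite ?subrr ?normc0 ?subr0.
have tX k : E k -> trop A X k = ext pos b k.
  by rewrite -rE => -[i _ <-]; rewrite -(matopE pi rA far) axb ext_pos.
have DE n k : (pos @` D n) k -> E k by move=> [i _ <-]; rewrite -rE; exists i.
have Q0 n k : (E k -> (pos @` D n) k) -> Q n k = 0.
  move=> h; have [Ek|Ek] := pselect (E k); first by rewrite /Q cut_in ?subrr//; exact: h.
  have X0 : X k = 0 by exact: (supp_ext x rE Ek).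
  by rewrite /Q /cut X0 if_same subrr.
have sZ n : truncated_solution a (D n) b (xn n) -> supp (pos @` D n) (Z n).
  move=> /truncated_solutionP[s0 _] k Dk.
  by rewrite /Z /Xn s0// cut_out// subrr.
have tZ n k : truncated_solution a (D n) b (xn n) -> (pos @` D n) k ->
    trop A (Z n) k = trop A (Q n) k.
  move=> /truncated_solutionP[_ h] Dk.
  by rewrite /Z /Q !tropB h// tX//; exact: DE Dk.
have bZ n : truncated_solution a (D n) b (xn n) -> bounded_fun (Z n).
  by move=> /sZ; exact: D_bounded.
have hZ n t : truncated_solution a (D n) b (xn n) -> lpb p (Q n) t ->
    lpb p (Z n) (C * (3 * K * t)).
  move=> hn hQ; apply: (lb A _ AM (@cD n)); [exact: sZ|exact: bZ|].
  apply: lpb_le (trop_lpb p1 K0 AK hQ) => // k.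
  have [Dk|Dk] := pselect ((pos @` D n) k); first by rewrite cut_in// tZ.
  by rewrite cut_out// normc0.
have hdiff n t : truncated_solution a (D n) b (xn n) -> lpb p (Q n) t ->
    lpb p (fun j => xn n j - x j) (C * (3 * K * t) + t).
  move=> hn hQ; have := lpbD p1 (hZ n t hn hQ) (lpbZ (-1) p1 hQ).
  rewrite normcN normc1 mul1r => /(lpb_inj pi); apply: lpb_eq => j /=.
  by rewrite /Z /Q /Xn /X !ext_pos//; ring.
split=> [plt|pE].
  apply: cvge_dist => e e0.
  pose t := e / (3 * C * K + 1).
  have CK : 0 <= 3 * C * K by rewrite !mulr_ge0.
  have t0 : 0 < t by rewrite divr_gt0//; lra.
  case: p p1 plt hX lb {bp xp hm hb hZ} hdiff => [r| |]//= p1 _ hX _ hdiff.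
  have [s hs] := lpb_tail p1 hX t0.
  have sD := eventually_covers s.
  have : \forall n \near \oo, truncated_solution a (D n) b (xn n) /\
      forall k, k \in s -> E k -> (pos @` D n) k by near=> n; split; near: n.
  move=> [N _ hN]; exists N => // n /hN [hn hnD].
  have hQ : lpb r%:E (Q n) t.
    by apply: hs => [k|k ks]; [exact: QX|apply: Q0; exact: hnD].
  have := hdiff n t hn hQ.
  have CK1 : 0 < 3 * C * K + 1 by rewrite ltr_wpDl.
  have -> : C * (3 * K * t) + t = (3 * C * K + 1) * t by ring.
  have -> : (3 * C * K + 1) * t = e by rewrite mulrC divfK// gt_eqF.
  move=> /lpbP-/(_ p1 (ltW e0)) h; rewrite sub0r add0r h andbT.
  apply: (@le_trans _ _ 0%E); first by rewrite lee_fin lerNl oppr0 ltW.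
  exact: poweR_ge0.
split.
  exists (C * mb); move: hxn => [N _ hN]; exists N => // n /hN /= hn.
  have := hn => /truncated_solutionP[sy hy].
  have mb0 := lpb_ge0 hb.
  apply/lpbP => //; first by rewrite mulr_ge0.
  apply/(ext_lpb pi _ _ p1); apply: (lb A _ AM (@cD n)) => //; first exact: D_bounded sy.
  have hbe : lpb p (ext pos b) mb by exact/(ext_lpb pi _ _ p1).
  apply: lpb_le hbe => // k.
  have [Dk|Dk] := pselect ((pos @` D n) k); first by rewrite cut_in// hy.
  by rewrite cut_out// normc0.
move=> j; apply: cvg_normc => e e0.
have m0 := lpb_ge0 hX.
have [C' [rho [C'0 rho01 hdec]]] := uniform_decay U0 V0 W0 cU cV cW injZ inj inj'.
have rho0 : 0 < rho by case/andP: rho01.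
have rho1 : rho <= 1 by case/andP: rho01 => _ /ltW.
have [N0 hN0] := @geo_small _ rho (C' * (3 * K * m)) e rho01 e0.
(* The radius is N0 + 1 because row k reads the entries k - 1 and k + 1. *)
have sD : \forall n \near \oo, forall k, (absz (k - pos j) <= N0.+1)%N -> E k -> (pos @` D n) k.
  have := eventually_covers [seq pos j + (l%:Z - (N0.+1)%:Z) | l <- iota 0 (N0.+1 + N0.+1).+1].
  move=> [N _ hN]; exists N => // n /hN h k kj; apply: h.
  have /mapP[l ls lE] := mem_sym_range kj; apply/mapP; exists l => //.
  by rewrite -lE subrKC.
have : \forall n \near \oo, truncated_solution a (D n) b (xn n) /\
    (forall k, (absz (k - pos j) <= N0.+1)%N -> E k -> (pos @` D n) k).
  by near=> n; split; near: n.
move=> [N _ hN]; exists N => // n /hN [hn hnD] /=.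
have -> : xn n j - x j = Z n (pos j).
  rewrite /Z /Xn cut_in /X ?ext_pos//; apply: hnD; first by rewrite subrr.
  by rewrite -rE; exists j.
apply: (@le_trans _ _ (C' * (3 * K * m * rho ^+ N0))); last first.
  by rewrite mulrA; exact: hN0.
have beta0 : 0 <= 3 * K * m * rho ^+ N0 by rewrite !mulr_ge0// exprn_ge0// ltW.
apply: (hdec A _ (Z n) (pos j) _ AM (@cD n) (sZ n hn) (bZ n hn)) => // k Dk.
rewrite tZ//; have [kj|kj] := leqP (absz (k - pos j)) N0.
  rewrite /trop !Q0 ?mulr0 ?addr0 ?normc0 ?mulr0//; apply: hnD; clear -kj; lia.
rewrite mulrC ler_pM ?exprn_ge0 ?(ltW rho0)//; last first.
  by rewrite ler_wiXn2l ?(ltW rho0)//; clear -kj; lia.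
have hQ : lpb p (Q n) m by apply: lpb_le hX => //; exact: QX.
exact: lpb_pt (trop_lpb p1 K0 AK hQ).
Unshelve. all: by end_near.
Qed.

End FiniteSectionMethod.

Lemma represents_mxnormP (I : choiceType) (pos : I -> int) a A D p c :
  (1 <= p)%E -> represents pos a A D -> Mbi U V W A -> 0 <= c ->
  (mxnorm p a <= c%:E)%E <-> upper_bound p A D c.
Proof. by move=> p1 rA AM c0; exact: (mxnormP rA (Mbi_far AM) p1). Qed.

Lemma represents_invnormP (I : choiceType) (pos : I -> int) a A D p c :
  (1 <= p)%E -> represents pos a A D -> Mbi U V W A -> convex_set D -> 0 <= c ->
  (invnorm p a <= c%:E)%E <-> lower_bound p A D c.
Proof.
move=> p1 rA AM cD c0.
have [C C0 lb] := uniform_lower_bound U0 V0 W0 cU cV cW injZ inj inj' p1.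
have [K K0 hK] := Mbi_bounded cU cV cW.
apply: (invnormP rA (Mbi_far AM) p1 c0 C0 K0 (hK A AM)); first exact: lb.
exact: (convex_solvable U0 V0 W0 cU cV cW injZ inj inj').
Qed.

Lemma represents_cond (I : choiceType) (pos : I -> int) a A D p :
  (1 <= p)%E -> represents pos a A D -> Mbi U V W A -> convex_set D ->
  cond p a = (mxnorm p a * invnorm p a)%E.
Proof.
move=> p1 rA AM cD; rewrite /cond asboolT//.
exact: (represents_invertible p1 rA).
Qed.

Lemma mxnorm_fin p : (1 <= p)%E -> exists K : R, forall (I : choiceType)
    (pos : I -> int) a A D, represents pos a A D -> Mbi U V W A ->
  (mxnorm p a <= K%:E)%E.
Proof.
move=> p1; have [K K0 hK] := Mbi_bounded cU cV cW; exists (3 * K) => I pos a A D rA AM.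
apply/(represents_mxnormP p1 rA AM); first by rewrite mulr_ge0.
by move=> X m _ hX; apply: lpb_cut => //; apply: trop_lpb => //; exact: hK.
Qed.

Lemma invnorm_fin p : (1 <= p)%E -> exists K : R, forall (I : choiceType)
    (pos : I -> int) a A D, represents pos a A D -> Mbi U V W A -> convex_set D ->
  (invnorm p a <= K%:E)%E.
Proof.
move=> p1.
have [C C0 lb] := uniform_lower_bound U0 V0 W0 cU cV cW injZ inj inj' p1.
exists C => I pos a A D rA AM cD.
by apply/(represents_invnormP p1 rA AM cD C0); exact: lb.
Qed.

Lemma Mnorm_fin p : (1 <= p)%E -> exists2 m : R, 0 <= m & Mnorm U V W p = m%:E.
Proof.
move=> p1; have [K hK] := mxnorm_fin p1; have [A AM _] := pseudoergodic_ex U0 V0 W0.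
apply: (@ereal_fin_between _ _ K).
  apply: le_trans (mxnorm_ge0 p1 A (inhabits 0)) _.
  by apply: ereal_sup_ubound; exists A.
by apply: ge_ereal_sup => _ [B BM <-]; exact: (hK _ _ _ _ _ (represents_int B) BM).
Qed.

Lemma Nnorm_fin p : (1 <= p)%E -> exists2 m : R, 0 <= m & Nnorm U V W p = m%:E.
Proof.
move=> p1; have [K hK] := invnorm_fin p1; have [A AM _] := pseudoergodic_ex U0 V0 W0.
apply: (@ereal_fin_between _ _ K).
  apply: le_trans (invnorm_ge0 p1 A (inhabits 0)) _.
  by apply: ereal_sup_ubound; exists A.
by apply: ge_ereal_sup => _ [B BM <-]; exact: (hK _ _ _ _ _ (represents_int B) BM convex_setT).
Qed.

Lemma upper_bound_sub p A D c : (1 <= p)%E ->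
  upper_bound p A setT c -> upper_bound p A D c.
Proof.
move=> p1 h X m sX hX; apply: lpb_cut => //.
by have := h X m (fun i ni => False_ind _ (ni I)) hX; rewrite cutT.
Qed.

Lemma mxnorm_le_Mnorm (I : choiceType) (pos : I -> int) a A D p :
  (1 <= p)%E -> represents pos a A D -> Mbi U V W A ->
  (mxnorm p a <= Mnorm U V W p)%E.
Proof.
move=> p1 rA AM; have [m m0 mE] := Mnorm_fin p1; rewrite mE.
apply/(represents_mxnormP p1 rA AM m0); apply: upper_bound_sub => //.
apply/(represents_mxnormP p1 (represents_int A) AM m0).
by rewrite -mE; apply: ereal_sup_ubound; exists A.
Qed.

Lemma mxnorm_approx (I J : choiceType) (posI : I -> int) (posJ : J -> int) a A D b B E p :
  (1 <= p)%E -> represents posI a A D -> represents posJ b B E ->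
  Mbi U V W A -> Mbi U V W B -> inhabited I ->
  loc_approx (fun _ : unit => A) (fun=> D) B E ->
  (mxnorm p b <= mxnorm p a)%E.
Proof.
move=> p1 rA rB AM BM hI app; have [K hK] := mxnorm_fin p1.
have [c c0 cE] := ereal_fin_between (mxnorm_ge0 p1 a hI) (hK _ _ _ _ _ rA AM).
rewrite cE; apply/(represents_mxnormP p1 rB BM c0).
apply: (upper_bound_approx p1 app c0) => _.
by apply/(represents_mxnormP p1 rA AM c0); rewrite cE.
Qed.

Lemma invnorm_approx (I J : choiceType) (posI : I -> int) (posJ : J -> int) a A D b B E p :
  (1 <= p)%E -> represents posI a A D -> represents posJ b B E ->
  Mbi U V W A -> Mbi U V W B -> convex_set D -> convex_set E -> inhabited I ->
  loc_approx (fun _ : unit => A) (fun=> D) B E ->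
  (invnorm p b <= invnorm p a)%E.
Proof.
move=> p1 rA rB AM BM cD cE hI app; have [L hL] := invnorm_fin p1.
have [c c0 vE] := ereal_fin_between (invnorm_ge0 p1 a hI) (hL _ _ _ _ _ rA AM cD).
have [C C0 lb] := uniform_lower_bound U0 V0 W0 cU cV cW injZ inj inj' p1.
have [K K0 hK] := Mbi_bounded cU cV cW.
rewrite vE; apply/(represents_invnormP p1 rB BM cE c0).
apply: (lower_bound_approx p1 app c0 K0 (hK B BM) (lb B E BM cE)) => _.
by apply/(represents_invnormP p1 rA AM cD c0); rewrite vE.
Qed.

Lemma PsiE_mxnorm A p : (1 <= p)%E -> PsiE U V W A -> mxnorm p A = Mnorm U V W p.
Proof.
move=> p1 hA; have AM := hA.1; apply/eqP; rewrite eq_le; apply/andP; split.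
  by apply: ereal_sup_ubound; exists A.
apply: ge_ereal_sup => _ [B BM <-].
apply: (mxnorm_approx p1 (represents_int A) (represents_int B) AM BM (inhabits 0)).
exact: PsiE_loc_approx hA BM.
Qed.

Lemma PsiE_invnorm A p : (1 <= p)%E -> PsiE U V W A -> invnorm p A = Nnorm U V W p.
Proof.
move=> p1 hA; have AM := hA.1; apply/eqP; rewrite eq_le; apply/andP; split.
  by apply: ereal_sup_ubound; exists A.
apply: ge_ereal_sup => _ [B BM <-].
apply: (invnorm_approx p1 (represents_int A) (represents_int B) AM BM convex_setT
  convex_setT (inhabits 0)).
exact: PsiE_loc_approx hA BM.
Qed.

Lemma Mplus_extension a : Mplus U V W a ->
  exists2 A, Mbi U V W A & represents Posz a A halfline.
Proof.
move=> aM; have [|A AM] := extension_ex U0 V0 W0 _ aM; first by move=> ? ? [].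
by rewrite range_Posz; exists A.
Qed.

Lemma PsiEplus_mxnorm a p : (1 <= p)%E -> PsiEplus U V W a -> mxnorm p a = Mnorm U V W p.
Proof.
move=> p1 ha; have [A AM rA] := Mplus_extension ha.1.
apply/eqP; rewrite eq_le; apply/andP; split; first exact: mxnorm_le_Mnorm rA AM.
apply: ge_ereal_sup => _ [B BM <-].
apply: (mxnorm_approx p1 rA (represents_int B) AM BM (inhabits 0%N)).
exact: PsiEplus_loc_approx ha rA BM.
Qed.

Lemma fsm_applies_int s (A : int -> int -> R[i]) (l r : nat -> int) :
  (1 <= s)%E -> Mbi U V W A ->
  (forall K : int, \forall n \near \oo, l n <= K) ->
  (forall K : int, \forall n \near \oo, K <= r n) ->
  fsm_applies s A (fun n => window (l n) (r n)).
Proof.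
move=> s1 AM hl hr.
apply: (fsm_applies_represents (represents_int A) AM) => //.
- by move=> n; rewrite image_id; exact: convex_window.
- by move=> n; exists (absz (l n) + absz (r n))%N => i; rewrite /window/=; lia.
- move=> i; near=> n; rewrite /window/=; apply/andP; split; near: n; [exact: hl|exact: hr].
Unshelve. all: by end_near.
Qed.

Lemma fsm_applies_nat s (a : nat -> nat -> R[i]) (r : nat -> nat) :
  (1 <= s)%E -> Mplus U V W a ->
  (forall K : nat, \forall n \near \oo, (K <= r n)%N) ->
  fsm_applies s a (fun n => window_plus (r n)).
Proof.
move=> s1 aM hr; have [A AM rA] := Mplus_extension aM.
apply: (fsm_applies_represents rA AM) => //.
- exact: convex_halfline.
- by move=> n; have := @convex_block (r n); rewrite -window_plus_image.
- by move=> n; exists (r n) => i; rewrite /window_plus/=; lia.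
- by move=> i; exact: hr.
Qed.

(** * Consequences of favourable exponents *)

Section Favourable.
Variable p : \bar R.
Hypotheses (p1 : (1 <= p)%E) (fav_p : favourable U V W p).
Variable np : R.
Hypotheses (np0 : 0 <= np) (npE : Nnorm U V W p = np%:E).

Lemma Nnorm_lower_bound A : Mbi U V W A -> lower_bound p A setT np.
Proof.
move=> AM; apply/(represents_invnormP p1 (represents_int A) AM convex_setT np0).
by rewrite -npE; apply: ereal_sup_ubound; exists A.
Qed.

(** [favourable] quantifies over pseudoergodic operators, so this equality of suprema depends on the
    existence of one. *)
Lemma favourable_sup : ereal_sup [set invnorm p C | C in Mplus U V W] = Nnorm U V W p.
Proof.
have [A AM [_ hA]] := pseudoergodic_ex U0 V0 W0.
by have [<- ->] := fav_p hA.
Qed.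

Lemma half_lower_bound A : Mbi U V W A -> lower_bound p A halfline np.
Proof.
move=> AM; apply/(represents_invnormP p1 (represents_nat A) AM convex_halfline np0).
rewrite -npE -favourable_sup; apply: ereal_sup_ubound.
by exists (fun i j : nat => A i j) => // i j; exact: (AM i j).
Qed.

End Favourable.

(** The reflected transpose of an operator in M(U,V,W) is again in M(U,V,W), and on the line the
    reflection changes no norm. *)
Lemma Nnorm_dual p q np : (1 <= p)%E -> (1 <= q)%E -> (p^-1 + q^-1 = 1)%E ->
  0 <= np -> Nnorm U V W p = np%:E -> (Nnorm U V W q <= np%:E)%E.
Proof.
move=> p1 q1 pq np0 npE; apply: ge_ereal_sup => _ [B BM <-].
apply/(represents_invnormP q1 (represents_int B) BM convex_setT np0).
have qp : (q^-1 + p^-1 = 1)%E by rewrite addeC.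
apply: (dual_lower_bound U0 V0 W0 cU cV cW injZ inj inj' q1 p1 qp np0 BM convex_setT).
apply: (@lower_bound_refl _ _ _ _ _ 0).
apply: (Nnorm_lower_bound p1 np0 npE).
exact: Mbi_refl (Mbi_tr BM).
Qed.

Section FavourablePair.
Variables (p q : \bar R).
Hypotheses (p1 : (1 <= p)%E) (q1 : (1 <= q)%E) (pq : (p^-1 + q^-1 = 1)%E).
Hypotheses (fav_p : favourable U V W p) (fav_q : favourable U V W q).
Variable np : R.
Hypotheses (np0 : 0 <= np) (npE : Nnorm U V W p = np%:E).

Lemma half_lower_bound_dual A : Mbi W V U A -> lower_bound p A halfline np.
Proof.
move=> AM; have injZ' : injective_Z W V U by exact: injective_Z_refl.
have [nq nq0 nqE] := Nnorm_fin q1.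
have nqp : nq <= np.
  by rewrite -lee_fin -nqE; exact: Nnorm_dual npE.
apply: (dual_lower_bound W0 V0 U0 cW cV cU injZ' inj' inj p1 q1 pq np0 AM convex_halfline).
move=> X m sX bX hX; have := half_lower_bound q1 fav_q nq0 nqE (Mbi_tr AM) sX bX hX.
by apply: lpb_mono => //; rewrite ler_wpM2r// (lpb_ge0 hX).
Qed.

Lemma window_Nnorm A l r : Mbi U V W A -> lower_bound p A (window l r) np.
Proof.
move=> AM; have [lr|lr] := leP l r.
  apply: (window_lower_bound U0 V0 W0 p1 np0 _ _ AM lr).
    exact: half_lower_bound npE.
  exact: half_lower_bound_dual.
move=> X m sX _ hX; apply: lpb0 => //; first by rewrite mulr_ge0// (lpb_ge0 hX).
by move=> i; apply: sX; rewrite /window/=; lia.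
Qed.

Lemma block_Nnorm A n : Mbi U V W A -> lower_bound p A (block n) np.
Proof.
move=> AM; apply: (block_lower_bound U0 V0 W0 p1 np0 _ _ AM).
  exact: half_lower_bound npE.
exact: half_lower_bound_dual.
Qed.

(** * Convergence of the norms of finite sections *)

Section SectionLimits.
Variables (I : choiceType) (pos : I -> int) (a : I -> I -> R[i]).
Variables (A : int -> int -> R[i]) (E : set int).
Hypotheses (rA : represents pos a A E) (AM : Mbi U V W A) (cE : convex_set E).
Variables (In : nat -> choiceType) (posn : forall n, In n -> int).
Variables (an : forall n, In n -> In n -> R[i]) (Dn : nat -> set int).
Hypotheses (rn : forall n, represents (@posn n) (@an n) A (Dn n)).
Hypotheses (cDn : forall n, convex_set (Dn n)).
Hypothesis In0 : \forall n \near \oo, inhabited (In n).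
Hypothesis exhaust : forall N : nat, \forall n \near \oo,
  forall i, (absz i <= N)%N -> (E i <-> Dn n i).
Hypothesis lbn : forall n, lower_bound p A (Dn n) np.
Hypotheses (mxE : mxnorm p a = Mnorm U V W p) (invE : invnorm p a = Nnorm U V W p).

(** The family is indexed by the sections with property P, so that semicontinuity applies along any
    infinite set of sections, without extracting a subsequence. *)
Lemma frequently_approx (P : nat -> Prop) :
  (forall N, exists n, (N <= n)%N /\ P n) ->
  loc_approx (fun s : {n | P n} => A) (fun s => Dn (sval s)) A E.
Proof.
move=> hP N e e0; have [M _ hM] := exhaust N; have [n [Mn Pn]] := hP M.
exists (exist _ n Pn), 0 => i iN; rewrite addr0; split; first exact: hM.
by move=> j _; rewrite addr0 subrr normc0.
Qed.

Lemma section_mxnorm_cvg : mxnorm p (@an n) @[n --> \oo] --> mxnorm p a.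
Proof.
have [mp mp0 mpE] := Mnorm_fin p1; rewrite mxE mpE; apply: cvge_of_frequently => //.
- by move=> n; rewrite -mpE; exact: mxnorm_le_Mnorm (rn n) AM.
- by move: In0 => [N _ hN]; exists N => // n /hN; exact: mxnorm_ge0.
move=> c c0 hc; rewrite -lee_fin -mpE -mxE; apply/(represents_mxnormP p1 rA AM c0).
apply: (upper_bound_approx p1 (frequently_approx hc) c0) => -[n /= hn].
exact/(represents_mxnormP p1 (rn n) AM c0).
Qed.

Lemma section_invnorm_cvg : invnorm p (@an n) @[n --> \oo] --> invnorm p a.
Proof.
rewrite invE npE; apply: cvge_of_frequently => //.
- by move=> n; apply/(represents_invnormP p1 (rn n) AM (@cDn n) np0).
- by move: In0 => [N _ hN]; exists N => // n /hN; exact: invnorm_ge0.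
move=> c c0 hc; rewrite -lee_fin -npE -invE; apply/(represents_invnormP p1 rA AM cE c0).
have [C C0 lb] := uniform_lower_bound U0 V0 W0 cU cV cW injZ inj inj' p1.
have [K K0 hK] := Mbi_bounded cU cV cW.
apply: (lower_bound_approx p1 (frequently_approx hc) c0 K0 (hK A AM) (lb A E AM cE)).
by move=> [n /= hn]; exact/(represents_invnormP p1 (rn n) AM (@cDn n) c0).
Qed.

Lemma sections_cvg :
  [/\ mxnorm p (@an n) @[n --> \oo] --> mxnorm p a,
      invnorm p (@an n) @[n --> \oo] --> invnorm p a
    & cond p (@an n) @[n --> \oo] --> cond p a].
Proof.
have hm := section_mxnorm_cvg; have hi := section_invnorm_cvg; split=> //.
rewrite (represents_cond p1 rA AM cE).
have -> : (fun n => cond p (@an n)) = (fun n => mxnorm p (@an n) * invnorm p (@an n))%E.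
  by apply/funext => n; rewrite (represents_cond p1 (rn n) AM (@cDn n)).
by apply: cvgeM => //; have [mp _ mpE] := Mnorm_fin p1; rewrite mxE invE mpE npE.
Qed.

End SectionLimits.

Let cond_Mbi (A : int -> int -> R[i]) : Mbi U V W A ->
  cond p A = (mxnorm p A * invnorm p A)%E.
Proof.
move=> AM; exact: (represents_cond p1 (represents_int A) AM).
Qed.

Let cond_Mplus a : Mplus U V W a -> cond p a = (mxnorm p a * invnorm p a)%E.
Proof.
move=> aM; have [A AM rA] := Mplus_extension aM.
exact: (represents_cond p1 rA AM convex_halfline).
Qed.

Lemma PsiE_norms A : PsiE U V W A -> mxnorm p A = Mnorm U V W p /\
  invnorm p A = Nnorm U V W p.
Proof.
move=> hA; split; first exact: (PsiE_mxnorm p1 hA).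
exact: (PsiE_invnorm p1 hA).
Qed.

Lemma PsiEplus_norms a : PsiEplus U V W a -> mxnorm p a = Mnorm U V W p /\
  invnorm p a = Nnorm U V W p.
Proof.
move=> ha; split; first exact: (PsiEplus_mxnorm p1 ha).
by case: (fav_p ha).
Qed.

Lemma finsec_int_cvg A (l r : nat -> int) : PsiE U V W A ->
  (forall K : int, \forall n \near \oo, l n <= K) ->
  (forall K : int, \forall n \near \oo, K <= r n) ->
  let An n := finsec A (D := window (l n) (r n)) in
  [/\ mxnorm p (An n) @[n --> \oo] --> mxnorm p A,
      invnorm p (An n) @[n --> \oo] --> invnorm p A
    & cond p (An n) @[n --> \oo] --> cond p A].
Proof.
move=> hA hl hr An; have AM := hA.1; have [mxE invE] := PsiE_norms hA.
have rn n : represents (@set_val _ (window (l n) (r n)) : index_in _ -> int) (An n) A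
    (window (l n) (r n)) by exact: represents_finsec_int.
have cDn n : convex_set (window (l n) (r n)) by exact: convex_window.
have In0 : \forall n \near \oo, inhabited (index_in (window (l n) (r n))).
  have : \forall n \near \oo, l n <= 0 /\ 0 <= r n by near=> n; split; near: n.
  move=> [N _ hN]; exists N => // n /hN [h1 h2]; constructor.
  have w0 : window (l n) (r n) 0 by rewrite /window/= h1.
  exact: (SigSub (mem_set w0)).
have exhaust (N : nat) : \forall n \near \oo, forall i, (absz i <= N)%N ->
    ((setT : set int) i <-> window (l n) (r n) i).
  have : \forall n \near \oo, l n <= - N%:Z /\ N%:Z <= r n by near=> n; split; near: n.
  move=> [M _ hM]; exists M => // n /hM [h1 h2] i iN; split=> // _.
  by rewrite /window/=; lia.
apply: (sections_cvg (represents_int A) AM convex_setT rn cDn In0 exhaust _ mxE invE).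
by move=> n; exact: window_Nnorm.
Unshelve. all: by end_near.
Qed.

(* Finite sections and square matrices are treated together: both are families
   representing the blocks of one half-line matrix. *)
Lemma half_sections_cvg a A (In : nat -> choiceType) (posn : forall n, In n -> int)
    (an : forall n, In n -> In n -> R[i]) (r : nat -> nat) :
  PsiEplus U V W a -> Mbi U V W A -> represents Posz a A halfline ->
  (forall n, represents (@posn n) (@an n) A (block (r n))) ->
  (\forall n \near \oo, inhabited (In n)) ->
  (forall K : nat, \forall n \near \oo, (K <= r n)%N) ->
  [/\ mxnorm p (@an n) @[n --> \oo] --> mxnorm p a,
      invnorm p (@an n) @[n --> \oo] --> invnorm p a
    & cond p (@an n) @[n --> \oo] --> cond p a].
Proof.
move=> ha AM rA rn In0 hr; have [mxE invE] := PsiEplus_norms ha.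
have cDn n : convex_set (block (r n)) by exact: convex_block.
have exhaust (N : nat) : \forall n \near \oo, forall i, (absz i <= N)%N ->
    (halfline i <-> block (r n) i).
  have [M _ hM] := hr N.+1; exists M => // n /hM /= h i iN.
  by rewrite /halfline /block/=; split; move: h; lia.
apply: (sections_cvg rA AM convex_halfline rn cDn In0 exhaust _ mxE invE).
by move=> n; exact: block_Nnorm.
Qed.

Lemma finsec_nat_cvg a (r : nat -> nat) : PsiEplus U V W a ->
  (forall K : nat, \forall n \near \oo, (K <= r n)%N) ->
  let An n := finsec a (D := window_plus (r n)) in
  [/\ mxnorm p (An n) @[n --> \oo] --> mxnorm p a,
      invnorm p (An n) @[n --> \oo] --> invnorm p a
    & cond p (An n) @[n --> \oo] --> cond p a].
Proof.
move=> ha hr An; have [A AM rA] := Mplus_extension ha.1.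
apply: (half_sections_cvg ha AM rA (fun n => represents_finsec_nat (r n) rA)) => //.
have [N _ hN] := hr 1%N; exists N => // n /hN /= h; constructor.
have w0 : window_plus (r n) 0%N by [].
exact: (SigSub (mem_set w0)).
Qed.

Let MN := (Mnorm U V W p * Nnorm U V W p)%E.

Lemma PsiE_cond A : PsiE U V W A -> cond p A = MN.
Proof. by move=> hA; rewrite cond_Mbi; [have [-> ->] := PsiE_norms hA|exact: hA.1]. Qed.

Lemma PsiEplus_cond a : PsiEplus U V W a -> cond p a = MN.
Proof. by move=> ha; rewrite cond_Mplus; [have [-> ->] := PsiEplus_norms ha|exact: ha.1]. Qed.

Lemma max_cond_Mbi : is_max [set cond p B | B in Mbi U V W] MN.
Proof.
have [A AM [hA _]] := pseudoergodic_ex U0 V0 W0.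
split; first by exists A => //; exact: PsiE_cond.
move=> _ [B BM <-]; rewrite cond_Mbi//; apply: lee_pmul.
- exact: (mxnorm_ge0 p1 B (inhabits 0)).
- exact: (invnorm_ge0 p1 B (inhabits 0)).
- by apply: ereal_sup_ubound; exists B.
- by apply: ereal_sup_ubound; exists B.
Qed.

Lemma max_cond_Mplus : is_max [set cond p B | B in Mplus U V W] MN.
Proof.
have [A AM [_ hA]] := pseudoergodic_ex U0 V0 W0.
split; first by eexists; [exact: hA.1|exact: PsiEplus_cond].
move=> _ [B BM <-]; rewrite cond_Mplus//; have [A' AM' rA'] := Mplus_extension BM.
apply: lee_pmul.
- exact: (mxnorm_ge0 p1 B (inhabits 0%N)).
- exact: (invnorm_ge0 p1 B (inhabits 0%N)).
- exact: (mxnorm_le_Mnorm p1 rA' AM').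
- rewrite -(favourable_sup fav_p).
  by apply: ereal_sup_ubound; exists B.
Qed.

(** Every finite matrix is a block of a member of [Mbi], which [block_Nnorm] bounds. Conversely, the
    leading sections of one pseudoergodic half-line matrix are finite matrices whose condition
    numbers converge to the product. *)
Lemma sup_fin_conds : ereal_sup (fin_conds U V W p) = MN.
Proof.
apply/eqP; rewrite eq_le; apply/andP; split.
  apply: ge_ereal_sup => _ [n /= n0 [F FM <-]].
  have posinj : injective (fun i : 'I_n => (i : nat)%:Z) by move=> i j [] /val_inj.
  have [A AM rA] := extension_ex U0 V0 W0 posinj FM.
  have rangeE : range (fun i : 'I_n => (i : nat)%:Z) = block n.
    by have [] := represents_block n A.
  rewrite rangeE in rA.
  rewrite (represents_cond p1 rA AM (@convex_block n)).
  have In : inhabited 'I_n by constructor; exact: (Ordinal n0).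
  apply: lee_pmul.
  - exact: mxnorm_ge0.
  - exact: invnorm_ge0.
  - exact: (mxnorm_le_Mnorm p1 rA AM).
  - rewrite npE; apply/(represents_invnormP p1 rA AM) => //.
      exact: convex_block.
    exact: block_Nnorm.
have [A AM [_ ha]] := pseudoergodic_ex U0 V0 W0.
pose F n : 'M[R[i]]_n.+1 := \matrix_(i, j) A (i : nat)%:Z (j : nat)%:Z.
have rF n : represents (fun i : 'I_n.+1 => (i : nat)%:Z) (fun_of_matrix (F n)) A (block n.+1).
  have [h1 h2 _] := represents_block n.+1 A; split; [exact: h1|exact: h2|] => i j.
  by rewrite mxE.
have [||_ _ hc] := half_sections_cvg (r := succn) ha AM (represents_nat A) rF.
- by exists 0%N => // n _; constructor; exact: ord0.
- by move=> K; exists K => // n /=; lia.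
rewrite -(PsiEplus_cond ha); apply: (cvge_le _ hc); exists 0%N => // n _ /=.
apply: ereal_sup_ubound; exists n.+1 => //=; exists (F n) => //.
by move=> i j; rewrite mxE; exact: (AM (i : nat)%:Z (j : nat)%:Z).
Qed.

End FavourablePair.
End Main.

Unset Implicit Arguments.

Theorem proposition4p11 (R : realType) (U V W : set R[i])
  (U0 : U !=set0) (V0 : V !=set0) (W0 : W !=set0)
  (cU : compact (U : set R[i]^o)) (cV : compact (V : set R[i]^o))
  (cW : compact (W : set R[i]^o))
  (hcompat : compatible U V W) (hkappa : kappa_is U V W 0)
  (p q : \bar R) (p1 : (1 <= p)%E) (q1 : (1 <= q)%E)
  (pq : (p^-1 + q^-1 = 1)%E)
  (fav_p : favourable U V W p) (fav_q : favourable U V W q) :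
  (* the finite section methods apply, on every l^s *)
  (forall (s : \bar R), (1 <= s)%E ->
     (forall (A : int -> int -> R[i]) (l r : nat -> int), PsiE U V W A ->
        (forall K : int, \forall n \near \oo, l n <= K) ->
        (forall K : int, \forall n \near \oo, K <= r n) ->
        fsm_applies s A (fun n => window (l n) (r n))) /\
     (forall (Ap : nat -> nat -> R[i]) (r : nat -> nat), PsiEplus U V W Ap ->
        (forall K : nat, \forall n \near \oo, (K <= r n)%N) ->
        fsm_applies s Ap (fun n => window_plus (r n)))) /\
  (* norms, inverse norms and condition numbers of the finite sections *)
  (forall (A : int -> int -> R[i]) (Ap : nat -> nat -> R[i]),
     PsiE U V W A -> PsiEplus U V W Ap ->
     [/\ mxnorm p A = mxnorm p Ap /\ mxnorm p Ap = Mnorm U V W p,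
         invnorm p A = invnorm p Ap /\ invnorm p Ap = Nnorm U V W p,
         cond p A = cond p Ap,
         (forall l r : nat -> int,
            (forall K : int, \forall n \near \oo, l n <= K) ->
            (forall K : int, \forall n \near \oo, K <= r n) ->
            let An n := finsec A (D := window (l n) (r n)) in
            [/\ mxnorm p (An n) @[n --> \oo] --> mxnorm p A,
                invnorm p (An n) @[n --> \oo] --> invnorm p A
              & cond p (An n) @[n --> \oo] --> cond p A])
       & (forall r : nat -> nat,
            (forall K : nat, \forall n \near \oo, (K <= r n)%N) ->
            let An n := finsec Ap (D := window_plus (r n)) in
            [/\ mxnorm p (An n) @[n --> \oo] --> mxnorm p Ap,
                invnorm p (An n) @[n --> \oo] --> invnorm p Ap
              & cond p (An n) @[n --> \oo] --> cond p Ap])]) /\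
  (* maximal condition numbers *)
  (let MN := (Mnorm U V W p * Nnorm U V W p)%E in
   [/\ is_max [set cond p B | B in Mbi U V W] MN,
       is_max [set cond p B | B in Mplus U V W] MN,
       ereal_sup (fin_conds U V W p) = MN,
       forall A, PsiE U V W A -> cond p A = MN
     & forall Ap, PsiEplus U V W Ap -> cond p Ap = MN]).
Proof.
have injZ : injective_Z U V W by exact: compatible_injective_Z.
have inj := injective_half_UVW U0 V0 W0 cU cV cW hcompat hkappa.
have inj' := injective_half_WVU U0 V0 W0 cU cV cW hcompat hkappa.
have [np np0 npE] := Nnorm_fin U0 V0 W0 cU cV cW injZ inj inj' p1.
split.
  move=> s s1; split=> [A l r hA hl hr|a r ha hr].
    by apply: (fsm_applies_int (U := U) (V := V) (W := W)) => //; exact: hA.1.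
  by apply: (fsm_applies_nat (U := U) (V := V) (W := W)) => //; exact: ha.1.
split.
  move=> A a hA ha.
  have [mA nA] := PsiE_norms U0 V0 W0 cU cV cW injZ inj inj' p1 hA.
  have [ma na] := PsiEplus_norms U0 V0 W0 cU cV cW p1 fav_p ha.
  split.
  - by rewrite mA ma.
  - by rewrite nA na.
  - by rewrite (PsiE_cond U0 V0 W0 cU cV cW injZ inj inj' p1 hA)
      (PsiEplus_cond U0 V0 W0 cU cV cW injZ inj inj' p1 fav_p ha).
  - move=> l r hl hr.
    exact: (finsec_int_cvg U0 V0 W0 cU cV cW injZ inj inj' p1 q1 pq fav_p fav_q np0 npE hA hl hr).
  - move=> r hr.
    exact: (finsec_nat_cvg U0 V0 W0 cU cV cW injZ inj inj' p1 q1 pq fav_p fav_q np0 npE ha hr).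
split.
- exact: (max_cond_Mbi U0 V0 W0 cU cV cW injZ inj inj' p1).
- exact: (max_cond_Mplus U0 V0 W0 cU cV cW injZ inj inj' p1 fav_p).
- exact: (sup_fin_conds U0 V0 W0 cU cV cW injZ inj inj' p1 q1 pq fav_p fav_q np0 npE).
- by move=> A; exact: (PsiE_cond U0 V0 W0 cU cV cW injZ inj inj' p1).
- by move=> a; exact: (PsiEplus_cond U0 V0 W0 cU cV cW injZ inj inj' p1 fav_p).
Qed.
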